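(* Let $s>1/6$ and $T>0$. Suppose $u,\tilde u\in C([0,T];H^s(\mathbb T))$ are real-valued solutions, in the sense of distributions on $(0,T)\times\mathbb T$, of the Benjamin–Ono equation $$\partial_t u=-\mathcal H\partial_x^2u+\partial_x(u^2),\qquad (t,x)\in(0,T)\times\mathbb T,$$ satisfying $u(0)=\tilde u(0)$. Then $u=\tilde u$ on $[0,T]$.
   Context: $\mathbb T=\mathbb R/2\pi\mathbb Z$. The periodic Hilbert transform $\mathcal H$ is the Fourier multiplier with symbol $-i\,\mathrm{sgn}(n)\mathbf 1_{\{n\neq0\}}$, where Fourier coefficients are $\hat f(n)=\frac1{2\pi}\int_0^{2\pi}f(x)e^{-inx}\,dx$. $H^s(\mathbb T)$ is the usual $L^2$-based Sobolev space on the torus. *)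

(* Defs.v *)
From Stdlib Require Import Reals ZArith.
Open Scope R_scope.

Definition Cx : Type := (R * R)%type.
Definition Cadd (z w : Cx) : Cx := (fst z + fst w, snd z + snd w).
Definition Csub (z w : Cx) : Cx := (fst z - fst w, snd z - snd w).
Definition Cmul (z w : Cx) : Cx :=
  (fst z * fst w - snd z * snd w, fst z * snd w + snd z * fst w).
Definition Cscal (r : R) (z : Cx) : Cx := (r * fst z, r * snd z).
Definition Cconj (z : Cx) : Cx := (fst z, - snd z).
Definition Cnorm2 (z : Cx) : R := fst z * fst z + snd z * snd z.

(** A function on T = R/2piZ is represented by its Fourier coefficients
    c : Z -> Cx, with c n = (1/2pi) int_0^{2pi} f(x) e^{-inx} dx. *)

Definition Zsum_cv (f : Z -> R) (l : R) : Prop :=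
  Un_cv (fun M : nat =>
           sum_f_R0 (fun m : nat => f (Z.of_nat m - Z.of_nat M)%Z) (2 * M)) l.

Definition Hs_weight (s : R) (n : Z) : R := Rpower (1 + IZR n ^ 2) s.

Definition in_Hs (s : R) (c : Z -> Cx) : Prop :=
  exists l, Zsum_cv (fun k => Hs_weight s k * Cnorm2 (c k)) l.

Definition real_valued (c : Z -> Cx) : Prop :=
  forall k : Z, c (- k)%Z = Cconj (c k).

Definition CHs_real (s T : R) (u : R -> Z -> Cx) : Prop :=
  (forall t, 0 <= t <= T -> in_Hs s (u t) /\ real_valued (u t)) /\
  (forall t0, 0 <= t0 <= T -> forall eps, eps > 0 ->
     exists delta, delta > 0 /\
       forall t, 0 <= t <= T -> Rabs (t - t0) < delta ->
         exists l, Zsum_cv (fun k => Hs_weight s k * Cnorm2 (Csub (u t k) (u t0 k))) l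
                   /\ l < eps).

Definition smooth_seq (d : nat -> R -> R) : Prop :=
  forall (k : nat) (x : R), derivable_pt_lim (d k) x (d (S k) x).

Definition supp_in (T : R) (phi : R -> R) : Prop :=
  exists a b, 0 < a /\ a < b /\ b < T /\
    forall t, (t <= a \/ b <= t) -> phi t = 0.

Definition weak_deriv (T : R) (f g : R -> R) : Prop :=
  forall d : nat -> R -> R, smooth_seq d -> supp_in T (d 0%nat) ->
    exists (p1 : Riemann_integrable (fun t => f t * d 1%nat t) 0 T)
           (p2 : Riemann_integrable (fun t => g t * d 0%nat t) 0 T),
      RiemannInt p1 = - RiemannInt p2.

(** u solves d_t u = - H d_x^2 u + d_x (u^2) in D'((0,T) x T), expressed
    mode by mode: with N n t = (u(t)^2)^(n) = sum_k u_k u_{n-k},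
    d_t u_n = -i n|n| u_n + i n N_n = i (n N_n - n|n| u_n). *)
Definition BO_sol (T : R) (u : R -> Z -> Cx) : Prop :=
  exists N : Z -> R -> Cx,
    (forall (n : Z) (t : R), 0 <= t <= T ->
       Zsum_cv (fun k => fst (Cmul (u t k) (u t (n - k)%Z))) (fst (N n t)) /\
       Zsum_cv (fun k => snd (Cmul (u t k) (u t (n - k)%Z))) (snd (N n t))) /\
    (forall n : Z,
       let G := fun t => Cadd (Cscal (IZR n) (N n t))
                              (Cscal (- (IZR n * IZR (Z.abs n))) (u t n)) in
       weak_deriv T (fun t => fst (u t n)) (fun t => - snd (G t)) /\
       weak_deriv T (fun t => snd (u t n)) (fun t => fst (G t))).

(* Main.v *)
(** Gérard's explicit formula for the Benjamin-Ono equation, in a form that survives for rough solutions.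
    Let q be the truncation of u to frequencies at most N, T_q its Toeplitz operator on the Hardy
    space, M = 2D + 1 - 2T_q, A the second Lax operator, S the backward shift and x the vector of
    nonnegative modes of q.  Up to truncation errors M' = [A, M], x' = A x and [A, S] = iMS, so that
    y = (e^{i(t - t0)M} S)^n x satisfies y' = A y; as the zeroth row of A vanishes, the zeroth
    coordinate of y is constant.  At t = t0 it is the n-th mode of u(t0), and at t = 0 it depends on
    u(0) only.

    The truncation error is a trilinear sum over resonant triples of frequencies, one of which
    exceeds N.  For s > 1/6 it is a vanishing multiple (as N grows) of the product of norms with
    weight n^{1+s}.  To stay in these spaces the exponential is replaced by J_b^2 J_a^m J_b^2, where
    J_c = (1 - icM)^{-1} and a = (t - t0)/m: the factors J_b gain the missing derivative, uniformly in
    a, m and N, and tend to the identity as b tends to 0.  All operators are cut to K x K matrices.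
    The limits are taken in the order K, N, m, b. *)
Require Import Defs.
From Stdlib Require Import Reals ZArith Lra Lia.
From Coquelicot Require Coquelicot.
Open Scope R_scope.

(** Two facts shape the estimates. The Lax commutator is exact on half-infinite matrices: in
    [A, T_q] the products q+ q-, which alone could need negative row indices, cancel. Cutting to K x
    K therefore errs only in a corner of size N and in the last row. Second, the Lax error is
    estimated only as a bilinear form on vectors with weight n^{1+s}. Hence residuals are measured
    in the dual of that norm, and operators in front of a residual are moved to the test vector;
    both arguments of the form must be smooth, which is why a letter has J_b^2 at both ends.
    Resolvents of the hermitian M contract the plain l2 norm only, so weights are recovered from
    powers of M, which commute with all resolvents. The m factors J_a insert the Lax error m times,
    which is harmless once m is fixed before N; their derivative misses that of the exponential by a
    M^2 J_a, of order 1/m once J_b^2 has absorbed M^2. A distributional solution must first become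
    classical: the modes of u^2 are continuous in time, so every mode of u is differentiable, and
    the words are differentiable functions of finitely many modes. *)

Module RealAnalysis.
Import Coquelicot.Coquelicot.

(** * Distributional derivatives of continuous functions *)

(** The flat function exp(-1/x), times a power of 1/x. [smooth_seq] asks for every derivative
    explicitly, and this family is closed under differentiation up to linear combinations. *)
Definition flat (k : nat) (x : R) : R :=
  if Rle_dec x 0 then 0 else (/ x) ^ k * exp (- / x).

(** A single term of the exponential series, y^(k+1)/(k+1)!, is at most exp y. *)
Lemma pow_exp_small (k : nat) (y : R) : 0 < y -> y ^ k * exp (- y) <= INR (fact (S k)) / y.
Proof.
  intros Hy.
  assert (H : y ^ S k / INR (fact (S k)) <= exp y).
  { destruct (exist_exp y) as [l Hl] eqn:E.
    unfold exp; rewrite E; change (y ^ S k / INR (fact (S k)) <= l).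
    assert (Hs : Un_cv (sum_f_R0 (fun i => / INR (fact i) * y ^ i)) l) by exact Hl.
    assert (Hg : Un_growing (sum_f_R0 (fun i => / INR (fact i) * y ^ i))).
    { intros n. assert (0 <= / INR (fact (S n)) * y ^ S n); [|change (sum_f_R0 (fun i => / INR (fact i) * y ^ i) (S n)) with (sum_f_R0 (fun i => / INR (fact i) * y ^ i) n + / INR (fact (S n)) * y ^ S n); lra].
      apply Rmult_le_pos; [left; apply Rinv_0_lt_compat, INR_fact_lt_0 | apply pow_le; lra]. }
    apply Rle_trans with (sum_f_R0 (fun i => / INR (fact i) * y ^ i) (S k)).
    2: apply (growing_ineq _ _ Hg Hs).
    rewrite tech5. assert (0 <= sum_f_R0 (fun i : nat => / INR (fact i) * y ^ i) k).
    { apply cond_pos_sum; intros n. apply Rmult_le_pos; [left; apply Rinv_0_lt_compat, INR_fact_lt_0 | apply pow_le; lra]. }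
    unfold Rdiv; rewrite (Rmult_comm (y ^ S k)); lra. }
  assert (Hf := INR_fact_lt_0 (S k)).
  rewrite exp_Ropp.
  apply Rmult_le_reg_r with (exp y); [apply exp_pos|].
  rewrite Rmult_assoc, Rinv_l, Rmult_1_r by (apply Rgt_not_eq, exp_pos).
  apply Rmult_le_reg_r with (y / INR (fact (S k))).
  { apply Rdiv_lt_0_compat; lra. }
  replace (y ^ k * (y / INR (fact (S k)))) with (y ^ S k / INR (fact (S k))) by (rewrite <- tech_pow_Rmult; field; lra).
  replace (INR (fact (S k)) / y * exp y * (y / INR (fact (S k)))) with (exp y); [exact H|].
  field; split; lra.
Qed.

Lemma flat_ge0 k x : 0 <= flat k x.
Proof.
  unfold flat; destruct (Rle_dec x 0); [lra|].
  apply Rmult_le_pos; [apply pow_le; left; apply Rinv_0_lt_compat; lra | left; apply exp_pos].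
Qed.

(** Second order vanishing makes the difference quotient at 0 tend to 0, whatever the power of 1/x.
    It is [pow_exp_small] at 1/x, with exponent k+1 instead of k. *)
Lemma flat_quadratic k x : flat k x <= INR (fact (S (S k))) * x ^ 2.
Proof.
  unfold flat; destruct (Rle_dec x 0) as [_|Hx].
  { apply Rmult_le_pos; [left; apply INR_fact_lt_0 | apply pow2_ge_0]. }
  assert (Hx0 : 0 < x) by lra.
  assert (Hi := Rinv_0_lt_compat _ Hx0).
  assert (H := pow_exp_small (S k) (/ x) Hi).
  rewrite <- tech_pow_Rmult in H.
  apply Rmult_le_reg_r with (/ x); [exact Hi|].
  eapply Rle_trans; [|eapply Rle_trans; [exact H|]].
  - right; ring.
  - right; field; lra.
Qed.

Lemma flat_der k x :
  derivable_pt_lim (flat k) x (- INR k * flat (S k) x + flat (S (S k)) x).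
Proof.
  apply is_derive_Reals.
  destruct (Rlt_le_dec 0 x) as [Hx|Hx].
  - apply is_derive_ext_loc with (fun y => (/ y) ^ k * exp (- / y)).
    { exists (mkposreal x Hx); intros y Hy.
      unfold ball, AbsRing_ball, flat; simpl in Hy.
      unfold ball in Hy; simpl in Hy; unfold AbsRing_ball, abs, minus, plus, opp in Hy; simpl in Hy.
      apply Rabs_def2 in Hy. destruct (Rle_dec y 0); [lra | reflexivity]. }
    unfold flat; destruct (Rle_dec x 0); [lra|].
    auto_derive; [repeat split; lra|].
    destruct k as [|k]; simpl pred.
    + simpl; field; lra.
    + rewrite S_INR; simpl; field; lra.
  - apply is_derive_Reals.
    assert (Hz : forall j, flat j x = 0).
    { intros j; unfold flat; destruct (Rle_dec x 0); [reflexivity|lra]. }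
    rewrite !Hz. replace (- INR k * 0 + 0) with 0 by ring.
    (* The cases x < 0 and x = 0 together: [flat k (x + h)] is 0, or else 0 < x + h <= h and the
       quadratic bound applies. *)
    intros eps Heps.
    assert (HC := INR_fact_lt_0 (S (S k))).
    assert (Hd : 0 < eps / INR (fact (S (S k)))) by (apply Rdiv_lt_0_compat; lra).
    exists (mkposreal _ Hd); intros h Hh0 Hh; simpl in Hh.
    rewrite Hz, !Rminus_0_r.
    assert (H1 : Rabs (flat k (x + h)) <= INR (fact (S (S k))) * h ^ 2).
    { rewrite Rabs_right by (apply Rle_ge, flat_ge0).
      destruct (Rle_dec (x + h) 0) as [Hn|Hn].
      - replace (flat k (x + h)) with 0.
        + apply Rmult_le_pos; [lra | apply pow2_ge_0].
        + unfold flat; destruct (Rle_dec (x + h) 0); [reflexivity|lra].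
      - eapply Rle_trans; [apply flat_quadratic|].
        apply Rmult_le_compat_l; [lra|]. apply pow_incr; lra. }
    unfold Rdiv; rewrite Rabs_mult, Rabs_inv.
    assert (Hp : 0 < Rabs h) by (apply Rabs_pos_lt; exact Hh0).
    apply Rmult_lt_reg_r with (Rabs h); [exact Hp|].
    rewrite Rmult_assoc, Rinv_l, Rmult_1_r by lra.
    eapply Rle_lt_trans; [exact H1|].
    rewrite <- Rsqr_pow2, (Rsqr_abs h); unfold Rsqr.
    rewrite <- Rmult_assoc. apply Rmult_lt_compat_r; [exact Hp|].
    apply Rmult_lt_reg_r with (/ INR (fact (S (S k)))); [apply Rinv_0_lt_compat; lra|].
    replace (INR (fact (S (S k))) * Rabs h * / INR (fact (S (S k)))) with (Rabs h) by (field; lra).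
    exact Hh.
Qed.

(** The n-th derivative of [flat k], by n applications of the rule in [flat_der]. *)
Fixpoint flat_seq (n k : nat) (x : R) : R :=
  match n with
  | O => flat k x
  | S n => - INR k * flat_seq n (S k) x + flat_seq n (S (S k)) x
  end.

Lemma flat_seq_der n k x : derivable_pt_lim (flat_seq n k) x (flat_seq (S n) k x).
Proof.
  revert k; induction n as [|n IH]; intros k; [apply flat_der|].
  apply derivable_pt_lim_plus; [apply (derivable_pt_lim_scal (flat_seq n (S k)))|]; apply IH.
Qed.

Lemma smooth_flat : smooth_seq (fun n => flat_seq n 0).
Proof. intros n x; apply flat_seq_der. Qed.

(** Leibniz' rule left unexpanded: the n-th derivative of a product, from the sequences of
    derivatives of its factors. *)
Fixpoint prod_seq (n : nat) (d e : nat -> R -> R) (x : R) : R :=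
  match n with
  | O => d O x * e O x
  | S n => prod_seq n (fun i => d (S i)) e x + prod_seq n d (fun i => e (S i)) x
  end.

Lemma smooth_prod d e : smooth_seq d -> smooth_seq e -> smooth_seq (fun n => prod_seq n d e).
Proof.
  intros Hd He n; revert d e Hd He; induction n as [|n IH]; intros d e Hd He x.
  - apply derivable_pt_lim_mult; [apply Hd | apply He].
  - apply derivable_pt_lim_plus; [apply (IH (fun i => d (S i)) e) | apply (IH d (fun i => e (S i)))];
      try assumption; intros k y; [apply Hd | apply He].
Qed.

Lemma smooth_affine d (c b : R) : smooth_seq d ->
  smooth_seq (fun n x => c ^ n * d n (c * x + b)).
Proof.
  intros Hd n x. apply is_derive_Reals.
  assert (H := proj2 (is_derive_Reals _ _ _) (Hd n (c * x + b))).
  replace (c ^ S n * d (S n) (c * x + b)) with (scal (c ^ n) (scal c (d (S n) (c * x + b)))).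
  2: { unfold scal; simpl; unfold mult; simpl; ring. }
  apply (is_derive_scal (fun y => d n (c * y + b))).
  apply (is_derive_comp (d n) (fun y => c * y + b)); [exact H|].
  auto_derive; [exact I | ring].
Qed.

(** The bump exp(-1/(x-a)) exp(-1/(b-x)) on [a,b], with its derivatives. *)
Definition cutoff (a b : R) (n : nat) : R -> R :=
  prod_seq n (fun n x => 1 ^ n * flat_seq n 0 (1 * x + - a)) (fun n x => (-1) ^ n * flat_seq n 0 (-1 * x + b)).

Lemma smooth_cutoff a b : smooth_seq (cutoff a b).
Proof. apply smooth_prod; apply (smooth_affine (fun n => flat_seq n 0)); exact smooth_flat. Qed.

Lemma cutoff_out a b x : x <= a \/ b <= x -> cutoff a b 0 x = 0.
Proof.
  unfold cutoff; simpl. unfold flat. intros [H|H].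
  - destruct (Rle_dec (1 * x + - a) 0); [ring|lra].
  - destruct (Rle_dec (-1 * x + b) 0); [ring|lra].
Qed.

Lemma cutoff_pos a b x : a < x < b -> 0 < cutoff a b 0 x.
Proof.
  unfold cutoff; simpl. unfold flat. intros H.
  destruct (Rle_dec (1 * x + - a) 0); [lra|].
  destruct (Rle_dec (-1 * x + b) 0); [lra|].
  rewrite !Rmult_1_l. apply Rmult_lt_0_compat; simpl; rewrite ?Rmult_1_l; apply exp_pos.
Qed.

Lemma cutoff_ge0 a b x : 0 <= cutoff a b 0 x.
Proof.
  destruct (Rle_dec x a) as [H|H]; [rewrite cutoff_out; lra|].
  destruct (Rle_dec b x) as [H'|H']; [rewrite cutoff_out; lra|].
  left; apply cutoff_pos; lra.
Qed.

Lemma smooth_continuous d n x : smooth_seq d -> continuous (d n) x.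
Proof.
  intros Hd. apply (ex_derive_continuous (d n)).
  exists (d (S n) x). apply is_derive_Reals, Hd.
Qed.

Lemma continuous_ex_RInt (h : R -> R) a b : (forall x, continuous h x) -> ex_RInt h a b.
Proof. intros H. apply (ex_RInt_continuous h). intros z _; apply H. Qed.

Lemma RInt_pos (k : R -> R) T p q : (forall x, continuous k x) -> (forall x, 0 <= k x) ->
  0 < p -> p < q -> q < T -> (forall x, p < x < q -> 0 < k x) -> 0 < RInt k 0 T.
Proof.
  intros Hc H0 Hp Hpq Hq Hpos.
  assert (E := fun a b => continuous_ex_RInt k a b Hc).
  rewrite <- (RInt_Chasles k 0 p T), <- (RInt_Chasles k p q T) by apply E.
  unfold plus; simpl.
  assert (0 <= RInt k 0 p) by (apply RInt_ge_0; [lra | apply E | intros; apply H0]).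
  assert (0 <= RInt k q T) by (apply RInt_ge_0; [lra | apply E | intros; apply H0]).
  assert (0 < RInt k p q) by (apply RInt_gt_0; [lra | exact Hpos | intros; apply Hc]).
  lra.
Qed.

Lemma RInt_zero (k : R -> R) a b : (forall x, Rmin a b < x < Rmax a b -> k x = 0) -> RInt k a b = 0.
Proof.
  intros H. rewrite (RInt_ext k (fun _ => 0)) by exact H.
  rewrite RInt_const. unfold scal; simpl; unfold mult; simpl; ring.
Qed.

(** The distributional derivative of h on (0,T) is zero. *)
Definition annihilates T (h : R -> R) : Prop := forall d, smooth_seq d -> supp_in T (d 0%nat) ->
  RInt (fun t => h t * d 1%nat t) 0 T = 0.

Lemma continuous_eps (h : R -> R) x : continuous h x -> forall eps, 0 < eps ->
  exists delta, 0 < delta /\ forall y, Rabs (y - x) < delta -> Rabs (h y - h x) < eps.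
Proof.
  intros H eps He.
  destruct (proj1 (filterlim_locally h (h x)) H (mkposreal _ He)) as [d Hd].
  exists d; split; [apply cond_pos|]. intros y Hy; apply Hd; exact Hy.
Qed.

(** If h a > h b, a bump near a minus a multiple of a bump near b has integral 0 and is the
    derivative of a test function, so h integrates to 0 against it. But with c midway between the
    two values, h > c on the first bump and h < c on the second, which makes this integral
    positive. *)
Lemma annihilates_le T h a b : (forall x, continuous h x) -> annihilates T h ->
  0 < a < T -> 0 < b < T -> h a <= h b.
Proof.
  intros Hc Hann Ha Hb. apply Rnot_lt_le; intros Hlt.
  set (c := (h a + h b) / 2).
  destruct (continuous_eps h a (Hc a) (h a - c)) as [d1 [Hd1 H1]]; [unfold c; lra|].
  destruct (continuous_eps h b (Hc b) (c - h b)) as [d2 [Hd2 H2]]; [unfold c; lra|].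
  set (e := Rmin (Rmin d1 d2) (Rmin (Rmin a (T - a)) (Rmin b (T - b))) / 2).
  assert (He : 0 < e /\ e < d1 /\ e < d2 /\ e < a /\ e < T - a /\ e < b /\ e < T - b).
  { assert (Hm : 0 < Rmin (Rmin d1 d2) (Rmin (Rmin a (T - a)) (Rmin b (T - b)))).
    { repeat apply Rmin_pos; lra. }
    assert (A1 := Rmin_l (Rmin d1 d2) (Rmin (Rmin a (T - a)) (Rmin b (T - b)))).
    assert (A2 := Rmin_r (Rmin d1 d2) (Rmin (Rmin a (T - a)) (Rmin b (T - b)))).
    assert (A3 := Rmin_l d1 d2). assert (A4 := Rmin_r d1 d2).
    assert (A5 := Rmin_l (Rmin a (T - a)) (Rmin b (T - b))).
    assert (A6 := Rmin_r (Rmin a (T - a)) (Rmin b (T - b))).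
    assert (A7 := Rmin_l a (T - a)). assert (A8 := Rmin_r a (T - a)).
    assert (A9 := Rmin_l b (T - b)). assert (A10 := Rmin_r b (T - b)).
    unfold e; lra. }
  clearbody e. destruct He as (He & Hed1 & Hed2 & Hea & HeTa & Heb & HeTb).
  set (p1 := cutoff (a - e) (a + e)). set (p2 := cutoff (b - e) (b + e)).
  assert (C1 : forall n x, continuous (p1 n) x) by (intros; apply smooth_continuous, smooth_cutoff).
  assert (C2 : forall n x, continuous (p2 n) x) by (intros; apply smooth_continuous, smooth_cutoff).
  assert (I1 : 0 < RInt (p1 O) 0 T).
  { apply RInt_pos with (a - e) (a + e); try lra; [apply C1 | apply cutoff_ge0 | apply cutoff_pos]. }
  assert (I2 : 0 < RInt (p2 O) 0 T).
  { apply RInt_pos with (b - e) (b + e); try lra; [apply C2 | apply cutoff_ge0 | apply cutoff_pos]. }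
  set (l := RInt (p1 O) 0 T / RInt (p2 O) 0 T).
  assert (Hl : 0 < l) by (apply Rdiv_lt_0_compat; lra).
  set (psi := fun n x => p1 n x + - l * p2 n x).
  assert (Cp : forall n x, continuous (psi n) x).
  { intros n x. apply (continuous_plus (p1 n) (fun x => - l * p2 n x)); [apply C1|].
    apply (continuous_scal_r (- l) (p2 n)), C2. }
  assert (Zp : RInt (psi O) 0 T = 0).
  { unfold psi. rewrite (RInt_plus (p1 O) (fun x => - l * p2 O x)).
    - rewrite (RInt_scal (p2 O)) by (apply continuous_ex_RInt, C2).
      unfold plus, scal; simpl; unfold mult; simpl. unfold l; field; lra.
    - apply continuous_ex_RInt, C1.
    - apply (ex_RInt_scal (p2 O)), continuous_ex_RInt, C2. }
  set (lo := Rmin a b - e). set (hi := Rmax a b + e).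
  assert (Hlo : 0 < lo < hi /\ hi < T /\ lo <= a - e /\ lo <= b - e /\ a + e <= hi /\ b + e <= hi).
  { unfold lo, hi, Rmin, Rmax; destruct (Rle_dec a b); lra. }
  clearbody lo hi.
  assert (Op : forall x, x <= lo \/ hi <= x -> psi O x = 0).
  { intros x Hx; unfold psi, p1, p2. rewrite !cutoff_out by lra. ring. }
  (* Because [psi] has integral 0, its primitive vanishes again to the right of [hi] and is a test
     function. *)
  set (d := fun n x => match n with O => RInt (psi O) 0 x | S n => psi n x end).
  assert (Sd : smooth_seq d).
  { intros [|n] x.
    - apply is_derive_Reals. simpl. apply is_derive_RInt with 0; [|apply Cp].
      apply filter_forall; intros y. apply (RInt_correct (psi O)), continuous_ex_RInt, Cp.
    - simpl. apply derivable_pt_lim_plus; [apply smooth_cutoff|].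
      apply (derivable_pt_lim_scal (p2 n)), smooth_cutoff. }
  assert (Dd : supp_in T (d O)).
  { exists lo, hi; repeat split; try lra. simpl. intros t [Ht|Ht].
    - apply RInt_zero; intros x Hx; apply Op; left.
      assert (Rmax 0 t <= lo) by (apply Rmax_lub; lra). lra.
    - rewrite <- (RInt_Chasles (psi O) 0 T t) by apply continuous_ex_RInt, Cp.
      rewrite Zp, (RInt_zero (psi O) T t); [unfold plus; simpl; ring|].
      intros x Hx; apply Op; right.
      assert (hi <= Rmin T t) by (apply Rmin_glb; lra). lra. }
  assert (Z := Hann d Sd Dd). simpl in Z.
  set (k := fun t => h t * psi O t + - c * psi O t).
  assert (Ck : forall x, continuous k x).
  { intros x. apply (continuous_plus (fun t => h t * psi O t) (fun t => - c * psi O t)).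
    - apply (continuous_mult h (psi O)); [apply Hc | apply Cp].
    - apply (continuous_scal_r (- c) (psi O)), Cp. }
  assert (P : 0 < RInt k 0 T).
  { assert (N1 : forall x, a - e < x < a + e -> c < h x).
    { intros x Hx. assert (A : Rabs (h x - h a) < h a - c) by (apply H1; apply Rabs_def1; lra).
      apply Rabs_def2 in A; lra. }
    assert (N2 : forall x, b - e < x < b + e -> h x < c).
    { intros x Hx. assert (A : Rabs (h x - h b) < c - h b) by (apply H2; apply Rabs_def1; lra).
      apply Rabs_def2 in A; lra. }
    assert (K1 : forall x, a - e < x < a + e -> 0 < k x).
    { intros x Hx. assert (B := N1 x Hx).
      (* The two bumps are disjoint, since h > c on one and h < c on the other. *)
      unfold k, psi. replace (p2 O x) with 0.
      - assert (Bp := cutoff_pos _ _ _ Hx). fold p1 in Bp.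
        replace (h x * (p1 O x + - l * 0) + - c * (p1 O x + - l * 0)) with ((h x - c) * p1 O x) by ring.
        apply Rmult_lt_0_compat; lra.
      - symmetry; apply cutoff_out. destruct (Rle_dec x (b - e)); [lra|].
        destruct (Rle_dec (b + e) x); [lra|]. assert (h x < c) by (apply N2; lra). lra. }
    apply RInt_pos with (a - e) (a + e); try lra; [exact Ck | | exact K1].
    intros x. destruct (Rlt_dec (a - e) x) as [X1|X1];
      [destruct (Rlt_dec x (a + e)) as [X2|X2]; [left; apply K1; lra|]|].
    1, 2: unfold k, psi; replace (p1 O x) with 0 by (symmetry; apply cutoff_out; lra);
      replace (h x * (0 + - l * p2 O x) + - c * (0 + - l * p2 O x)) with ((c - h x) * (l * p2 O x)) by ring;
      (destruct (Rlt_dec (b - e) x); [destruct (Rlt_dec x (b + e))|]);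
      [ assert (h x < c) by (apply N2; lra);
        apply Rmult_le_pos; [lra | apply Rmult_le_pos; [lra | apply cutoff_ge0]]
      | unfold p2; rewrite cutoff_out by lra; lra
      | unfold p2; rewrite cutoff_out by lra; lra ]. }
  unfold k in P. rewrite (RInt_plus (fun t => h t * psi O t) (fun t => - c * psi O t)) in P.
  - rewrite (RInt_scal (psi O)) in P by (apply continuous_ex_RInt, Cp).
    rewrite Zp in P. unfold plus, scal in P; simpl in P; unfold mult in P; simpl in P. lra.
  - apply continuous_ex_RInt; intros x.
    apply (continuous_mult h (psi O)); [apply Hc | apply Cp].
  - apply (ex_RInt_scal (psi O)), continuous_ex_RInt, Cp.
Qed.

Lemma annihilates_const T h : 0 < T -> (forall x, continuous h x) -> annihilates T h ->
  forall t, 0 <= t <= T -> h t = h (T / 2).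
Proof.
  intros HT Hc Hann t Ht.
  destruct (Req_dec (h t) (h (T / 2))) as [E|E]; [exact E|exfalso].
  assert (He : 0 < Rabs (h (T / 2) - h t)) by (apply Rabs_pos_lt; lra).
  destruct (continuous_eps h t (Hc t) _ He) as [d [Hd H]].
  set (mu := Rmin 1 (d / T)).
  assert (Hdt : 0 < d / T) by (apply Rdiv_lt_0_compat; lra).
  assert (Hmu : 0 < mu /\ mu <= 1 /\ mu * T <= d).
  { split; [apply Rmin_pos; lra|]. split; [apply Rmin_l|].
    apply Rle_trans with (d / T * T); [|right; field; lra].
    apply Rmult_le_compat_r; [lra | apply Rmin_r]. }
  clearbody mu. destruct Hmu as (M0 & M1 & M2).
  (* [annihilates_le] covers interior points only. Moving t slightly towards the midpoint gives an
     interior point, where h already has its midpoint value; continuity does the rest. *)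
  set (t' := t + mu * (T / 2 - t)).
  assert (Ht' : 0 < t' < T).
  { unfold t'. assert (0 <= (1 - mu) * t) by (apply Rmult_le_pos; lra).
    assert (0 <= (1 - mu) * (T - t)) by (apply Rmult_le_pos; lra).
    assert (0 < mu * T) by (apply Rmult_lt_0_compat; lra). split; lra. }
  assert (Hh : h t' = h (T / 2)).
  { apply Rle_antisym; apply annihilates_le with T; try assumption; lra. }
  assert (A : Rabs (t' - t) < d).
  { unfold t'. replace (t + mu * (T / 2 - t) - t) with (mu * (T / 2 - t)) by ring.
    rewrite Rabs_mult, (Rabs_right mu) by lra.
    apply Rle_lt_trans with (mu * (T / 2)).
    - apply Rmult_le_compat_l; [lra|]. apply Rabs_le; lra.
    - assert (0 < mu * T) by (apply Rmult_lt_0_compat; lra). lra. }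
  apply H in A. rewrite Hh in A. lra.
Qed.

Definition cont_on (T : R) (f : R -> R) : Prop :=
  forall t, 0 <= t <= T -> forall eps, 0 < eps -> exists delta, 0 < delta /\
    forall s, 0 <= s <= T -> Rabs (s - t) < delta -> Rabs (f s - f t) < eps.

(** Composition with it extends a function on [0,T] by its end values, so that integrals and
    primitives need no domain conditions. *)
Definition clamp (T x : R) : R := Rmax 0 (Rmin T x).

Lemma clamp_in T x : 0 < T -> 0 <= clamp T x <= T.
Proof. intros; unfold clamp, Rmax, Rmin; destruct (Rle_dec T x), (Rle_dec 0 _); lra. Qed.

Lemma clamp_id T x : 0 <= x <= T -> clamp T x = x.
Proof. intros; unfold clamp, Rmax, Rmin; destruct (Rle_dec T x), (Rle_dec 0 _); lra. Qed.

Lemma clamp_lip T x y : 0 < T -> Rabs (clamp T y - clamp T x) <= Rabs (y - x).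
Proof.
  intros; unfold clamp, Rmax, Rmin.
  destruct (Rle_dec T x), (Rle_dec T y); repeat (destruct (Rle_dec 0 _); try lra);
  unfold Rabs; destruct (Rcase_abs _), (Rcase_abs _); lra.
Qed.

Lemma clamp_continuous T f : 0 < T -> cont_on T f -> forall x, continuous (fun y => f (clamp T y)) x.
Proof.
  intros HT Hf x. apply filterlim_locally; intros eps.
  destruct (Hf (clamp T x) (clamp_in T x HT) eps (cond_pos eps)) as [d [Hd H]].
  exists (mkposreal d Hd); intros y Hy. apply H; [apply clamp_in, HT|].
  eapply Rle_lt_trans; [apply clamp_lip, HT | exact Hy].
Qed.

(* The lemma of du Bois-Reymond. *)
Theorem weak_deriv_strong T f g : 0 < T -> cont_on T f -> cont_on T g -> weak_deriv T f g ->
  forall t, 0 <= t <= T -> forall eps, 0 < eps -> exists delta, 0 < delta /\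
    forall s, 0 <= s <= T -> s <> t -> Rabs (s - t) < delta ->
      Rabs ((f s - f t) / (s - t) - g t) < eps.
Proof.
  intros HT Hf Hg Hw.
  set (fc := fun y => f (clamp T y)). set (gc := fun y => g (clamp T y)).
  assert (Cf : forall x, continuous fc x) by (apply clamp_continuous; assumption).
  assert (Cg : forall x, continuous gc x) by (apply clamp_continuous; assumption).
  set (G := RInt gc 0).
  assert (DG : forall x, is_derive G x (gc x)).
  { intros x. apply is_derive_RInt with 0; [|apply Cg].
    apply filter_forall; intros y. apply (RInt_correct gc), continuous_ex_RInt, Cg. }
  assert (CG : forall x, continuous G x).
  { intros x; apply (ex_derive_continuous G). exists (gc x); apply DG. }
  set (h := fun x => fc x + - G x).
  assert (Ch : forall x, continuous h x).
  { intros x; apply (continuous_plus fc (fun x => - G x)); [apply Cf|].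
    apply (continuous_opp G), CG. }
  assert (A : annihilates T h).
  { intros d Sd Dd.
    assert (C0 : forall n x, continuous (d n) x) by (intros; apply smooth_continuous, Sd).
    destruct (Hw d Sd Dd) as [p1 [p2 Hp]]. rewrite <- !RInt_Reals in Hp.
    rewrite (RInt_ext _ (fun t => fc t * d 1%nat t)) in Hp.
    2: { rewrite Rmin_left, Rmax_right by lra; intros x Hx; unfold fc; rewrite clamp_id; [reflexivity|lra]. }
    rewrite (RInt_ext (fun t => g t * d O t) (fun t => gc t * d O t)) in Hp.
    2: { rewrite Rmin_left, Rmax_right by lra; intros x Hx; unfold gc; rewrite clamp_id; [reflexivity|lra]. }
    assert (E1 : forall x, continuous (fun t => gc t * d O t) x)
      by (intros x; apply (continuous_mult gc (d O)); [apply Cg | apply C0]).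
    assert (E2 : forall x, continuous (fun t => G t * d 1%nat t) x)
      by (intros x; apply (continuous_mult G (d 1%nat)); [apply CG | apply C0]).
    assert (E3 : forall x, continuous (fun t => fc t * d 1%nat t) x)
      by (intros x; apply (continuous_mult fc (d 1%nat)); [apply Cf | apply C0]).
    assert (B : RInt (fun t => gc t * d O t + G t * d 1%nat t) 0 T = 0).
    { apply is_RInt_unique.
      replace 0 with (minus (G T * d O T) (G 0 * d O 0)) at 2.
      - apply (is_RInt_derive (fun t => G t * d O t)).
        + intros x _. apply (is_derive_mult G (d O)); [apply DG | apply is_derive_Reals, Sd | intros; apply Rmult_comm].
        + intros x _. apply (continuous_plus (fun t => gc t * d O t)); [apply E1 | apply E2].
      - destruct Dd as (a & b & H0 & H1 & H2 & H3).
        rewrite !H3 by lra. unfold minus, plus, opp; simpl; ring. }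
    rewrite (RInt_plus (fun t => gc t * d O t) (fun t => G t * d 1%nat t)) in B
      by (apply continuous_ex_RInt; assumption).
    unfold plus in B; simpl in B.
    rewrite (RInt_ext _ (fun t => plus (fc t * d 1%nat t) (opp (G t * d 1%nat t)))).
    2: { intros x _; unfold h, plus, opp; simpl; ring. }
    rewrite (RInt_plus (fun t => fc t * d 1%nat t) (fun t => opp (G t * d 1%nat t))).
    - rewrite (RInt_opp (fun t => G t * d 1%nat t)) by (apply continuous_ex_RInt; assumption).
      unfold plus, opp; simpl; lra.
    - apply continuous_ex_RInt; assumption.
    - apply (ex_RInt_opp (fun t => G t * d 1%nat t)), continuous_ex_RInt; assumption. }
  assert (K := annihilates_const T h HT Ch A).
  intros t Ht eps He.
  destruct (proj1 (is_derive_Reals _ _ _) (DG t) eps He) as [d Hd].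
  exists d; split; [apply cond_pos|]. intros s Hs Hst Hsd.
  assert (Hk := eq_trans (K s Hs) (eq_sym (K t Ht))).
  unfold h, fc in Hk; rewrite !clamp_id in Hk by assumption.
  specialize (Hd (s - t)). replace (t + (s - t)) with s in Hd by ring.
  replace (f s - f t) with (G s - G t) by lra.
  unfold gc in Hd; rewrite clamp_id in Hd by assumption.
  apply Hd; [lra | exact Hsd].
Qed.

End RealAnalysis.

(** * Power weights *)

(** The base n+1 keeps the weight positive at n = 0 and makes it submultiplicative for a >= 0: if k
    <= i + j then k+1 <= (i+1)(j+1). *)
Definition pw (a : R) (n : nat) : R := Rpower (INR (S n)) a.

Lemma pw_pos a n : 0 < pw a n.
Proof. apply exp_pos. Qed.

Lemma pw_plus a b n : pw (a + b) n = pw a n * pw b n.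
Proof. apply Rpower_plus. Qed.

Lemma pw_0 n : pw 0 n = 1.
Proof. apply Rpower_O, lt_0_INR; lia. Qed.

Lemma pw_1 n : pw 1 n = INR (S n).
Proof. apply Rpower_1, lt_0_INR; lia. Qed.

Lemma INR_S_ge1 n : 1 <= INR (S n).
Proof. change 1 with (INR 1); apply le_INR; lia. Qed.

Lemma pw_le_exp a b n : a <= b -> pw a n <= pw b n.
Proof.
  intros H. destruct n as [|n].
  - unfold pw, Rpower; simpl. rewrite ln_1, !Rmult_0_r; lra.
  - apply Rle_Rpower; [|exact H]. apply INR_S_ge1.
Qed.

Lemma pw_mono a m n : 0 <= a -> (m <= n)%nat -> pw a m <= pw a n.
Proof.
  intros Ha H. apply Rle_Rpower_l; [exact Ha|]. split; [apply lt_0_INR; lia | apply le_INR; lia].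
Qed.

Lemma pw_ge1 a n : 0 <= a -> 1 <= pw a n.
Proof. intros Ha. rewrite <- (pw_0 n). apply pw_le_exp, Ha. Qed.

Lemma pw_opp a n : pw (- a) n = / pw a n.
Proof. apply Rpower_Ropp. Qed.

Lemma pw_submult a i j k : 0 <= a -> (k <= i + j)%nat -> pw a k <= pw a i * pw a j.
Proof.
  intros Ha H. unfold pw. rewrite Rpower_mult_distr by (apply lt_0_INR; lia).
  apply Rle_Rpower_l; [exact Ha|]. split; [apply lt_0_INR; lia|].
  rewrite <- mult_INR; apply le_INR; lia.
Qed.

Lemma pw_infty a e : 0 < a -> 0 < e -> exists N, forall n, (N <= n)%nat -> pw (- a) n <= e.
Proof.
  intros Ha He.
  destruct (INR_archimed 1 (Rpower (/ e) (/ a)) Rlt_0_1) as [N HN].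
  exists N; intros n Hn. rewrite Rmult_1_r in HN. rewrite pw_opp.
  rewrite <- (Rinv_inv e). apply Rinv_le_contravar; [apply Rinv_0_lt_compat, He|].
  apply Rle_trans with (Rpower (Rpower (/ e) (/ a)) a).
  - rewrite Rpower_mult, Rinv_l by lra. rewrite Rpower_1 by (apply Rinv_0_lt_compat, He). lra.
  - apply Rle_Rpower_l; [lra|]. split; [apply exp_pos|].
    apply Rle_trans with (INR N); [lra | apply le_INR; lia].
Qed.

(** Comparison with the integral of x^(-1-e), using ln(y+1) - ln y >= 1/(y+1) and exp x >= 1 + x
    with y = n+1. *)
Lemma pw_telescope e n : 0 < e -> e * pw (- (1 + e)) (S n) <= pw (- e) n - pw (- e) (S n).
Proof.
  intros He.
  set (y := INR (S n)). assert (Hy : 1 <= y) by apply INR_S_ge1.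
  assert (Hy1 : INR (S (S n)) = y + 1) by (rewrite S_INR; reflexivity).
  assert (E : pw (- e) n = pw (- e) (S n) * exp (e * (ln (y + 1) - ln y))).
  { unfold pw, Rpower. rewrite <- exp_plus, Hy1. fold y. f_equal; ring. }
  assert (F : pw (- (1 + e)) (S n) = pw (- e) (S n) * / (y + 1)).
  { replace (- (1 + e)) with (- e + - 1) by ring. rewrite pw_plus, pw_opp, (pw_opp 1), pw_1, Hy1; reflexivity. }
  assert (L : / (y + 1) <= ln (y + 1) - ln y).
  { assert (A := exp_ineq1_le (ln y - ln (y + 1))).
    unfold Rminus in A. rewrite exp_plus, exp_Ropp, !exp_ln in A by lra.
    replace (y * / (y + 1)) with (1 - / (y + 1)) in A by (field; lra). lra. }
  assert (M := exp_ineq1_le (e * (ln (y + 1) - ln y))).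
  assert (0 < pw (- e) (S n)) by apply pw_pos.
  rewrite E, F.
  replace (e * (pw (- e) (S n) * / (y + 1))) with (pw (- e) (S n) * (e * / (y + 1))) by ring.
  replace (pw (- e) (S n) * exp (e * (ln (y + 1) - ln y)) - pw (- e) (S n))
    with (pw (- e) (S n) * (exp (e * (ln (y + 1) - ln y)) - 1)) by ring.
  apply Rmult_le_compat_l; [lra|].
  assert (e * / (y + 1) <= e * (ln (y + 1) - ln y)) by (apply Rmult_le_compat_l; lra). lra.
Qed.

Lemma pw_sum e M : 0 < e -> sum_f_R0 (pw (- (1 + e))) M <= 1 + / e.
Proof.
  intros He.
  assert (H : sum_f_R0 (pw (- (1 + e))) M <= 1 + / e * (1 - pw (- e) M)).
  { induction M as [|M IH].
    - simpl. assert (Z : forall a, pw a 0 = 1) by (intros a; unfold pw, Rpower; simpl; rewrite ln_1, Rmult_0_r, exp_0; reflexivity).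
      rewrite !Z; lra.
    - rewrite tech5. assert (T := pw_telescope e M He).
      apply (Rmult_le_compat_l (/ e)) in T; [|left; apply Rinv_0_lt_compat, He].
      rewrite <- Rmult_assoc, Rinv_l, Rmult_1_l in T by lra. lra. }
  assert (0 < pw (- e) M) by apply pw_pos.
  assert (0 < / e * pw (- e) M) by (apply Rmult_lt_0_compat; [apply Rinv_0_lt_compat, He | lra]).
  lra.
Qed.

(* With the smallest frequency x and the largest z, the product of the three weights is at least
   (z+1)^s (x+1)^(2s), to be split as (z+1)^d (x+1)^(3s-d). *)
Lemma pw_resonance_sorted s d x y z N : 0 <= d <= s -> (x <= y)%nat -> (x <= z)%nat -> (N <= z)%nat ->
  1 <= pw (- d) N * pw (- (3 * s - d)) x * (pw s x * pw s y * pw s z).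
Proof.
  intros Hd Hy Hz HN.
  assert (A : pw d N * pw (3 * s - d) x <= pw s x * pw s y * pw s z).
  { replace (3 * s - d) with (s + s + (s - d)) by ring. rewrite !pw_plus.
    replace (pw s z) with (pw d z * pw (s - d) z) by (rewrite <- pw_plus; f_equal; ring).
    apply Rle_trans with (pw s x * pw s y * (pw d N * pw (s - d) x)).
    - replace (pw d N * (pw s x * pw s x * pw (s - d) x)) with (pw s x * pw s x * (pw d N * pw (s - d) x)) by ring.
      apply Rmult_le_compat_r; [apply Rmult_le_pos; left; apply pw_pos|].
      apply Rmult_le_compat_l; [left; apply pw_pos | apply pw_mono; [lra|exact Hy]].
    - apply Rmult_le_compat_l; [apply Rmult_le_pos; left; apply pw_pos|].
      apply Rmult_le_compat; try (left; apply pw_pos); apply pw_mono; lra || assumption. }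
  assert (P1 := pw_pos d N). assert (P2 := pw_pos (3 * s - d) x).
  rewrite !pw_opp, <- Rinv_mult.
  apply Rmult_le_reg_l with (pw d N * pw (3 * s - d) x); [apply Rmult_lt_0_compat; assumption|].
  rewrite <- Rmult_assoc, Rinv_r, Rmult_1_l, Rmult_1_r; [exact A|].
  apply Rgt_not_eq, Rmult_lt_0_compat; assumption.
Qed.

(** Which index is smallest is not known, so the weight with exponent -(3s-d) is summed over all
    three. After sorting, one of the two larger indices exceeds N. *)
Lemma pw_resonance s d a b c N : 0 <= d <= s -> (N < a \/ N < b \/ N < c)%nat ->
  1 <= pw (- d) N * (pw (- (3 * s - d)) a + pw (- (3 * s - d)) b + pw (- (3 * s - d)) c)
       * (pw s a * pw s b * pw s c).
Proof.
  intros Hd HN. set (t := 3 * s - d). set (W := pw s a * pw s b * pw s c).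
  assert (PW : 0 < W) by (repeat apply Rmult_lt_0_compat; apply pw_pos).
  assert (Pa := pw_pos (- t) a). assert (Pb := pw_pos (- t) b). assert (Pc := pw_pos (- t) c).
  assert (PN := pw_pos (- d) N).
  assert (K : forall x, 0 < pw (- t) x -> pw (- t) x <= pw (- t) a + pw (- t) b + pw (- t) c ->
    1 <= pw (- d) N * pw (- t) x * W ->
    1 <= pw (- d) N * (pw (- t) a + pw (- t) b + pw (- t) c) * W).
  { intros x _ Hx H1. eapply Rle_trans; [exact H1|]. apply Rmult_le_compat_r; [lra|].
    apply Rmult_le_compat_l; lra. }
  assert (S : forall x y z, (x <= y)%nat -> (x <= z)%nat -> (N < x \/ N < y \/ N < z)%nat ->
    W = pw s x * pw s y * pw s z -> 1 <= pw (- d) N * pw (- t) x * W).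
  { intros x y z Hy Hz HN' ->. destruct (Nat.le_gt_cases N z) as [h|h].
    - apply pw_resonance_sorted; assumption.
    - replace (pw s x * pw s y * pw s z) with (pw s x * pw s z * pw s y) by ring.
      apply pw_resonance_sorted; try assumption; lia. }
  destruct (Nat.le_gt_cases a b) as [h1|h1]; destruct (Nat.le_gt_cases a c) as [h2|h2];
    destruct (Nat.le_gt_cases b c) as [h3|h3];
  first
  [ apply (K a); [lra|lra|]; apply (S a b c); [lia|lia|lia|unfold W; ring]
  | apply (K b); [lra|lra|]; apply (S b a c); [lia|lia|lia|unfold W; ring]
  | apply (K c); [lra|lra|]; apply (S c a b); [lia|lia|lia|unfold W; ring] ].
Qed.

(** From (|k|+1)^2 <= 2(1+k^2), raised to the power s0, with 2^s0 <= 2. *)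
Lemma sobolev_weight s0 s k : 0 <= s0 -> s0 <= s -> s0 <= 1 ->
  pw s0 (Z.abs_nat k) ^ 2 <= 2 * Hs_weight s k.
Proof.
  intros H0 H1 H2. unfold pw, Hs_weight.
  set (x := INR (S (Z.abs_nat k))). set (y := 1 + IZR k ^ 2).
  assert (Hx : 1 <= x) by apply INR_S_ge1.
  assert (Hk : IZR k ^ 2 = (x - 1) ^ 2).
  { unfold x. rewrite S_INR, INR_IZR_INZ, Zabs2Nat.id_abs, abs_IZR.
    rewrite <- (pow2_abs (IZR k)). f_equal; ring. }
  assert (Hy : 1 <= y) by (unfold y; assert (A := pow2_ge_0 (IZR k)); lra).
  assert (Hxy : x * x <= 2 * y).
  { unfold y; rewrite Hk. assert (A := pow2_ge_0 (x - 2)). simpl in *; lra. }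
  replace (Rpower x s0 ^ 2) with (Rpower x s0 * Rpower x s0) by ring.
  rewrite Rpower_mult_distr by lra.
  apply Rle_trans with (Rpower (2 * y) s0).
  { apply Rle_Rpower_l; [exact H0|]. split; [apply Rmult_lt_0_compat; lra | exact Hxy]. }
  rewrite <- Rpower_mult_distr by lra.
  apply Rmult_le_compat; try (left; apply exp_pos).
  - rewrite <- (Rpower_1 2) at 2 by lra. apply Rle_Rpower; lra.
  - apply Rle_Rpower; lra.
Qed.

Close Scope R_scope.
From HB Require Import structures.
From mathcomp Require Import all_boot all_order all_algebra.
From mathcomp Require Import ring lra zify ssrZ.
From mathcomp Require Import complex.
From mathcomp Require Import boolp classical_sets reals Rstruct.
Set Implicit Arguments.
Unset Strict Implicit.
Unset Printing Implicit Defensive.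
Import Order.TTheory GRing.Theory Num.Theory ComplexField.Normc.
Import RealAnalysis.
Local Open Scope ring_scope.
Local Open Scope complex_scope.

(** * Finite l2 norms *)

Section L2.
Variable R : rcfType.
Implicit Types I J : eqType.

Definition l2 I (s : seq I) (f : I -> R) : R := Num.sqrt (\sum_(i <- s) f i ^+ 2).

Lemma sum_sqr_ge0 I (s : seq I) (f : I -> R) : 0 <= \sum_(i <- s) f i ^+ 2.
Proof. by apply: sumr_ge0 => i _; exact: sqr_ge0. Qed.

Lemma l2_ge0 I (s : seq I) (f : I -> R) : 0 <= l2 s f.
Proof. exact: sqrtr_ge0. Qed.

Lemma l2_sqr I (s : seq I) (f : I -> R) : l2 s f ^+ 2 = \sum_(i <- s) f i ^+ 2.
Proof. by rewrite sqr_sqrtr // sum_sqr_ge0. Qed.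

Lemma l2_le I (s : seq I) (f : I -> R) B :
  0 <= B -> (l2 s f <= B) = (\sum_(i <- s) f i ^+ 2 <= B ^+ 2).
Proof. by move=> B0; rewrite -l2_sqr ler_pXn2r // nnegrE l2_ge0. Qed.

Lemma l2_eq I (s : seq I) (f g : I -> R) :
  (forall i, i \in s -> f i = g i) -> l2 s f = l2 s g.
Proof.
by move=> fg; congr Num.sqrt; apply: eq_big_seq => i /fg ->.
Qed.

Lemma l2_mono I (s : seq I) (f g : I -> R) :
  (forall i, i \in s -> `|f i| <= g i) -> l2 s f <= l2 s g.
Proof.
move=> fg; apply: ler_wsqrtr.
rewrite big_seq [leRHS]big_seq; apply: ler_sum => i /fg fgi.
by rewrite -real_normK ?num_real // ler_pXn2r ?nnegrE ?(le_trans _ fgi).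
Qed.

Lemma l2_scale I (s : seq I) (f : I -> R) c :
  0 <= c -> l2 s (fun i => c * f i) = c * l2 s f.
Proof.
move=> c0; rewrite /l2.
under eq_bigr do rewrite exprMn.
by rewrite -mulr_sumr sqrtrM ?sqr_ge0 // sqrtr_sqr ger0_norm.
Qed.

Lemma l2_eq0 I (s : seq I) (f : I -> R) : l2 s f = 0 -> forall i, i \in s -> f i = 0.
Proof.
move=> /(congr1 (fun x => x ^+ 2)); rewrite l2_sqr expr0n /= => /eqP.
rewrite psumr_eq0; last by move=> i _; exact: sqr_ge0.
by move=> /allP h i /h; rewrite sqrf_eq0 => /eqP.
Qed.

Lemma cauchy_schwarz I (s : seq I) (f g : I -> R) :
  \sum_(i <- s) f i * g i <= l2 s f * l2 s g.
Proof.
set a := l2 s f; set b := l2 s g.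
have a0 : 0 <= a by exact: l2_ge0.
have b0 : 0 <= b by exact: l2_ge0.
have [a00|an0] := eqVneq a 0.
  rewrite a00 mul0r big_seq big1 // => i /(l2_eq0 a00) ->; exact: mul0r.
have [b00|bn0] := eqVneq b 0.
  rewrite b00 mulr0 big_seq big1 // => i /(l2_eq0 b00) ->; exact: mulr0.
have ab0 : 0 < a * b by rewrite mulr_gt0 // lt_neqAle eq_sym ?an0 ?bn0.
have : 0 <= \sum_(i <- s) (b * f i - a * g i) ^+ 2 by exact: sum_sqr_ge0.
have -> : \sum_(i <- s) (b * f i - a * g i) ^+ 2 =
   b ^+ 2 * (\sum_(i <- s) f i ^+ 2) + a ^+ 2 * (\sum_(i <- s) g i ^+ 2)
   - (2 * (a * b)) * \sum_(i <- s) f i * g i.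
  rewrite !mulr_sumr -sumrN -!big_split /=.
  by apply: eq_bigr => i _; ring.
rewrite -!l2_sqr -/a -/b; set S := \sum_(i <- s) _ => h.
have : (a * b) * S <= (a * b) * (a * b) by lra.
by rewrite ler_pM2l.
Qed.

Lemma l2_triangle I (s : seq I) (f g : I -> R) :
  l2 s (fun i => f i + g i) <= l2 s f + l2 s g.
Proof.
have a0 : 0 <= l2 s f by exact: l2_ge0.
have b0 : 0 <= l2 s g by exact: l2_ge0.
rewrite l2_le ?addr_ge0 // sqrrD !l2_sqr.
have := cauchy_schwarz s f g.
have -> : \sum_(i <- s) (f i + g i) ^+ 2 =
  \sum_(i <- s) f i ^+ 2 + 2 * (\sum_(i <- s) f i * g i) + \sum_(i <- s) g i ^+ 2.
  by rewrite !mulr_sumr -!big_split /=; apply: eq_bigr => i _; ring.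
lra.
Qed.

Lemma l2_0 I (s : seq I) : l2 s (fun _ => 0) = 0.
Proof. by rewrite /l2 big1 ?sqrtr0 // => i _; rewrite expr0n. Qed.

Lemma l2_sum I J (s : seq I) (r : seq J) (F : J -> I -> R) :
  l2 s (fun i => \sum_(j <- r) F j i) <= \sum_(j <- r) l2 s (F j).
Proof.
elim: r => [|j r IH].
  by rewrite big_nil (@l2_eq _ _ _ (fun _ => 0)) ?l2_0 // => i _; rewrite big_nil.
rewrite big_cons (@l2_eq _ _ _ (fun i => F j i + \sum_(j <- r) F j i)); last first.
  by move=> i _; rewrite big_cons.
by apply: (le_trans (l2_triangle _ _ _)); rewrite lerD2l.
Qed.

(** Membership in l2 with norm at most B, expressed through finite subsets so that no infinite sum
    has to be formed. *)
Definition l2bound I (U : I -> R) (B : R) : Prop :=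
  forall s : seq I, uniq s -> l2 s U <= B.

Lemma l2bound_ge0 I (U : I -> R) B : l2bound U B -> 0 <= B.
Proof. by move=> /(_ [::] isT); apply: le_trans; exact: l2_ge0. Qed.

Lemma l2bound_map I J (U : I -> R) B (h : J -> I) (s : seq J) :
  l2bound U B -> uniq s -> {in s &, injective h} -> l2 s (fun j => U (h j)) <= B.
Proof.
move=> UB us hi; have := UB (map h s); rewrite map_inj_in_uniq // => /(_ us).
by rewrite /l2 big_map.
Qed.

(* Young's inequality. *)
Lemma young I J (h : I -> int) (g : J -> int) (s : seq I) (r : seq J)
    (U : int -> R) (V : J -> R) B :
  l2bound U B -> uniq s -> injective h -> (forall j, 0 <= V j) ->
  l2 s (fun i => \sum_(j <- r) U (h i - g j) * V j) <= B * \sum_(j <- r) V j.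
Proof.
move=> UB us hi V0; apply: (le_trans (l2_sum _ _ _)); rewrite mulr_sumr.
apply: ler_sum => j _.
rewrite (@l2_eq _ _ _ (fun i => V j * U (h i - g j))); last by move=> *; rewrite mulrC.
rewrite l2_scale // mulrC ler_wpM2r //.
apply: (@l2bound_map _ _ U B (fun i => h i - g j)) => //.
by move=> i k _ _ /addIr /hi.
Qed.

End L2.

Section Modulus.
Variable R : rcfType.
Implicit Types x y : R[i].

Lemma cm_ge0 x : 0 <= normc x.
Proof. by case: x => a b; exact: sqrtr_ge0. Qed.

Lemma cm_sum I (s : seq I) (F : I -> R[i]) :
  normc (\sum_(i <- s) F i) <= \sum_(i <- s) normc (F i).
Proof.
elim: s => [|i s IH]; first by rewrite !big_nil normc0.
by rewrite !big_cons; apply: (le_trans (le_normcD _ _)); rewrite lerD2l.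
Qed.

Lemma cmB x y : normc (x - y) <= normc x + normc y.
Proof. by apply: (le_trans (le_normcD _ _)); rewrite normcN. Qed.

Lemma cm_sqr x : ((normc x ^+ 2)%:C = x * x^*)%C.
Proof. by rewrite rmorphXn -sqr_normc. Qed.

Lemma cm_conj x : normc (x^*)%C = normc x.
Proof. by apply: complexI; exact: normcJ. Qed.

Lemma cm_real (a : R) : normc (a%:C)%C = `|a|.
Proof. by rewrite /= expr0n /= addr0 sqrtr_sqr. Qed.

Lemma cm_im (a : R) : normc (a *i)%C = `|a|.
Proof. by rewrite /= expr0n /= add0r sqrtr_sqr. Qed.

Lemma cm_nat n : normc (n%:R : R[i]) = n%:R.
Proof. by rewrite -(rmorph_nat (real_complex R)) cm_real normr_nat. Qed.

Lemma cm_Re x : `|complex.Re x| <= normc x.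
Proof. by rewrite -lecR; exact: normc_ge_Re. Qed.

Lemma cm_reim x : normc x <= `|complex.Re x| + `|complex.Im x|.
Proof.
case: x => a b /=; rewrite -[leRHS]ger0_norm ?addr_ge0 //.
rewrite -(sqrtr_sqr (_ + _)); apply: ler_wsqrtr; rewrite sqrrD !real_normK ?num_real //.
by rewrite addrAC lerDl mulrn_wge0 // mulr_ge0.
Qed.

End Modulus.

(** * Resolvents of hermitian matrices *)

Section Vectors.
Variables (R : rcfType) (K : nat).
Local Notation C := R[i].
Implicit Types (x y z : 'cV[C]_K) (w : nat -> R) (M : 'M[C]_K) (c : C).

Definition ip x y : C := \sum_i x i 0 * conjc (y i 0).

Definition wnorm w x : R := l2 (index_enum 'I_K) (fun i => w i * normc (x i 0)).
Definition one_w : nat -> R := fun _ => 1.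
Definition nrm x : R := wnorm one_w x.

Lemma ipDl x y z : ip (x + y) z = ip x z + ip y z.
Proof. by rewrite -big_split /=; apply: eq_bigr => i _; rewrite !mxE mulrDl. Qed.

Lemma ipZl c x y : ip (c *: x) y = c * ip x y.
Proof. by rewrite mulr_sumr; apply: eq_bigr => i _; rewrite !mxE mulrA. Qed.

Lemma ipC x y : ip y x = conjc (ip x y).
Proof.
rewrite rmorph_sum; apply: eq_bigr => i _; rewrite rmorphM /= conjcK; exact: mulrC.
Qed.

Lemma ipDr x y z : ip x (y + z) = ip x y + ip x z.
Proof. by rewrite ipC ipDl rmorphD /= -!ipC. Qed.

Lemma ipZr c x y : ip x (c *: y) = conjc c * ip x y.
Proof. by rewrite ipC ipZl rmorphM /= -!ipC. Qed.

Lemma ipNl x y : ip (- x) y = - ip x y.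
Proof. by rewrite -scaleN1r ipZl mulN1r. Qed.

Lemma ipBl x y z : ip (x - y) z = ip x z - ip y z.
Proof. by rewrite ipDl ipNl. Qed.

Lemma ip0l x : ip 0 x = 0.
Proof. by rewrite -(scale0r 0) ipZl mul0r. Qed.

Definition adj M : 'M[C]_K := \matrix_(i, j) conjc (M j i).

Lemma ip_adj M x y : ip (M *m x) y = ip x (adj M *m y).
Proof.
rewrite /ip; under eq_bigr => i _ do rewrite mxE mulr_suml.
under [RHS]eq_bigr => i _ do rewrite mxE rmorph_sum mulr_sumr.
rewrite exchange_big /=; apply: eq_bigr => i _; apply: eq_bigr => j _.
by rewrite !mxE rmorphM /= conjcK; ring.
Qed.

Lemma wnorm_ge0 w x : 0 <= wnorm w x. Proof. exact: l2_ge0. Qed.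
Lemma nrm_ge0 x : 0 <= nrm x. Proof. exact: l2_ge0. Qed.

Lemma nrm_ip x : ((nrm x ^+ 2)%:C) = ip x x.
Proof.
rewrite l2_sqr rmorph_sum; apply: eq_bigr => i _.
by rewrite /one_w mul1r; exact: cm_sqr.
Qed.

Lemma wnormD w x y : (forall n, 0 <= w n) -> wnorm w (x + y) <= wnorm w x + wnorm w y.
Proof.
move=> w0; apply: (le_trans _ (l2_triangle _ _ _)).
apply: l2_mono => i _; rewrite mxE ger0_norm ?mulr_ge0 ?cm_ge0 //.
by rewrite -mulrDr ler_wpM2l // le_normcD.
Qed.

Lemma wnormZ w c x : wnorm w (c *: x) = normc c * wnorm w x.
Proof.
rewrite -l2_scale ?cm_ge0 //; apply: l2_eq => i _.
by rewrite mxE normcM mulrCA.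
Qed.

Lemma wnormN w x : wnorm w (- x) = wnorm w x.
Proof. by rewrite -scaleN1r wnormZ normcN normc1 mul1r. Qed.

Lemma wnormB w x y : (forall n, 0 <= w n) -> wnorm w (x - y) <= wnorm w x + wnorm w y.
Proof. by move=> w0; rewrite -(wnormN w y); exact: wnormD. Qed.

Lemma wnorm_mono w w' x : (forall n, 0 <= w n <= w' n) -> wnorm w x <= wnorm w' x.
Proof.
move=> ww; apply: l2_mono => i _; have /andP[w0 w1] := ww i.
by rewrite ger0_norm ?mulr_ge0 ?cm_ge0 // ler_wpM2r ?cm_ge0.
Qed.

Lemma one_w_ge0 n : 0 <= one_w n. Proof. exact: ler01. Qed.

Lemma nrmD x y : nrm (x + y) <= nrm x + nrm y.
Proof. exact: wnormD one_w_ge0. Qed.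

Lemma nrmB x y : nrm (x - y) <= nrm x + nrm y.
Proof. exact: wnormB one_w_ge0. Qed.

Lemma ip_le x y : normc (ip x y) <= nrm x * nrm y.
Proof.
apply: (le_trans (cm_sum _ _)); apply: (le_trans _ (cauchy_schwarz _ _ _)).
by apply: ler_sum => i _; rewrite normcM cm_conj !mul1r.
Qed.

Lemma cm_le_nrm x i : normc (x i 0) <= nrm x.
Proof.
rewrite -[normc _]ger0_norm ?cm_ge0 // -sqrtr_sqr; apply: ler_wsqrtr.
rewrite (bigD1 i) //= mul1r lerDl; apply: sumr_ge0 => j _; exact: sqr_ge0.
Qed.

End Vectors.

Section Cayley.
Variables (R : rcfType) (K : nat) (M : 'M[R[i]]_K).
Local Notation C := R[i].
Implicit Types (x y : 'cV[C]_K) (c : R).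
Hypothesis Mherm : adj M = M.

Definition resX c : 'M[C]_K := 1%:M - (c *i) *: M.
Definition res c : 'M[C]_K := invmx (resX c).

Lemma resE c : res c = invmx (resX c). Proof. by []. Qed.

Lemma resX_mul c x : resX c *m x = x - (c *i) *: (M *m x).
Proof. by rewrite mulmxBl mul1mx scalemxAl. Qed.

Lemma ip_herm x y : ip (M *m x) y = ip x (M *m y).
Proof. by rewrite ip_adj Mherm. Qed.

Lemma conj_imN c : conjc (- (c *i)) = c *i.
Proof. by simpc. Qed.

Lemma im_mul c : (c *i) * ((- c) *i) = (c ^+ 2)%:C.
Proof. by simpc; rewrite ?expr2. Qed.

(** The cross terms cancel because M is hermitian and ic is purely imaginary. Invertibility of 1 -
    icM, contractivity of [res c] and the bound on c M [res c] all follow, independently of the size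
    K. *)
Lemma nrm_resX c x : nrm (resX c *m x) ^+ 2 = nrm x ^+ 2 + c ^+ 2 * nrm (M *m x) ^+ 2.
Proof.
have CDM (a b d : R) : (a + b * d)%:C = a%:C + b%:C * d%:C.
  by rewrite rmorphD rmorphM.
apply: complexI; rewrite CDM !nrm_ip resX_mul.
rewrite ipBl -scaleNr !ipDr !ipZr !ipZl ip_herm.
rewrite -(im_mul c) conj_imN (_ : (- c) *i = - (c *i)); last by simpc.
ring.
Qed.

Lemma nrm_le_resX c x : nrm x <= nrm (resX c *m x).
Proof.
rewrite -(@ler_pXn2r _ 2) ?nnegrE ?nrm_ge0 // nrm_resX lerDl.
by rewrite mulr_ge0 // sqr_ge0.
Qed.

Lemma nrmM_le_resX c x : `|c| * nrm (M *m x) <= nrm (resX c *m x).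
Proof.
rewrite -(@ler_pXn2r _ 2) ?nnegrE ?mulr_ge0 ?nrm_ge0 // nrm_resX exprMn.
by rewrite real_normK ?num_real // lerDr sqr_ge0.
Qed.

Lemma nrm_eq0 x : nrm x = 0 -> x = 0.
Proof.
move=> x0; apply/matrixP => i j; rewrite !ord1 mxE; apply: eq0_normc.
by apply: le_anti; rewrite cm_ge0 andbT -x0 cm_le_nrm.
Qed.

Lemma resX_unit c : resX c \in unitmx.
Proof.
rewrite -unitmx_tr -row_free_unit -kermx_eq0; apply/eqP/row_matrixP => i.
rewrite row0; set r := row i _.
have hr : r *m (resX c)^T = 0 by apply/sub_kermxP; exact: row_sub.
apply: trmx_inj; rewrite trmx0; apply: nrm_eq0; apply: le_anti.
rewrite nrm_ge0 andbT; apply: (le_trans (nrm_le_resX c _)).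
by rewrite -[resX c]trmxK -trmx_mul hr trmx0 /nrm /wnorm (@l2_eq _ _ _ _ (fun _ => 0)) ?l2_0 // => k _; rewrite mxE normc0 mulr0.
Qed.

Lemma resK c x : resX c *m (res c *m x) = x.
Proof. by rewrite mulmxA mulmxV ?mul1mx // resX_unit. Qed.

Lemma resKV c x : res c *m (resX c *m x) = x.
Proof. by rewrite mulmxA mulVmx ?mul1mx // resX_unit. Qed.

Lemma res0 x : res 0 *m x = x.
Proof. by rewrite -[RHS](resKV 0) resX_mul scale0r subr0. Qed.

Lemma res_commM c x : M *m (res c *m x) = res c *m (M *m x).
Proof.
rewrite -[LHS](resKV c); congr (_ *m _).
rewrite -[x in RHS](resK c) !resX_mul mulmxBr -scalemxAr; congr (_ - _ *: _).
Qed.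

Lemma resX_comm c d x : resX c *m (res d *m x) = res d *m (resX c *m x).
Proof. by rewrite !resX_mul res_commM mulmxBr scalemxAr. Qed.

Lemma nrm_res c x : nrm (res c *m x) <= nrm x.
Proof. by rewrite -{2}(resK c x) nrm_le_resX. Qed.

Lemma nrmM_res c x : `|c| * nrm (M *m (res c *m x)) <= nrm x.
Proof. by rewrite -{2}(resK c x) nrmM_le_resX. Qed.

(** The adjoint of (1 - icM)^{-1} is (1 + icM)^{-1}, again a resolvent. *)
Lemma ip_res c x y : ip (res c *m x) y = ip x (res (- c) *m y).
Proof.
rewrite -[y in LHS](resK (- c)) -[x in RHS](resK c) !resX_mul.
rewrite -!scaleNr ipDl ipDr ipZl ipZr ip_herm conj_imN.
by rewrite (_ : (- c) *i = - (c *i)) ?opprK ?conj_imN //; simpc.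
Qed.

Lemma res_id c x : res c *m x = x + (c *i) *: (M *m (res c *m x)).
Proof. by rewrite -{2}(resK c x) resX_mul subrK. Qed.

End Cayley.

#[global] Opaque res.

(** * Toeplitz matrices and their resolvents *)

Section InverseSquares.
Variable R : realFieldType.

(** With x = r + n, 1/(x - 1/2) - 1/(x + 1/2) = 1/(x^2 - 1/4) >= 1/x^2, and the left side
    telescopes. *)
Lemma sum_inv_sqr (r K : nat) : (0 < r)%N ->
  \sum_(n < K) ((r + n)%:R^-1 : R) ^+ 2 <= 2 / r%:R.
Proof.
move=> r0; have r1 : (1 : R) <= r%:R by rewrite ler1n.
suff : \sum_(n < K) ((r + n)%:R^-1 : R) ^+ 2
    <= (r%:R - 2^-1)^-1 - (r%:R + K%:R - 2^-1)^-1.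
  move=> /le_trans; apply.
  have h1 : 0 < r%:R + K%:R - 2^-1 :> R by have := ler0n R K; lra.
  have : (r%:R - 2^-1)^-1 <= 2 / r%:R :> R.
    rewrite -[2 / _]invrK invf_div lef_pV2 ?posrE; lra.
  have := invr_ge0 (r%:R + K%:R - 2^-1 : R); lra.
elim: K => [|K IH]; first by rewrite big_ord0 addr0 subrr.
rewrite big_ord_recr /=; apply: (le_trans (lerD IH (lexx _))).
rewrite natrD -(natr1 K); set x := r%:R + K%:R.
have x1 : 1 <= x by rewrite /x; have := ler0n R K; lra.
rewrite -addrA lerD2l.
have -> : r%:R + (K%:R + 1) - 2^-1 = x + 2^-1 by rewrite /x; lra.
rewrite -lerBrDl opprK addrC -subr_ge0.
have -> : (x - 2^-1)^-1 - (x + 2^-1)^-1 - x^-1 ^+ 2 =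
   4^-1 * (x^-1 ^+ 2 * ((x - 2^-1)^-1 * (x + 2^-1)^-1)).
  by field; rewrite !gt_eqF //; lra.
by rewrite !mulr_ge0 ?invr_ge0 //; lra.
Qed.

(** W reappears on the right with total coefficient 1/2 and is absorbed; this closes the relative
    bound in [dom1]. *)
Lemma absorb_half (W a t s p x y : R) : W <= a + 2 * t -> t <= s -> s <= p ->
  4 * p <= y + W -> a <= x -> W <= 2 * x + y.
Proof. lra. Qed.

End InverseSquares.

(** * Weighted graph norms of M *)

Section Domain.
Variables (R : rcfType) (K : nat) (q : int -> R[i]).
Local Notation C := R[i].
Implicit Types (x y z f g : 'cV[C]_K) (b X : R).

Definition matT (p : int -> C) : 'M[C]_K := \matrix_(n, m) p (n%:Z - m%:Z).
Definition matM : 'M[C]_K :=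
  \matrix_(n, m) ((if n == m then (2 * n + 1)%:R else 0) - 2 * q (n%:Z - m%:Z)).

Definition l1sum (w : nat -> R) x : R := \sum_(i < K) w i * normc (x i 0).

Lemma matM_mul x : matM *m x = (\col_i ((2 * i + 1)%:R * x i 0)) - 2 *: (matT q *m x).
Proof.
apply/matrixP => i j; rewrite ord1 !mxE mulr_sumr.
under eq_bigr do rewrite !mxE mulrBl -mulrA.
rewrite sumrB; congr (_ - _); last by apply: eq_bigr => k _; rewrite !mxE.
rewrite (bigD1 i) //= eqxx big1 ?addr0 // => k ki.
by rewrite eq_sym (negbTE ki) mul0r.
Qed.

(** Young's inequality with q in l2 and x in l1; submultiplicativity divides the weight between the
    two. *)
Lemma matT_norm w x B : (forall n, 0 <= w n) ->
  (forall i j : int, w (absz (i + j)) <= w `|i|%N * w `|j|%N) ->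
  l2bound (fun k : int => w `|k|%N * normc (q k)) B ->
  wnorm w (matT q *m x) <= B * l1sum w x.
Proof.
move=> w0 wM qB.
pose h (j : 'I_K) : int := (j : nat)%:Z.
apply: le_trans (@young R _ _ h h (index_enum 'I_K) (index_enum 'I_K) _
  (fun j => w j * normc (x j 0)) B qB (index_enum_uniq 'I_K) _ _).
- apply: l2_mono => i _; rewrite ger0_norm ?mulr_ge0 ?cm_ge0 // mxE.
  apply: (le_trans (ler_wpM2l (w0 i) (cm_sum _ _))).
  rewrite mulr_sumr; apply: ler_sum => j _; rewrite mxE normcM.
  set u := normc (q _); set v := normc _.
  have -> : w (absz ((i : nat)%:Z - (j : nat)%:Z)) * u * (w j * v) =
    (w (absz ((i : nat)%:Z - (j : nat)%:Z)) * w j) * (u * v) by ring.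
  rewrite ler_wpM2r ?mulr_ge0 ?cm_ge0 //.
  by have := wM ((i : nat)%:Z - (j : nat)%:Z) (j : nat)%:Z; rewrite subrK !absz_nat.
- by move=> i j /= hij; apply: val_inj; case: hij.
- by move=> j; rewrite mulr_ge0 ?cm_ge0.
Qed.

Variables (w : nat -> R) (B C1 : R) (r : nat).
Hypothesis qherm : forall k, q (- k) = conjc (q k).
Hypothesis w_ge1 : forall n, 1 <= w n.
Hypothesis w_le : forall n, w n <= n.+1%:R.
Hypothesis w_sub : forall i j : int, w (absz (i + j)) <= w `|i|%N * w `|j|%N.
Hypothesis qB : l2bound (fun k : int => w `|k|%N * normc (q k)) B.
Hypothesis wC1 : l2bound (fun n : nat => w n / n.+1%:R) C1.
Hypothesis r_gt0 : (0 < r)%N.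
Hypothesis r_large : 32 * B ^+ 2 <= r%:R.

Definition w1 : nat -> R := fun n => n.+1%:R.
(** For w = n^s this is the weight n^{1+s}, in which the Lax error is controlled. *)
Definition wG : nat -> R := fun n => n.+1%:R * w n.

Lemma matM_herm : adj matM = matM.
Proof.
apply/matrixP => i j; rewrite !mxE rmorphB rmorphM /= -qherm opprB eq_sym.
have -> : conjc (if i == j then (2 * j + 1)%:R else 0 : C) = if i == j then (2 * i + 1)%:R else 0.
  by case: eqP => [->|_]; rewrite ?conjc_nat ?conjc0.
congr (_ - _ * _); exact: (conjc_nat R 2).
Qed.

Lemma w_ge0 n : 0 <= w n. Proof. exact: le_trans ler01 (w_ge1 n). Qed.
Lemma w1_ge0 n : 0 <= w1 n. Proof. exact: ler0n. Qed.
Lemma wG_ge0 n : 0 <= wG n. Proof. by rewrite mulr_ge0 ?w_ge0. Qed.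

Lemma B_ge0 : 0 <= B. Proof. exact: l2bound_ge0 qB. Qed.
Lemma C1_ge0 : 0 <= C1. Proof. exact: l2bound_ge0 wC1. Qed.

Lemma qB1 : l2bound (fun k : int => one_w R `|k|%N * normc (q k)) B.
Proof.
move=> s us; apply: le_trans (qB us); apply: l2_mono => k _.
by rewrite /one_w mul1r ger0_norm ?cm_ge0 // ler_peMl ?cm_ge0.
Qed.

Lemma nrm_le_w x : nrm x <= wnorm w x.
Proof. by apply: wnorm_mono => n; rewrite ler01 w_ge1. Qed.

Lemma w_le_w1 x : wnorm w x <= wnorm w1 x.
Proof. by apply: wnorm_mono => n; rewrite w_ge0 w_le. Qed.

Lemma w_le_wG x : wnorm w x <= wnorm wG x.
Proof. by apply: wnorm_mono => n; rewrite w_ge0 ler_peMl ?w_ge0 // ler1n. Qed.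

Lemma nrm_matT x : nrm (matT q *m x) <= B * l1sum (one_w R) x.
Proof.
by apply: matT_norm qB1 => *; rewrite ?ler01 // /one_w mul1r.
Qed.

Lemma wnorm_matT x : wnorm w (matT q *m x) <= B * l1sum w x.
Proof. exact: matT_norm w_ge0 w_sub qB. Qed.

Lemma l1sum_w x : l1sum w x <= C1 * wnorm w1 x.
Proof.
have -> : l1sum w x = \sum_(i < K) (w i / i.+1%:R) * (w1 i * normc (x i 0)).
  apply: eq_bigr => i _; rewrite mulrA; congr (_ * _).
  by rewrite /w1 divfK // pnatr_eq0.
apply: (le_trans (cauchy_schwarz _ _ _)); rewrite ler_wpM2r ?wnorm_ge0 //.
apply: (@l2bound_map _ _ _ (fun n => w n / n.+1%:R) C1 (fun i : 'I_K => (i : nat))) => //.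
  exact: index_enum_uniq.
by move=> i j _ _; exact: val_inj.
Qed.

(** Cauchy-Schwarz against r + i instead of i + 1: a large r costs r times the plain norm, but puts
    the small factor sqrt(2/r) in front of the norm with one derivative. *)
Lemma l1sum_1 x : l1sum (one_w R) x <= Num.sqrt (2 / r%:R) * (r%:R * nrm x + wnorm w1 x).
Proof.
have -> : l1sum (one_w R) x = \sum_(i < K) (r + i)%:R^-1 * ((r + i)%:R * normc (x i 0)).
  apply: eq_bigr => i _; rewrite mulrA mulVf ?mul1r //.
  by rewrite pnatr_eq0; lia.
apply: (le_trans (cauchy_schwarz _ _ _)).
apply: ler_pM; rewrite ?l2_ge0 //; first by apply: ler_wsqrtr; exact: sum_inv_sqr.
rewrite -l2_scale //; apply: le_trans (l2_triangle _ _ _).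
apply: l2_mono => i _; rewrite ger0_norm ?mulr_ge0 ?cm_ge0 //.
rewrite /one_w mul1r -mulrDl ler_wpM2r ?cm_ge0 // /w1 natrD lerD2l ler_nat; lia.
Qed.

Lemma wnorm_D (v : nat -> R) x : (forall n, 0 <= v n) ->
  wnorm (fun n => w1 n * v n) x <= wnorm v (\col_i ((2 * i + 1)%:R * x i 0)).
Proof.
move=> v0; apply: l2_mono => i _; rewrite ger0_norm ?mulr_ge0 ?cm_ge0 ?w1_ge0 //.
rewrite mxE normcM cm_nat mulrA ler_wpM2r ?cm_ge0 // mulrC ler_wpM2l //.
by rewrite /w1 ler_nat; lia.
Qed.

Lemma D_eq x : (\col_i ((2 * i + 1)%:R * x i 0)) = matM *m x + 2 *: (matT q *m x).
Proof. by rewrite matM_mul subrK. Qed.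

Definition Cd : R := 2 + r%:R.

Lemma Cd_ge1 : 1 <= Cd. Proof. by rewrite /Cd; have := ler0n R r; lra. Qed.

(** The Kato-Rellich argument: by [l1sum_1] the Toeplitz part is a small perturbation of 2D + 1, so
    z and M z in the plain norm control one derivative of z, uniformly in K. *)
Lemma dom1 z X : nrm z <= X -> nrm (matM *m z) <= X -> wnorm w1 z <= Cd * X.
Proof.
move=> zX MX; have X0 : 0 <= X by exact: le_trans (nrm_ge0 z) zX.
have h1 : wnorm w1 z <= nrm (matM *m z) + 2 * nrm (matT q *m z).
  have -> : wnorm w1 z = wnorm (fun n => w1 n * one_w R n) z.
    by apply: l2_eq => i _; rewrite /one_w mulr1.
  apply: (le_trans (wnorm_D _ (@one_w_ge0 R))); rewrite D_eq.
  apply: (le_trans (nrmD _ _)); rewrite lerD2l /nrm wnormZ.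
  by rewrite (cm_nat R 2).
have h2 := nrm_matT z; have h3 := l1sum_1 z.
set k := Num.sqrt _ in h3; have k0 : 0 <= k by exact: sqrtr_ge0.
have r0 : 0 < r%:R :> R by rewrite ltr0n.
(* The origin of the constant in [r_large]: squared, this is 16 B^2 * 2/r <= 1. *)
have Bk : 4 * (B * k) <= 1.
  rewrite -(@expr_le1 _ 2) ?mulr_ge0 ?B_ge0 // !exprMn.
  rewrite sqr_sqrtr ?divr_ge0 ?(ltW r0) //.
  have -> : 4 ^+ 2 * (B ^+ 2 * (2 / r%:R)) = 32 * B ^+ 2 / r%:R by ring.
  by rewrite ler_pdivrMr ?mul1r.
have h4 : B * l1sum (one_w R) z <= B * k * (r%:R * X + wnorm w1 z).
  rewrite -mulrA ler_wpM2l ?B_ge0 //; apply: (le_trans h3).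
  by rewrite ler_wpM2l // lerD2r ler_wpM2l // ltW.
have h5 : 4 * (B * k * (r%:R * X + wnorm w1 z)) <= r%:R * X + wnorm w1 z.
  rewrite mulrA -[leRHS]mul1r ler_wpM2r // addr_ge0 ?wnorm_ge0 ?mulr_ge0 //.
by rewrite /Cd mulrDl; apply: absorb_half h1 h2 h4 h5 MX.
Qed.

Definition CG : R := 1 + 2 * (B * (C1 * Cd)).

Lemma CG_ge1 : 1 <= CG.
Proof.
rewrite lerDl !mulr_ge0 ?B_ge0 ?C1_ge0 //; exact: le_trans ler01 Cd_ge1.
Qed.

Lemma dom2 z X : nrm z <= X -> wnorm w (matM *m z) <= X -> wnorm wG z <= CG * X.
Proof.
move=> zX MX.
have h1 := dom1 zX (le_trans (nrm_le_w _) MX).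
apply: (le_trans (wnorm_D _ w_ge0)); rewrite D_eq.
apply: (le_trans (wnormD _ _ w_ge0)); rewrite /CG mulrDl mul1r; apply: lerD => //.
rewrite wnormZ (cm_nat R 2) -mulrA ler_wpM2l //.
apply: (le_trans (wnorm_matT z)); rewrite -!mulrA ler_wpM2l ?B_ge0 //.
by apply: (le_trans (l1sum_w z)); rewrite ler_wpM2l ?C1_ge0.
Qed.

(** Since w n <= n + 1, [dom1] applied to M z supplies the weighted bound that [dom2] requires. *)
Lemma dom3 z X : nrm z <= X -> nrm (matM *m z) <= X -> nrm (matM *m (matM *m z)) <= X ->
  wnorm wG z <= CG * (Cd * X).
Proof.
move=> h0 h1 h2; apply: dom2.
  apply: (le_trans h0); rewrite ler_peMl ?Cd_ge1 //; exact: le_trans (nrm_ge0 z) h0.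
exact: le_trans (w_le_w1 _) (dom1 h1 h2).
Qed.

Notation J := (res matM).

(** M J_b f = (J_b f - f)/(ib). The weighted norm of J_b f on the right is at most its norm with one
    derivative, which [dom1] bounds by Cd X/b; this gives the constant (Cd/b + 1)/b. *)
Lemma res_gain b f X : 0 < `|b| <= 1 -> wnorm w f <= X ->
  wnorm wG (J b *m f) <= CG * ((Cd / `|b| + 1) / `|b| * X).
Proof.
move=> /andP[b0 b1] fX.
have ib : 1 <= `|b|^-1 by rewrite invf_ge1.
have fX' : nrm f <= X by exact: le_trans (nrm_le_w f) fX.
have X0 : 0 <= X by exact: le_trans (nrm_ge0 f) fX'.
have zX : nrm (J b *m f) <= X := le_trans (nrm_res matM_herm b f) fX'.
have MX : nrm (matM *m (J b *m f)) <= X / `|b|.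
  by rewrite ler_pdivlMr // mulrC (le_trans (nrmM_res matM_herm _ _)).
have Xb : X <= X / `|b| by rewrite ler_peMr.
have h1 := dom1 (le_trans zX Xb) MX.
have Cd0 : 0 <= Cd := le_trans ler01 Cd_ge1.
have step : X <= (Cd / `|b| + 1) / `|b| * X.
  rewrite ler_peMl // -[leLHS]mulr1; apply: ler_pM => //.
  by rewrite lerDr mulr_ge0 // invr_ge0 (ltW b0).
apply: dom2; first exact: le_trans zX step.
have -> : matM *m (J b *m f) = (b *i)^-1 *: (J b *m f - f).
  rewrite {2}(res_id matM_herm b f) addrC addKr scalerA mulVf ?scale1r //.
  by apply/eqP => /(congr1 (@complex.Im R)) /= hb; rewrite hb normr0 ltxx in b0.
rewrite wnormZ normcV cm_im mulrC [leRHS]mulrAC ler_pM2r ?invr_gt0 //.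
apply: (le_trans (wnormB _ _ w_ge0)); rewrite mulrDl mul1r.
apply: lerD => //; apply: (le_trans (w_le_w1 _)); apply: (le_trans h1).
by rewrite mulrA mulrAC.
Qed.

(** A product of resolvents; the head of the list acts first. *)
Definition run (cs : seq R) f : 'cV[C]_K := foldl (fun x c => J c *m x) f cs.

Lemma run_M cs f : matM *m run cs f = run cs (matM *m f).
Proof. by elim: cs f => //= c cs IH f; rewrite IH res_commM //; exact: matM_herm. Qed.

Lemma nrm_run cs f : nrm (run cs f) <= nrm f.
Proof.
elim: cs f => //= c cs IH f; apply: (le_trans (IH _)).
exact: nrm_res matM_herm c f.
Qed.

(** [run cs] contracts the plain norm only, but it commutes with M. Hence z = [run cs] J_b J_b f
    satisfies plain bounds on z, M z and M^2 z, each M being paid for by one J_b, and [dom3] turns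
    these into a weighted bound free of the length of [cs]. *)
Lemma run_gain b cs f X : 0 < `|b| <= 1 -> nrm f <= X ->
  wnorm wG (run cs (J b *m (J b *m f))) <= CG * (Cd * (X / `|b| ^+ 2)).
Proof.
move=> /andP[b0 b1] fX.
have ib : 1 <= `|b|^-1 by rewrite invf_ge1.
have X0 : 0 <= X by exact: le_trans (nrm_ge0 f) fX.
have hJ g : nrm (J b *m g) <= nrm g by exact: nrm_res matM_herm b g.
have hM g Y : nrm g <= Y -> nrm (matM *m (J b *m g)) <= Y / `|b|.
  move=> gY; rewrite ler_pdivlMr // mulrC.
  by rewrite (le_trans (nrmM_res matM_herm _ _)).
have Xb : X <= X / `|b| by rewrite ler_peMr.
have Xb2 : X / `|b| <= X / `|b| ^+ 2.
  by rewrite expr2 invfM mulrA ler_peMr // mulr_ge0 // invr_ge0 (ltW b0).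
apply: dom3; rewrite ?run_M; apply: (le_trans (nrm_run _ _)).
- exact: le_trans (hJ _) (le_trans (hJ _) (le_trans fX (le_trans Xb Xb2))).
- by apply: (le_trans (hM _ _ (le_trans (hJ _) fX))).
- rewrite (res_commM matM_herm) expr2 invfM mulrA; by apply: (hM); apply: (hM).
Qed.

Definition runa (cs : seq R) f : 'cV[C]_K := foldr (fun c x => J (- c) *m x) f cs.

Lemma ip_run cs f h : ip (run cs f) h = ip f (runa cs h).
Proof.
by elim: cs f => //= c cs IH f; rewrite IH ip_res //; exact: matM_herm.
Qed.

(** The adjoint word is a word of the same kind, so every gain proved for [run] also holds for test
    vectors. *)
Lemma runaE cs h : runa cs h = run (rev (map -%R cs)) h.
Proof.
by elim: cs h => //= c cs IH h; rewrite rev_cons -cats1 /run foldl_cat /= IH.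
Qed.

End Domain.

(** * The Lax commutator *)

Section FiniteSupport.

Lemma big_supp (V : nmodType) (I : eqType) (s1 s2 : seq I) (f : I -> V) :
  uniq s1 -> uniq s2 -> (forall i, f i != 0 -> (i \in s1) && (i \in s2)) ->
  \sum_(i <- s1) f i = \sum_(i <- s2) f i.
Proof.
move=> u1 u2 hf.
have E s : \sum_(i <- s) f i = \sum_(i <- [seq i <- s | f i != 0]) f i.
  rewrite big_filter [RHS]big_mkcond; apply: eq_bigr => i _.
  by case: eqP => [->|].
rewrite (E s1) (E s2); apply: perm_big; apply: uniq_perm; rewrite ?filter_uniq //.
move=> i; rewrite !mem_filter; case: (boolP (f i != 0)) => //.
by move=> /hf /andP[-> ->].
Qed.

Lemma big_subset (R : numDomainType) (I : eqType) (s1 s2 : seq I) (f : I -> R) :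
  uniq s1 -> {subset s1 <= s2} -> (forall i, 0 <= f i) ->
  \sum_(i <- s1) f i <= \sum_(i <- s2) f i.
Proof.
move=> u1 s12 f0; elim: s1 s2 u1 s12 => [|i s1 IH] s2 /=.
  by move=> _ _; rewrite big_nil sumr_ge0.
move=> /andP[is1 us1] s12.
rewrite (perm_big _ (perm_to_rem (s12 _ (mem_head _ _)))) !big_cons lerD2l.
apply: IH => // j js1; have := s12 j; rewrite inE js1 orbT => /(_ isT).
rewrite (perm_mem (perm_to_rem (s12 _ (mem_head _ _)))) inE => /orP[/eqP ji|//].
by rewrite -ji js1 in is1.
Qed.

Definition zrange (N : nat) : seq int := [seq j%:Z - N%:Z | j <- iota 0 (2 * N).+1].

Lemma mem_zrange N (p : int) : (p \in zrange N) = (`|p|%N <= N)%N.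
Proof.
apply/mapP/idP => [[j]|h].
  by rewrite mem_iota => /andP[_ hj] ->; lia.
by exists (absz (p + N%:Z)); rewrite ?mem_iota; lia.
Qed.

Lemma zrange_uniq N : uniq (zrange N).
Proof. by rewrite map_inj_uniq ?iota_uniq // => i j /addIr []. Qed.

End FiniteSupport.

Section Kernel.
Variables (R : rcfType) (q : int -> R[i]) (N : nat).
Local Notation C := R[i].
Hypothesis qsupp : forall k : int, (N < `|k|)%N -> q k = 0.
Implicit Types (n m l : nat) (k p : int).

Definition qm k : C := if k < 0 then q k else 0.
Definition qp k : C := if k < 0 then 0 else q k.

Lemma qE k : q k = qm k + qp k.
Proof. by rewrite /qm /qp; case: ifP; rewrite ?addr0 ?add0r. Qed.

(* Entries of A = -iD^2 + 2i(D T_{q-} + T_{q+} D) and M = 2D + 1 - 2T_q, with q- and q+ the parts of q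
   on negative and on nonnegative frequencies. *)
Definition kernA0 n m : C := 2 * 'i * (n%:R * qm (n%:Z - m%:Z) + qp (n%:Z - m%:Z) * m%:R).
Definition kernA n m : C := (n == m)%:R * (- 'i * n%:R ^+ 2) + kernA0 n m.
Definition kernM n m : C := (n == m)%:R * (2 * n%:R + 1) - 2 * q (n%:Z - m%:Z).

Definition conv k : C := \sum_(p <- zrange N) q p * q (k - p).

Definition BO k : C := 'i * k%:~R * (conv k - `|k|%:~R * q k).

Lemma sum_delta n (L : nat) (F : nat -> C) : (n < L)%N ->
  \sum_(l < L) (n == l)%:R * F l = F n.
Proof.
move=> nL; rewrite (bigD1 (Ordinal nL)) //= eqxx mul1r big1 ?addr0 // => l ln.
rewrite (_ : (n == l) = false) ?mul0r //; apply: contraNF ln => /eqP h.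
by apply/eqP/val_inj.
Qed.

Lemma sum_window n (L : nat) (F : int -> C) :
  (forall p, F p != 0 -> (`|p| <= N)%N && (p <= n%:Z)) -> (n + N < L)%N ->
  \sum_(l < L) F (n%:Z - (l : nat)%:Z) = \sum_(p <- zrange N) F p.
Proof.
move=> hF nL; rewrite -(big_mkord xpredT (fun l => F (n%:Z - l%:Z))).
rewrite -(big_map (fun l : nat => n%:Z - l%:Z) xpredT).
apply: big_supp; last first.
- move=> p /hF /andP[h1 h2]; rewrite mem_zrange h1 andbT.
  by apply/mapP; exists (absz (n%:Z - p)); rewrite ?mem_index_iota; lia.
- exact: zrange_uniq.
- by rewrite map_inj_uniq ?iota_uniq // => i j h; lia.
Qed.

Lemma sum_flip k (F : int -> C) :
  (forall p, F p != 0 -> (`|p| <= N)%N && (absz (k - p) <= N)%N) ->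
  \sum_(p <- zrange N) F p = \sum_(p <- zrange N) F (k - p).
Proof.
move=> hF; rewrite -[RHS](big_map (fun p => k - p) xpredT).
apply: big_supp; rewrite ?zrange_uniq //.
  by rewrite map_inj_uniq ?zrange_uniq // => i j /addrI /oppr_inj.
move=> p /hF /andP[h1 h2]; rewrite mem_zrange h1 andTb.
apply/mapP; exists (k - p); rewrite ?mem_zrange //; lia.
Qed.

Lemma qm_neq0 k : qm k != 0 -> (k < 0) && (`|k| <= N)%N.
Proof.
rewrite /qm; case: ifP; rewrite ?eqxx //= => _; apply: contraR.
by rewrite -ltnNge => /qsupp ->.
Qed.

Lemma qp_neq0 k : qp k != 0 -> (0 <= k) && (`|k| <= N)%N.
Proof.
rewrite /qp; case: ifP; rewrite ?eqxx //= => h; rewrite leNgt h /=; apply: contraR.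
by rewrite -ltnNge => /qsupp ->.
Qed.

(** With p = n - l, the products of q at p and at k - p enter the commutator with factor p for q-
    q-, k for q- q+, k - p for q+ q+, and 0 for q+ q-. Only the last could be nonzero for p > n,
    that is l < 0; so nothing is lost by summing over l >= 0. *)
Lemma quad_sum n m (L : nat) : (n + N < L)%N ->
  2 * \sum_(l < L) (kernA0 n l * q ((l : nat)%:Z - m%:Z) - q (n%:Z - (l : nat)%:Z) * kernA0 l m)
  = 2 * 'i * (n%:Z - m%:Z)%:~R * conv (n%:Z - m%:Z).
Proof.
move=> nL; set k := n%:Z - m%:Z.
pose F p : C := p%:~R * (qm p * qm (k - p)).
pose G p : C := qm p * qp (k - p).
pose H p : C := (k - p)%:~R * (qp p * qp (k - p)).
have suppM (x y z : C) : x * (y * z) != 0 -> y != 0 /\ z != 0.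
  by rewrite !mulf_eq0 !negb_or => /andP[_ /andP[]].
have -> : \sum_(l < L) (kernA0 n l * q ((l : nat)%:Z - m%:Z) - q (n%:Z - (l : nat)%:Z) * kernA0 l m)
  = 2 * 'i * (\sum_(l < L) F (n%:Z - (l : nat)%:Z) + k%:~R * \sum_(l < L) G (n%:Z - (l : nat)%:Z)
     + \sum_(l < L) H (n%:Z - (l : nat)%:Z)).
  rewrite mulr_sumr -!big_split /= mulr_sumr; apply: eq_bigr => l _.
  rewrite /F /G /H (_ : k - (n%:Z - (l : nat)%:Z) = (l : nat)%:Z - m%:Z); last by rewrite /k; lia.
  rewrite /kernA0 !qE /k !rmorphB /=.
  set a := qm _; set b := qp _; set c := qm _; set d := qp _.
  rewrite -!pmulrn; ring.
have hF : \sum_(l < L) F (n%:Z - (l : nat)%:Z) = \sum_(p <- zrange N) F p.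
  apply: sum_window => // p /suppM[/qm_neq0 h _]; lia.
have hG : \sum_(l < L) G (n%:Z - (l : nat)%:Z) = \sum_(p <- zrange N) G p.
  by apply: sum_window => // p; rewrite -[G p]mul1r => /suppM[/qm_neq0 h _]; lia.
have hH : \sum_(l < L) H (n%:Z - (l : nat)%:Z) = \sum_(p <- zrange N) H p.
  apply: sum_window => // p /suppM[/qp_neq0 h /qp_neq0]; rewrite /k; lia.
rewrite {}hF {}hG {}hH.
(* Symmetrising p and k - p replaces the factor p by k/2. *)
have hF : 2 * \sum_(p <- zrange N) F p = k%:~R * \sum_(p <- zrange N) qm p * qm (k - p).
  rewrite mulr2n mulrDl mul1r {2}(sum_flip (k := k)); last first.
    by move=> p /suppM[/qm_neq0 /andP[_ ->] /qm_neq0 /andP[_ ->]].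
  rewrite mulr_sumr -big_split /=; apply: eq_bigr => p _.
  by rewrite /F subKr rmorphB /=; ring.
have hH : 2 * \sum_(p <- zrange N) H p = k%:~R * \sum_(p <- zrange N) qp p * qp (k - p).
  rewrite mulr2n mulrDl mul1r {2}(sum_flip (k := k)); last first.
    by move=> p /suppM[/qp_neq0 /andP[_ ->] /qp_neq0 /andP[_ ->]].
  rewrite mulr_sumr -big_split /=; apply: eq_bigr => p _.
  by rewrite /H subKr rmorphB /=; ring.
have hG : \sum_(p <- zrange N) G p = \sum_(p <- zrange N) qp p * qm (k - p).
  rewrite (sum_flip (k := k)); last first.
    by move=> p; rewrite -[G p]mul1r => /suppM[/qm_neq0 /andP[_ ->] /qp_neq0 /andP[_ ->]].
  by apply: eq_bigr => p _; rewrite /G subKr mulrC.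
have -> : conv k = \sum_(p <- zrange N) qm p * qm (k - p) + \sum_(p <- zrange N) G p
   + \sum_(p <- zrange N) qp p * qm (k - p) + \sum_(p <- zrange N) qp p * qp (k - p).
  by rewrite -!big_split /=; apply: eq_bigr => p _; rewrite !qE /G; ring.
rewrite -hG mulrCA [X in _ * X]mulrDr [in X in _ * (X + _)]mulrDr hF hH; ring.
Qed.

(** The Lax equation entry by entry, as M' has the entries -2 q'(n-m). The sum may stop at L because
    the n-th rows of both kernels vanish beyond n + N. *)
Lemma kern_commutator n m (L : nat) : (n + N < L)%N -> (m < L)%N ->
  \sum_(l < L) (kernA n l * kernM l m - kernM n l * kernA l m) = - 2 * BO (n%:Z - m%:Z).
Proof.
move=> nL mL; have nL' : (n < L)%N by lia.
set k := n%:Z - m%:Z.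
have E l : kernA n l * kernM l m - kernM n l * kernA l m =
  (n == l)%:R * (- 'i * n%:R ^+ 2 * kernM l m) + (m == l)%:R * ((2 * l%:R + 1) * kernA0 n l)
  - (n == l)%:R * ((2 * n%:R + 1) * kernA l m)
  + (m == l)%:R * (2 * q (n%:Z - l%:Z) * (- 'i * l%:R ^+ 2))
  - 2 * (kernA0 n l * q (l%:Z - m%:Z) - q (n%:Z - l%:Z) * kernA0 l m).
  rewrite /kernA /kernM ![l == m]eq_sym; ring.
under eq_bigr do rewrite E.
rewrite sumrB -mulr_sumr quad_sum // !big_split /= sumrN.
rewrite (sum_delta (fun l => - 'i * n%:R ^+ 2 * kernM l m) nL').
rewrite (sum_delta (fun l => (2 * l%:R + 1) * kernA0 n l) mL).
rewrite (sum_delta (fun l => (2 * n%:R + 1) * kernA l m) nL').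
rewrite (sum_delta (fun l => 2 * q (n%:Z - l%:Z) * (- 'i * l%:R ^+ 2)) mL) -/k.
rewrite /kernA /kernM /kernA0 /BO -!/k.
have [nm|nm] := eqVneq n m.
  have k0 : k = 0 by rewrite /k nm subrr.
  by rewrite k0 nm /=; ring.
have -> : q k = qm k + qp k by exact: qE.
have kE : k%:~R = n%:R - m%:R :> C by rewrite /k rmorphB.
rewrite /qm /qp kE; case: ltP => hk.
  have -> : `|k|%:~R = - (n%:R - m%:R) :> C by rewrite ltr0_norm // mulrNz kE.
  ring.
have -> : `|k|%:~R = n%:R - m%:R :> C by rewrite ger0_norm // kE.
ring.
Qed.

End Kernel.

(** * The trilinear estimate *)

Lemma mul_le_l (R : numDomainType) (a x y z : R) :
  0 <= a -> x * y <= z -> a * x * y <= a * z.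
Proof. by move=> a0 h; rewrite -mulrA ler_wpM2l. Qed.

Section Trilinear.
Variables (R : rcfType) (K N : nat) (w tau : nat -> R) (B C1 Ct eta : R).
Variables (U : int -> R).
Local Notation C := R[i].
Hypothesis w_ge1 : forall n, 1 <= w n.
Hypothesis w_sub : forall i j : int, w (absz (i + j)) <= w `|i|%N * w `|j|%N.
Hypothesis wC1 : l2bound (fun n : nat => w n / n.+1%:R) C1.
Hypothesis tau_ge0 : forall n, 0 <= tau n.
Hypothesis tauC : l2bound (fun k : int => tau `|k|%N) Ct.
Hypothesis U_ge0 : forall k, 0 <= U k.
Hypothesis UB : l2bound (fun k : int => w `|k|%N * U k) B.
(** Some frequency in the interaction of j and k - j into k is removed by the truncation. *)
Definition outside (j k : int) := [|| (N < absz j)%N, (N < absz (k - j)%R)%N | (N < absz k)%N].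
Hypothesis eta_ge0 : 0 <= eta.
Hypothesis eta_bound : forall j k : int, outside j k ->
  1 <= eta * (tau `|j|%N + tau (absz (k - j)%R) + tau `|k|%N) * (w `|j|%N * w (absz (k - j)%R) * w `|k|%N).

Variables (g h : 'cV[C]_K).
Local Notation G := (wnorm (wG w) g).
Local Notation H := (wnorm (wG w) h).

(** The factor (n+1) + (m+1) dominates |n - m|, the derivative contained in M'. *)
Definition pairw (n m : nat) (a b : R) : R := (n.+1%:R + m.+1%:R) * (a * b).
Local Notation c n m := (pairw n m (normc (g m 0)) (normc (h n 0))).
Local Notation wc n m := (w n * w m * c n m).
Let w0 := w_ge0 w_ge1.

(** The factor (n+1) + (m+1) puts the derivative on g or on h. The vector that receives it is paired
    with V by Cauchy-Schwarz; the other one has a derivative to spare, which makes it summable in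
    the weight w. *)
Lemma sum_shift (V : int -> R) (Bv : R) (a : int) :
  l2bound V Bv -> (forall k, 0 <= V k) ->
  \sum_(n < K) \sum_(m < K) V (n%:Z - m%:Z - a) * wc n m <= Bv * (2 * (C1 * (G * H))).
Proof.
move=> VB V0; have Bv0 := l2bound_ge0 VB.
have C10 : 0 <= C1 := l2bound_ge0 wC1.
have l1 (x : 'cV[C]_K) : l1sum w x <= C1 * wnorm (wG w) x.
  apply: (le_trans (l1sum_w wC1 x)); rewrite ler_wpM2l //.
  by apply: wnorm_mono => n; rewrite w1_ge0 ler_peMr ?w1_ge0.
have E : \sum_(n < K) \sum_(m < K) V (n%:Z - m%:Z - a) * wc n m =
  \sum_(n < K) (w n * normc (h n 0)) * \sum_(m < K) V (n%:Z - m%:Z - a) * (wG w m * normc (g m 0)) +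
  \sum_(m < K) (w m * normc (g m 0)) * \sum_(n < K) V (n%:Z - m%:Z - a) * (wG w n * normc (h n 0)).
  have -> : \sum_(m < K) (w m * normc (g m 0)) * \sum_(n < K) V (n%:Z - m%:Z - a) * (wG w n * normc (h n 0))
    = \sum_(n < K) \sum_(m < K) (w m * normc (g m 0)) * (V (n%:Z - m%:Z - a) * (wG w n * normc (h n 0))).
    by rewrite exchange_big; apply: eq_bigr => i _; rewrite mulr_sumr.
  rewrite -big_split; apply: eq_bigr => n _.
  rewrite mulr_sumr -big_split; apply: eq_bigr => m _ /=.
  by rewrite /wG /pairw; ring.
rewrite E mulrCA mulr_natl mulr2n; apply: lerD.
- apply: (@le_trans _ _ (\sum_(n < K) (w n * normc (h n 0)) * (Bv * G))).
    apply: ler_sum => n _; rewrite ler_wpM2l ?mulr_ge0 ?cm_ge0 //.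
    apply: (le_trans (cauchy_schwarz _ _ _)); rewrite ler_wpM2r ?wnorm_ge0 //.
    apply: (@l2bound_map _ _ _ V Bv (fun m : 'I_K => n%:Z - m%:Z - a)) => //.
      exact: index_enum_uniq.
    by move=> i j _ _ hij; apply: val_inj => /=; lia.
  rewrite -mulr_suml mulrC -mulrA ler_wpM2l //.
  by rewrite [leRHS]mulrCA ler_wpM2l ?wnorm_ge0 //; exact: l1.
- apply: (@le_trans _ _ (\sum_(n < K) (w n * normc (g n 0)) * (Bv * H))).
    apply: ler_sum => n _; rewrite ler_wpM2l ?mulr_ge0 ?cm_ge0 //.
    apply: (le_trans (cauchy_schwarz _ _ _)); rewrite ler_wpM2r ?wnorm_ge0 //.
    apply: (@l2bound_map _ _ _ V Bv (fun m : 'I_K => m%:Z - n%:Z - a)) => //.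
      exact: index_enum_uniq.
    by move=> i j _ _ hij; apply: val_inj => /=; lia.
  rewrite -mulr_suml mulrC -mulrA ler_wpM2l //.
  by rewrite [G * H]mulrC [leRHS]mulrCA ler_wpM2l ?wnorm_ge0 //; exact: l1.
Qed.

Lemma pairw_ge0 (n m : 'I_K) : 0 <= pairw n m (normc (g m 0)) (normc (h n 0)).
Proof. by rewrite !mulr_ge0 ?cm_ge0 ?addr_ge0. Qed.

Lemma wc_ge0 (n m : 'I_K) : 0 <= wc n m.
Proof. by rewrite mulr_ge0 ?pairw_ge0 // mulr_ge0. Qed.

Let Ut k := w `|k|%N * U k.
Let Ut_ge0 k : 0 <= Ut k. Proof. exact: mulr_ge0. Qed.
Local Notation D := (B * (2 * (C1 * (G * H)))).

Lemma sum_tauU (s : seq int) : uniq s ->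
  \sum_(n < K) \sum_(m < K) wc n m * (\sum_(j <- s) tau `|j|%N * (Ut j * Ut (n%:Z - m%:Z - j)))
   <= Ct * B * D.
Proof.
move=> us.
have -> : \sum_(n < K) \sum_(m < K) wc n m * (\sum_(j <- s) tau `|j|%N * (Ut j * Ut (n%:Z - m%:Z - j)))
  = \sum_(j <- s) tau `|j|%N * Ut j * (\sum_(n < K) \sum_(m < K) Ut (n%:Z - m%:Z - j) * wc n m).
  under eq_bigr => n _ do (under eq_bigr => m _ do rewrite mulr_sumr; rewrite exchange_big).
  rewrite exchange_big; apply: eq_bigr => j _ /=.
  rewrite mulr_sumr; apply: eq_bigr => n _; rewrite mulr_sumr; apply: eq_bigr => m _.
  by ring.
have D0 : 0 <= D.
  apply: (le_trans _ (@sum_shift Ut B 0 UB Ut_ge0)).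
  by apply: sumr_ge0 => n _; apply: sumr_ge0 => m _; rewrite mulr_ge0 ?wc_ge0.
apply: (@le_trans _ _ (\sum_(j <- s) tau `|j|%N * Ut j * D)).
  apply: ler_sum => j _; rewrite ler_wpM2l ?mulr_ge0 //; exact: sum_shift.
rewrite -mulr_suml ler_wpM2r //; apply: (le_trans (cauchy_schwarz _ _ _)).
by apply: ler_pM; rewrite ?l2_ge0 //; [exact: tauC | exact: UB].
Qed.

Lemma sum_tau_conv (s : seq int) : uniq s ->
  \sum_(n < K) \sum_(m < K) wc n m * (\sum_(j <- s) tau (absz (n%:Z - m%:Z - j)%R) * (Ut j * Ut (n%:Z - m%:Z - j)))
   <= Ct * B * D.
Proof.
move=> us.
(* The substitution l = n - m - j depends on n and m, so all the shifted lists are merged into one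
   before [sum_tauU] is applied. *)
pose ls := undup [seq (p.1%:Z - p.2%:Z - j : int) | p <- allpairs pair (iota 0 K) (iota 0 K), j <- s].
have uls : uniq ls by exact: undup_uniq.
apply: le_trans (sum_tauU uls).
apply: ler_sum => n _; apply: ler_sum => m _; rewrite ler_wpM2l ?wc_ge0 //.
have -> : \sum_(j <- s) tau (absz (n%:Z - m%:Z - j)%R) * (Ut j * Ut (n%:Z - m%:Z - j))
  = \sum_(l <- [seq n%:Z - m%:Z - j | j <- s]) tau `|l|%N * (Ut l * Ut (n%:Z - m%:Z - l)).
  by rewrite big_map; apply: eq_bigr => j _; rewrite subKr [Ut j * _]mulrC.
apply: big_subset.
- by rewrite map_inj_uniq // => i j hij; lia.
- move=> l /mapP[j js ->]; rewrite mem_undup; apply/allpairsP => /=.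
  exists ((n : nat, m : nat), j); split => //=.
  by apply/allpairsP; exists (n : nat, m : nat); split; rewrite ?mem_iota /=.
- by move=> l; rewrite !mulr_ge0.
Qed.

(** [eta_bound] supplies the weights of the three frequencies at the price of eta and a sum of three
    tau's; the weight at k = n - m is passed on to n and m. The factor tau is used by Cauchy-Schwarz
    in the variable it depends on. *)
Lemma trilinear (s : seq int) : uniq s ->
  \sum_(n < K) \sum_(m < K) c n m *
     (\sum_(j <- s | outside j (n%:Z - m%:Z)) U j * U (n%:Z - m%:Z - j))
  <= eta * (3 * (Ct * B * D)).
Proof.
move=> us.
pose k (n m : nat) := n%:Z - m%:Z.
apply: (@le_trans _ _ (\sum_(n < K) \sum_(m < K) eta *
  (wc n m * (\sum_(j <- s) tau `|j|%N * (Ut j * Ut (k n m - j)))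
  + wc n m * (\sum_(j <- s) tau (absz (k n m - j)%R) * (Ut j * Ut (k n m - j)))
  + wc n m * (\sum_(j <- s) tau `|k n m|%N * (Ut j * Ut (k n m - j)))))).
  apply: ler_sum => n _; apply: ler_sum => m _; rewrite -/(k n m).
  have -> : eta *
  (wc n m * (\sum_(j <- s) tau `|j|%N * (Ut j * Ut (k n m - j)))
  + wc n m * (\sum_(j <- s) tau (absz (k n m - j)%R) * (Ut j * Ut (k n m - j)))
  + wc n m * (\sum_(j <- s) tau `|k n m|%N * (Ut j * Ut (k n m - j)))) =
  c n m * \sum_(j <- s) eta * (tau `|j|%N + tau (absz (k n m - j)%R) + tau `|k n m|%N)
     * ((Ut j * Ut (k n m - j)) * (w n * w m)).
    rewrite -!mulrDr -!big_split /= !mulr_sumr; apply: eq_bigr => j _; ring.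
  rewrite ler_wpM2l ?pairw_ge0 // big_mkcond; apply: ler_sum => j _.
  have tau3 : 0 <= eta * (tau `|j|%N + tau (absz (k n m - j)%R) + tau `|k n m|%N).
    by rewrite mulr_ge0 ?addr_ge0.
  case: ifP => [out|_]; last by apply: mulr_ge0 => //; rewrite !mulr_ge0.
  rewrite -[leLHS]mul1r; apply: (le_trans (ler_wpM2r _ (eta_bound out))).
    by rewrite mulr_ge0.
  apply: (mul_le_l tau3).
  have -> : w `|j|%N * w (absz (k n m - j)%R) * w `|k n m|%N * (U j * U (k n m - j))
    = Ut j * Ut (k n m - j) * w `|k n m|%N by rewrite /Ut; ring.
  rewrite ler_wpM2l ?mulr_ge0 //.
  by have := w_sub n%:Z (- m%:Z); rewrite abszN !absz_nat.
have -> : \sum_(n < K) \sum_(m < K) eta *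
  (wc n m * (\sum_(j <- s) tau `|j|%N * (Ut j * Ut (k n m - j)))
  + wc n m * (\sum_(j <- s) tau (absz (k n m - j)%R) * (Ut j * Ut (k n m - j)))
  + wc n m * (\sum_(j <- s) tau `|k n m|%N * (Ut j * Ut (k n m - j)))) =
  eta * (\sum_(n < K) \sum_(m < K) wc n m * (\sum_(j <- s) tau `|j|%N * (Ut j * Ut (k n m - j)))
  + \sum_(n < K) \sum_(m < K) wc n m * (\sum_(j <- s) tau (absz (k n m - j)%R) * (Ut j * Ut (k n m - j)))
  + \sum_(n < K) \sum_(m < K) wc n m * (\sum_(j <- s) tau `|k n m|%N * (Ut j * Ut (k n m - j)))).
  rewrite -!big_split /= mulr_sumr; apply: eq_bigr => n _.
  by rewrite -!big_split /= mulr_sumr; apply: eq_bigr => m _.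
rewrite ler_wpM2l //.
have h1 := sum_tauU us; have h2 := sum_tau_conv us.
have h3 : \sum_(n < K) \sum_(m < K) wc n m * (\sum_(j <- s) tau `|k n m|%N * (Ut j * Ut (k n m - j)))
   <= Ct * B * D.
  (* When tau sits on k, the sum over j is closed first, leaving tau itself in the role of V in
     [sum_shift]. *)
  apply: (@le_trans _ _ (\sum_(n < K) \sum_(m < K) (B * B) * (tau (absz (k n m - 0)%R) * wc n m))).
    apply: ler_sum => n _; apply: ler_sum => m _.
    rewrite subr0 -mulr_sumr mulrA mulrC [wc n m * _]mulrC.
    have hs : \sum_(i <- s) Ut i * Ut (k n m - i) <= B * B.
      apply: (le_trans (cauchy_schwarz _ _ _)).
      apply: ler_pM; rewrite ?l2_ge0 //; first exact: UB.
      by apply: (@l2bound_map _ _ _ _ B (fun j => k n m - j) s UB us) => i j _ _ /addrI /oppr_inj.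
    by rewrite (ler_wpM2r (mulr_ge0 (tau_ge0 _) (wc_ge0 n m)) hs).
  under eq_bigr do rewrite -mulr_sumr.
  rewrite -mulr_sumr.
  have -> : Ct * B * D = B * B * (Ct * (2 * (C1 * (G * H)))) by ring.
  rewrite ler_wpM2l ?mulr_ge0 ?(l2bound_ge0 UB) //.
  exact: (@sum_shift (fun k => tau `|k|%N) Ct 0 tauC).
have -> : 3 * (Ct * B * D) = Ct * B * D + Ct * B * D + Ct * B * D by ring.
by apply: lerD h3; apply: lerD h1 h2.
Qed.

End Trilinear.

(** * Truncation errors *)

Section BilinearBounds.
Variables (R : rcfType) (K : nat).
Local Notation C := R[i].
Implicit Types (x h : 'cV[C]_K) (A : 'M[C]_K).

Lemma ip_mx_le A x h : normc (ip (A *m x) h) <=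
  \sum_(n < K) \sum_(m < K) normc (A n m) * (normc (x m 0) * normc (h n 0)).
Proof.
apply: (le_trans (cm_sum _ _)); apply: ler_sum => n _.
rewrite normcM cm_conj mxE; apply: (le_trans (ler_wpM2r (cm_ge0 _) (cm_sum _ _))).
by rewrite mulr_suml; apply: ler_sum => m _; rewrite normcM mulrA.
Qed.

(** The last N entries are the only ones that q couples to indices beyond the matrix. *)
Definition tail (N : nat) x : R := \sum_(i < K | (K <= i + N)%N) normc (x i 0).

Lemma tail_ge0 N x : 0 <= tail N x.
Proof. by apply: sumr_ge0 => i _; exact: cm_ge0. Qed.

Lemma cm_le_w1 x (i : 'I_K) : i.+1%:R * normc (x i 0) <= wnorm (w1 R) x.
Proof.
rewrite -[leLHS]ger0_norm ?mulr_ge0 ?cm_ge0 // -sqrtr_sqr; apply: ler_wsqrtr.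
by rewrite (bigD1 i) //= lerDl; apply: sumr_ge0 => j _; exact: sqr_ge0.
Qed.

(** At most N entries occur, and 2(i+1) >= K for each of them because 2N <= K. *)
Lemma tail_le N x : (2 * N <= K)%N -> (0 < K)%N ->
  tail N x <= 2 * N%:R / K%:R * wnorm (w1 R) x.
Proof.
move=> NK K0; have Kr : 0 < K%:R :> R by rewrite ltr0n.
have count : (\sum_(i < K | (K <= i + N)%N) 1 <= N)%N.
  rewrite -(big_mkord (fun i => K <= i + N)%N (fun=> 1%N)).
  rewrite (big_cat_nat (n := (K - N)%N)) //=; last by lia.
  rewrite big_nat_cond big_pred0 => [|i]; last by lia.
  rewrite add0n big_mkcond; apply: (@leq_trans (\sum_(K - N <= i < K) 1)).
    by apply: leq_sum => i _; case: ifP.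
  by rewrite sum_nat_const_nat; lia.
have -> : 2 * N%:R / K%:R * wnorm (w1 R) x = N%:R * (2 / K%:R * wnorm (w1 R) x) by ring.
apply: (@le_trans _ _ (\sum_(i < K | (K <= i + N)%N) 2 / K%:R * wnorm (w1 R) x)).
  apply: ler_sum => i hi.
  have := cm_le_w1 x i; set a := normc _; set W := wnorm _ _ => h.
  rewrite -(ler_pM2l Kr) mulrA mulrCA divff ?gt_eqF // mulr1.
  apply: (@le_trans _ _ (2 * (i.+1%:R * a))); last by rewrite ler_pM2l.
  rewrite mulrA ler_wpM2r ?cm_ge0 // -natrM ler_nat; lia.
rewrite sumr_const -[leLHS]mulr_natl ler_wpM2r ?mulr_ge0 ?invr_ge0 ?wnorm_ge0 ?ler0n //.
by rewrite ler_nat -sum1_card.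
Qed.

End BilinearBounds.

Section Errors.
Variables (R : rcfType) (K N : nat) (q qd e : int -> R[i]) (B : R).
Local Notation C := R[i].
Implicit Types (x h : 'cV[C]_K).
Hypothesis qsupp : forall k : int, (N < `|k|)%N -> q k = 0.
Hypothesis qle : forall k, normc (q k) <= B.
Hypothesis qdE : forall k, qd k = BO q N k + 'i * k%:~R * e k.
Hypothesis K_gt0 : (0 < K)%N.
Hypothesis NK : (2 * N <= K)%N.

Definition matA : 'M[C]_K := \matrix_(n, m) kernA q n m.
Definition matMd : 'M[C]_K := \matrix_(n, m) (- 2 * qd (n%:Z - m%:Z)).
Definition matS : 'M[C]_K := \matrix_(n, m) ((m : nat) == n.+1)%:R.
Definition matE : 'M[C]_K := \matrix_(n, m) (- 2 * ('i * (n%:Z - m%:Z)%:~R * e (n%:Z - m%:Z))).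
Local Notation M := (matM K q).

(** On half-infinite matrices [shifterr] would vanish, and [laxerr] would reduce to [matE], the
    effect of truncating u in frequency. [corner] is the further effect of cutting the matrices. *)
Definition laxerr : 'M[C]_K := matMd - (matA *m M - M *m matA).
Definition corner : 'M[C]_K := laxerr - matE.
Definition shifterr : 'M[C]_K := matS *m matA - matA *m matS + 'i *: (M *m matS).

Lemma matME (n m : 'I_K) : M n m = kernM q n m.
Proof.
rewrite mxE /kernM -val_eqE; case: eqP => /= _; last by rewrite mul0r.
by rewrite mul1r natrD natrM.
Qed.

(** [kern_commutator] sums l up to K + N, the matrix product only up to K - 1; these are the missing
    terms. *)
Lemma cornerE (n m : 'I_K) :
  corner n m = \sum_(l < N.+1) (- 4 * 'i * (n%:R - m%:R) * (q (n%:Z - (K + l)%:Z) * q ((K + l)%:Z - m%:Z))).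
Proof.
have n1 := ltn_ord n; have m1 := ltn_ord m.
have h := @kern_commutator R q N qsupp n m (K + N.+1) ltac:(lia) ltac:(lia).
rewrite big_split_ord /= in h.
rewrite /corner /laxerr !mxE qdE mulrDr.
have -> : \sum_j matA n j * M j m = \sum_(l < K) kernA q n l * kernM q l m.
  by apply: eq_bigr => j _; rewrite matME mxE.
have -> : \sum_j M n j * matA j m = \sum_(l < K) kernM q n l * kernA q l m.
  by apply: eq_bigr => j _; rewrite matME mxE.
rewrite -sumrB -h; set S1 := \sum_(i < K) _; set S2 := \sum_(i < N.+1) _.
set X := - 2 * _; have -> : S1 + S2 + X - S1 - X = S2 by ring.
apply: eq_bigr => l _.
rewrite /kernA /kernM /kernA0 (_ : (n == K + l :> nat)%N = false); last by lia.
rewrite (_ : (K + l == m)%N = false); last by lia.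
rewrite /qm /qp (_ : n%:Z - (K + l)%:Z < 0 = true); last by lia.
rewrite (_ : (K + l)%:Z - m%:Z < 0 = false); last by lia.
by rewrite /= mulr0n; set a := q _; set b := q _; ring.
Qed.

Lemma corner_le (n m : 'I_K) : normc (corner n m) <=
  if (K <= n + N)%N && (K <= m + N)%N then 4 * K%:R * N.+1%:R * B ^+ 2 else 0.
Proof.
have n1 := ltn_ord n; have m1 := ltn_ord m.
have B0 : 0 <= B := le_trans (cm_ge0 (q 0)) (qle 0).
rewrite cornerE; case: ifP => [_|out]; last first.
  rewrite big1 ?normc0 // => l _.
  have [hn|hn] := leqP K (n + N); last by rewrite qsupp ?mul0r ?mulr0 //; lia.
  by rewrite [q (_ - m%:Z)]qsupp ?mulr0 //; lia.
apply: (le_trans (cm_sum _ _)).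
apply: (@le_trans _ _ (\sum_(l < N.+1) 4 * K%:R * B ^+ 2)); last first.
  rewrite sumr_const card_ord -mulr_natl le_eqVlt; apply/orP; left; apply/eqP; ring.
apply: ler_sum => l _; rewrite !normcM.
have -> : normc (- 4 : C) = 4 by rewrite normcN (cm_nat R 4).
have -> : normc 'i%C = 1 :> R by rewrite /= expr0n expr1n add0r sqrtr1.
rewrite mulr1 expr2; apply: ler_pM; rewrite ?mulr_ge0 ?cm_ge0 //; last first.
  by apply: ler_pM; rewrite ?cm_ge0 ?qle.
rewrite ler_wpM2l //.
have -> : n%:R - m%:R = ((n%:R - m%:R)%:C)%C :> C by rewrite rmorphB !rmorph_nat.
by rewrite cm_real ler_norml; have := ltn_ord n; have := ltn_ord m;
  rewrite -!(ltr_nat R) => *; apply/andP; split; have := ler0n R n; have := ler0n R m; lra.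
Qed.

(** The entries grow like K, but each of the two tails gives a factor 2N/K. *)
Lemma corner_ip x h : normc (ip (corner *m x) h) <=
  16 * N%:R ^+ 2 * N.+1%:R * B ^+ 2 / K%:R * (wnorm (w1 R) x * wnorm (w1 R) h).
Proof.
have Kr : 0 < K%:R :> R by rewrite ltr0n.
have B0 : 0 <= B := le_trans (cm_ge0 (q 0)) (qle 0).
apply: (le_trans (ip_mx_le _ _ _)).
apply: (@le_trans _ _ (4 * K%:R * N.+1%:R * B ^+ 2 * (tail N x * tail N h))).
  rewrite [tail N x * _]mulrC /tail mulr_suml mulr_sumr [leRHS]big_mkcond; apply: ler_sum => n _.
  case: ifP => hn; last first.
    apply: sumr_le0 => m _; have := corner_le n m; rewrite hn /= => c0.
    by rewrite mulr_le0_ge0 ?mulr_ge0 ?cm_ge0.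
  rewrite mulr_sumr mulr_sumr [leRHS]big_mkcond.
  apply: ler_sum => m _; have := corner_le n m; rewrite hn /=.
  case: ifP => hm cl; last by rewrite mulr_le0_ge0 ?mulr_ge0 ?cm_ge0.
  by rewrite [normc (h n 0) * _]mulrC ler_wpM2r ?mulr_ge0 ?cm_ge0.
have hx := tail_le x NK K_gt0; have hh := tail_le h NK K_gt0.
apply: (le_trans (ler_wpM2l _ (ler_pM (tail_ge0 _ _) (tail_ge0 _ _) hx hh))).
  by rewrite !mulr_ge0 ?sqr_ge0.
by rewrite le_eqVlt; apply/orP; left; apply/eqP; field; rewrite gt_eqF.
Qed.

(** The kernels satisfy A(n+1,l) = A(n,l-1) - i M(n,l-1) exactly, with zero on both sides for l = 0.
    Only the last row fails, since S has no row K to shift up. *)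
Lemma matS_mul_le (n l : 'I_K) :
  shifterr n l = - ((n.+1 == K)%:R * kernA0 q K l).
Proof.
have n1 := ltn_ord n; have l1 := ltn_ord l.
have sumS (F : nat -> C) : \sum_(m < K) ((m : nat) == n.+1)%:R * F m = (n.+1 < K)%N%:R * F n.+1.
  have [nK|nK] := ltnP n.+1 K; last first.
    by rewrite mul0r big1 // => m _; have := ltn_ord m; case: eqP => [|]; rewrite ?mul0r //; lia.
  by rewrite mul1r -[RHS](sum_delta F nK); apply: eq_bigr => m _; rewrite eq_sym.
have sumS2 (F : nat -> C) : \sum_(m < K) F m * ((l : nat) == m.+1)%:R = (0 < l)%N%:R * F l.-1.
  case El: (l : nat) => [|l'] /=.
    by rewrite mul0r big1 // => m _; rewrite mulr0.
  have l'K : (l' < K)%N by lia.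
  rewrite mul1r -(sum_delta F l'K); apply: eq_bigr => m _.
  by rewrite eqSS mulrC.
rewrite !mxE.
have -> : \sum_j matS n j * matA j l = (n.+1 < K)%N%:R * kernA q n.+1 l.
  by rewrite -(sumS (fun j => kernA q j l)); apply: eq_bigr => j _; rewrite !mxE.
have -> : \sum_j matA n j * matS j l = (0 < l)%N%:R * kernA q n l.-1.
  by rewrite -(sumS2 (fun j => kernA q n j)); apply: eq_bigr => j _; rewrite !mxE.
have -> : \sum_j M n j * matS j l = (0 < l)%N%:R * kernM q n l.-1.
  by rewrite -(sumS2 (fun j => kernM q n j)); apply: eq_bigr => j _; rewrite matME mxE.
have key : kernA q n.+1 l = (0 < l)%N%:R * (kernA q n l.-1 - 'i * kernM q n l.-1).
  rewrite /kernA /kernM /kernA0; case: (l : nat) => [|l'] /=.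
    by rewrite /qm (_ : n.+1%:Z - 0 < 0 = false) //; ring.
  rewrite (_ : n.+1%:Z - l'.+1%:Z = n%:Z - l'%:Z); last by lia.
  rewrite eqSS (qE q) -(natr1 n) -(natr1 l').
  have [->|_] := eqVneq (n : nat) l'; ring.
have [nK|nK] := ltnP n.+1 K.
  by rewrite key (_ : (n.+1 == K) = false) ?mul1r ?mul0r ?oppr0; [ring | lia].
rewrite (_ : n.+1 == K) ?mul1r ?mul0r; last by lia.
have nK' : n.+1 = K by lia.
have -> : kernA0 q K l = kernA q n.+1 l.
  by rewrite nK' /kernA (_ : (K == l :> nat) = false) ?mul0r ?add0r //; lia.
rewrite key; ring.
Qed.

Lemma shifterr_ip x h : normc (ip (shifterr *m x) h) <=
  2 * B * (tail N x * wnorm (w1 R) h).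
Proof.
have B0 : 0 <= B := le_trans (cm_ge0 (q 0)) (qle 0).
have Kr : 0 < K%:R :> R by rewrite ltr0n.
apply: (le_trans (ip_mx_le _ _ _)).
have pK : (K.-1 < K)%N by lia.
rewrite (bigD1 (Ordinal pK)) //= [X in _ + X]big1 ?addr0; last first.
  move=> n /eqP nK; apply: big1 => m _; rewrite matS_mul_le.
  rewrite (_ : n.+1 == K = false) ?mul0r ?oppr0 ?normc0 ?mul0r //.
  by apply/eqP => nK'; apply: nK; apply: val_inj => /=; lia.
have := cm_le_w1 h (Ordinal pK); set hn := normc (h _ 0); rewrite /= prednK // => hh.
apply: (@le_trans _ _ (2 * B * (tail N x * (K%:R * hn)))); last first.
  by rewrite ler_wpM2l ?mulr_ge0 // ler_wpM2l ?tail_ge0.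
rewrite /tail mulr_suml mulr_sumr [leRHS]big_mkcond; apply: ler_sum => m _.
have mK := ltn_ord m.
rewrite matS_mul_le /= prednK // eqxx mul1r normcN /kernA0.
rewrite /qm /qp (_ : K%:Z - m%:Z < 0 = false); last by lia.
rewrite mulr0 add0r !normcM (cm_nat R 2) cm_nat.
have -> : normc 'i%C = 1 :> R by rewrite /= expr0n expr1n add0r sqrtr1.
case: ifP => hm; last by rewrite qsupp ?normc0 ?mul0r ?mulr0 ?mul0r //; lia.
have -> : 2 * B * (normc (x m 0) * (K%:R * hn)) = (2 * 1 * (B * K%:R)) * (normc (x m 0) * hn) by ring.
rewrite ler_wpM2r ?mulr_ge0 ?cm_ge0 // ler_wpM2l // ?mulr1 //.
by apply: ler_pM; rewrite ?cm_ge0 // ler_nat ltnW.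
Qed.

End Errors.

Section LaxError.
Variables (R : rcfType) (K N : nat) (w tau : nat -> R) (B C1 Ct eta : R).
Variables (u q qd e : int -> R[i]).
Local Notation C := R[i].
Hypothesis w_ge1 : forall n, 1 <= w n.
Hypothesis w_sub : forall i j : int, w (absz (i + j)) <= w `|i|%N * w `|j|%N.
Hypothesis wC1 : l2bound (fun n : nat => w n / n.+1%:R) C1.
Hypothesis tau_ge0 : forall n, 0 <= tau n.
Hypothesis tauC : l2bound (fun k : int => tau `|k|%N) Ct.
Hypothesis uB : l2bound (fun k : int => w `|k|%N * normc (u k)) B.
Hypothesis eta_ge0 : 0 <= eta.
Hypothesis eta_bound : forall j k : int, outside N j k ->
  1 <= eta * (tau `|j|%N + tau (absz (k - j)%R) + tau `|k|%N) * (w `|j|%N * w (absz (k - j)%R) * w `|k|%N).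
Hypothesis e_tail : forall (d : R) (ks : seq int), 0 < d -> exists2 s : seq int, uniq s &
  forall k, k \in ks -> normc (e k) <=
    \sum_(j <- s | outside N j k) normc (u j) * normc (u (k - j)) + d.
Hypothesis qE : forall k : int, q k = if (`|k| <= N)%N then u k else 0.
Hypothesis qdE : forall k, qd k = BO q N k + 'i * k%:~R * e k.
Hypothesis K_gt0 : (0 < K)%N.
Hypothesis NK : (2 * N <= K)%N.
Implicit Types (x h : 'cV[C]_K).

Lemma q_supp : forall k : int, (N < `|k|)%N -> q k = 0.
Proof. by move=> k kN; rewrite qE leqNgt kN. Qed.

Lemma q_le k : normc (q k) <= B.
Proof.
rewrite qE; case: ifP => _; last by rewrite normc0 (l2bound_ge0 uB).
apply: (le_trans _ (uB (s := [:: k]) isT)).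
rewrite /l2 big_seq1 sqrtr_sqr ger0_norm ?mulr_ge0 ?cm_ge0 ?(w_ge0 w_ge1) //.
by rewrite ler_peMl ?cm_ge0.
Qed.

Lemma q_l2 : l2bound (fun k : int => w `|k|%N * normc (q k)) B.
Proof.
move=> s us; apply: le_trans (uB us); apply: l2_mono => k _.
rewrite ger0_norm ?mulr_ge0 ?cm_ge0 ?(w_ge0 w_ge1) // ler_wpM2l ?(w_ge0 w_ge1) //.
by rewrite qE; case: ifP; rewrite ?normc0 ?cm_ge0.
Qed.

Lemma matE_ip x h : normc (ip (matE K e *m x) h) <=
  12 * eta * Ct * C1 * B ^+ 2 * (wnorm (wG w) x * wnorm (wG w) h).
Proof.
pose c (n m : 'I_K) := pairw n m (normc (x m 0)) (normc (h n 0)).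
have c0 n m : 0 <= c n m by rewrite !mulr_ge0 ?cm_ge0 ?addr_ge0.
pose c1 := \sum_(n < K) \sum_(m < K) c n m.
have c10 : 0 <= c1 by apply: sumr_ge0 => n _; apply: sumr_ge0 => m _.
apply/ler_addgt0Pr => d d0.
(* Each entry contributes 2 d' times its coefficient, and the coefficients add up to [c1]; the 1
   avoids division by zero. *)
pose d' := d / (2 * c1 + 1).
have c1p : 0 < 2 * c1 + 1 by rewrite ltr_wpDl ?mulr_ge0.
have d'0 : 0 < d' by rewrite divr_gt0.
have [s us hs] := e_tail [seq n%:Z - m%:Z | n <- iota 0 K, m <- iota 0 K] d'0.
have tri := @trilinear R K N w tau B C1 Ct eta (fun k => normc (u k)) w_ge1 w_sub
  wC1 tau_ge0 tauC (fun k => cm_ge0 (u k)) uB eta_ge0 eta_bound x h s us.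
apply: (le_trans (ip_mx_le _ _ _)).
apply: (@le_trans _ _ (2 * (\sum_(n < K) \sum_(m < K) c n m *
   (\sum_(j <- s | outside N j (n%:Z - m%:Z)) normc (u j) * normc (u (n%:Z - m%:Z - j))) + d' * c1))).
  rewrite mulr_sumr -big_split /= mulr_sumr; apply: ler_sum => n _.
  rewrite mulr_sumr -big_split /= mulr_sumr; apply: ler_sum => m _.
  rewrite mxE normcM normcN (cm_nat R 2) !normcM.
  have -> : normc 'i%C = 1 :> R by rewrite /= expr0n expr1n add0r sqrtr1.
  rewrite mul1r -mulrA ler_wpM2l // [d' * _]mulrC -mulrDr.
  have kn : normc ((n%:Z - m%:Z)%:~R : C) <= n.+1%:R + m.+1%:R.
    rewrite rmorphB /=; apply: (le_trans (cmB _ _)); rewrite -!pmulrn !cm_nat.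
    by apply: lerD; rewrite ler_nat.
  have := hs (n%:Z - m%:Z) (allpairs_f _ _ _).
  rewrite !mem_iota => /(_ (ltn_ord n) (ltn_ord m)); set S := _ + _ => hS.
  rewrite /c /pairw [leRHS]mulrAC; apply: ler_pM; rewrite ?mulr_ge0 ?cm_ge0 //.
  by apply: ler_pM; rewrite ?cm_ge0.
rewrite mulrDr; apply: lerD.
  apply: (le_trans (ler_wpM2l _ tri)) => //.
  by rewrite le_eqVlt; apply/orP; left; apply/eqP; ring.
rewrite /d' mulrCA mulrAC ler_pdivrMr // ler_pM2l // lerDl ler01 //.
Qed.

(** In this order: truncation of u, corner, shift. The first is small for large N through eta, the
    other two for K large compared with N. *)
Definition lax_eps : R := 12 * eta * Ct * C1 * B ^+ 2
  + 16 * N%:R ^+ 2 * N.+1%:R * B ^+ 2 / K%:R + 4 * B * N%:R / K%:R.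

Lemma w1_le_wG x : wnorm (w1 R) x <= wnorm (wG w) x.
Proof. by apply: wnorm_mono => n; rewrite w1_ge0 ler_peMr ?w1_ge0. Qed.

Let B0 : 0 <= B. Proof. exact: l2bound_ge0 uB. Qed.
Let Ct0 : 0 <= Ct. Proof. exact: l2bound_ge0 tauC. Qed.
Let C10 : 0 <= C1. Proof. exact: l2bound_ge0 wC1. Qed.

Lemma lax_eps_ge0 : 0 <= lax_eps.
Proof. by rewrite !addr_ge0 ?divr_ge0 ?mulr_ge0 ?sqr_ge0. Qed.

Lemma laxerr_ip x h : normc (ip (laxerr K q qd *m x) h) <=
  lax_eps * (wnorm (wG w) x * wnorm (wG w) h).
Proof.
have -> : laxerr K q qd = corner K q qd e + matE K e by rewrite subrK.
rewrite mulmxDl ipDl; apply: (le_trans (le_normcD _ _)).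
have h1 := @corner_ip R K N q qd e B q_supp q_le qdE K_gt0 NK x h.
have h2 := matE_ip x h.
have h3 : wnorm (w1 R) x * wnorm (w1 R) h <= wnorm (wG w) x * wnorm (wG w) h.
  by apply: ler_pM; rewrite ?wnorm_ge0 ?w1_le_wG.
have c0 : 0 <= 16 * N%:R ^+ 2 * N.+1%:R * B ^+ 2 / K%:R.
  by rewrite !(divr_ge0, mulr_ge0) ?sqr_ge0.
apply: (le_trans (lerD (le_trans h1 (ler_wpM2l c0 h3)) h2)).
rewrite -mulrDl ler_wpM2r ?mulr_ge0 ?wnorm_ge0 // addrC lerDl.
by rewrite divr_ge0 ?mulr_ge0.
Qed.

Lemma shifterr_small x h : normc (ip (shifterr K q *m x) h) <=
  lax_eps * (wnorm (wG w) x * wnorm (wG w) h).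
Proof.
have h1 := @shifterr_ip R K N q B q_supp q_le K_gt0 NK x h.
apply: (le_trans h1); have h2 := tail_le x NK K_gt0.
apply: (@le_trans _ _ (4 * B * N%:R / K%:R * (wnorm (w1 R) x * wnorm (w1 R) h))).
  apply: (le_trans (ler_wpM2l _ (ler_wpM2r (wnorm_ge0 _ _) h2))); first by rewrite mulr_ge0.
  by rewrite le_eqVlt; apply/orP; left; apply/eqP; ring.
apply: ler_pM; rewrite ?divr_ge0 ?mulr_ge0 ?wnorm_ge0 //; last first.
  by apply: ler_pM; rewrite ?wnorm_ge0 ?w1_le_wG.
by rewrite lerDr addr_ge0 ?divr_ge0 ?mulr_ge0 ?sqr_ge0.
Qed.

(** The shift error reads only the last N entries of x, all beyond N when K > 2N. *)
Lemma shifterr_supp x h : (2 * N < K)%N ->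
  (forall i : 'I_K, (N < i)%N -> x i 0 = 0) -> ip (shifterr K q *m x) h = 0.
Proof.
move=> NK' xN; apply: eq0_normc; apply: le_anti; rewrite cm_ge0 andbT.
have h1 := @shifterr_ip R K N q B q_supp q_le K_gt0 NK x h.
apply: (le_trans h1); rewrite /tail big1 ?mul0r ?mulr0 // => i hi.
by rewrite xN ?normc0 //; lia.
Qed.

End LaxError.

(** * Calculus within a set of times *)

Section Calculus.
Variables (R : rcfType) (I : R -> Prop).
Local Notation C := R[i].
Implicit Types (F G : R -> C) (t : R).

Definition cont F t : Prop := forall eps : R, 0 < eps -> exists2 d : R, 0 < d &
  forall t', I t' -> `|t' - t| < d -> normc (F t' - F t) < eps.

Lemma cont_cst (c : C) t : cont (fun=> c) t.
Proof. by move=> eps e0; exists 1 => // t' _ _; rewrite subrr normc0. Qed.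

Lemma cont_id t : cont (fun t => t%:C) t.
Proof. by move=> eps e0; exists eps => // t' _; rewrite -rmorphB cm_real. Qed.

Lemma contD F G t : cont F t -> cont G t -> cont (fun t => F t + G t) t.
Proof.
move=> cF cG eps e0; have e2 : 0 < eps / 2 by rewrite divr_gt0.
have [d1 d10 h1] := cF _ e2; have [d2 d20 h2] := cG _ e2.
exists (Num.min d1 d2) => [|t' It']; first by rewrite lt_min d10.
rewrite lt_min => /andP[l1 l2]; have := h1 _ It' l1; have := h2 _ It' l2 => a b.
have -> : F t' + G t' - (F t + G t) = (F t' - F t) + (G t' - G t) by ring.
by apply: (le_lt_trans (le_normcD _ _)); rewrite [ltRHS]splitr ltrD.
Qed.

Lemma contM F G t : cont F t -> cont G t -> cont (fun t => F t * G t) t.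
Proof.
move=> cF cG eps e0.
pose a := normc (F t) + 1; pose b := normc (G t) + 1.
have a0 : 0 < a by rewrite ltr_wpDl ?cm_ge0.
have b0 : 0 < b by rewrite ltr_wpDl ?cm_ge0.
have [d1 d10 h1] := cF (eps / 2 / b) (divr_gt0 (divr_gt0 e0 (ltr0Sn _ _)) b0).
have [d2 d20 h2] := cG (eps / 2 / a) (divr_gt0 (divr_gt0 e0 (ltr0Sn _ _)) a0).
have [d3 d30 h3] := cG 1 ltr01.
exists (Num.min d1 (Num.min d2 d3)) => [|t' It']; first by rewrite !lt_min d10 d20.
rewrite !lt_min => /and3P[l1 l2 l3].
have g1 := h1 _ It' l1; have g2 := h2 _ It' l2; have g3 := h3 _ It' l3.
have -> : F t' * G t' - F t * G t = (F t' - F t) * G t' + F t * (G t' - G t) by ring.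
apply: (le_lt_trans (le_normcD _ _)); rewrite !normcM.
have Gb : normc (G t') <= b.
  rewrite -[G t'](subrK (G t)) addrC; apply: (le_trans (le_normcD _ _)).
  by rewrite lerD2l ltW.
rewrite [ltRHS]splitr; apply: ltr_leD.
  apply: (le_lt_trans (ler_wpM2l (cm_ge0 _) Gb)).
  by rewrite -ltr_pdivlMr.
apply: (@le_trans _ _ (a * normc (G t' - G t))).
  by rewrite ler_wpM2r ?cm_ge0 // lerDl.
by rewrite mulrC -ler_pdivlMr // ltW.
Qed.

Lemma cont_sum (J : Type) (s : seq J) (F : J -> R -> C) t :
  (forall j, cont (F j) t) -> cont (fun t => \sum_(j <- s) F j t) t.
Proof.
move=> cF; elim: s => [|j s IH] eps e0.
  by exists 1 => // t' _ _; rewrite !big_nil subrr normc0.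
have [d d0 h] := contD (cF j) IH e0.
by exists d => // t' It' l; rewrite !big_cons; exact: h.
Qed.

Lemma cont_ext F G t : I t -> (forall t', I t' -> F t' = G t') -> cont G t -> cont F t.
Proof.
move=> It FG cG eps /cG [d d0 h]; exists d => // t' It' l; rewrite !FG //; exact: h.
Qed.

Lemma cont_squeeze F (J : Type) (s : seq J) (G : J -> R -> C) t :
  (forall j, cont (G j) t) ->
  (forall t', I t' -> normc (F t' - F t) <= \sum_(j <- s) normc (G j t' - G j t)) -> cont F t.
Proof.
move=> cG; elim: s F => [|j s IH] F hF eps e0.
  exists 1 => // t' It' _; have := hF _ It'; rewrite big_nil => /le_lt_trans; exact.
have : exists2 d : R, 0 < d & forall t', I t' -> `|t' - t| < d ->
   \sum_(j <- j :: s) normc (G j t' - G j t) < eps.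
  elim: (j :: s) eps e0 => [|k r IH2] eps e0.
    by exists 1 => // t' _ _; rewrite big_nil.
  have e2 : 0 < eps / 2 by rewrite divr_gt0.
  have [d1 d10 h1] := cG k _ e2; have [d2 d20 h2] := IH2 _ e2.
  exists (Num.min d1 d2) => [|t' It']; first by rewrite lt_min d10.
  rewrite lt_min => /andP[l1 l2]; rewrite big_cons [ltRHS]splitr.
  by apply: ltrD; [exact: h1 | exact: h2].
move=> [d d0 h]; exists d => // t' It' l; exact: le_lt_trans (hF _ It') (h _ It' l).
Qed.

Definition mcont m n (A : R -> 'M[C]_(m, n)) t := forall i j, cont (fun t => A t i j) t.

Lemma mcont_mul m n p (A : R -> 'M[C]_(m, n)) (B : R -> 'M[C]_(n, p)) t :
  I t -> mcont A t -> mcont B t -> mcont (fun t => A t *m B t) t.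
Proof.
move=> It cA cB i j; apply: (cont_ext It (G := fun t => \sum_k A t i k * B t k j)).
  by move=> t' _; rewrite mxE.
by apply: cont_sum => k; apply: contM.
Qed.

(** Carathéodory's form of the derivative: the difference quotient P is continuous at t. Product and
    inverse rules become algebraic identities, and the end points of I need no separate
    treatment. *)
Definition mder m n (A : R -> 'M[C]_(m, n)) (A' : 'M[C]_(m, n)) t : Prop :=
  exists2 P : R -> 'M[C]_(m, n), mcont P t /\ P t = A' &
    forall t', I t' -> A t' - A t = (t' - t)%:C *: P t'.

Lemma mder_cont m n (A : R -> 'M[C]_(m, n)) A' t : I t -> mder A A' t -> mcont A t.
Proof.
move=> It [P [cP _] h] i j.
apply: (cont_ext It (G := fun t' => A t i j + (t'%:C - t%:C) * P t' i j)).
  move=> t' It'; have /(congr1 (fun M : 'M[C]_(m, n) => M i j)) := h _ It'.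
  by rewrite !mxE rmorphB => <-; rewrite addrCA subrr addr0.
apply: contD; first exact: cont_cst.
by apply: contM (cP i j); apply: contD (@cont_id t) (@cont_cst _ t).
Qed.

Lemma mder_cst m n (A : 'M[C]_(m, n)) t : mder (fun=> A) 0 t.
Proof.
exists (fun=> 0) => [|t' _]; last by rewrite subrr scaler0.
by split => // i j; exact: cont_cst.
Qed.

Lemma mderD m n (A B : R -> 'M[C]_(m, n)) A' B' t :
  mder A A' t -> mder B B' t -> mder (fun t => A t + B t) (A' + B') t.
Proof.
move=> [P [cP <-] hP] [Q [cQ <-] hQ]; exists (fun t => P t + Q t).
  split => // i j eps /(contD (cP i j) (cQ i j)) [d d0 h].
  by exists d => // t' It' l; rewrite !mxE; exact: h.
by move=> t' It'; rewrite scalerDr -hP // -hQ // opprD addrACA.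
Qed.

Lemma mderZ m n (c : C) (A : R -> 'M[C]_(m, n)) A' t :
  mder A A' t -> mder (fun t => c *: A t) (c *: A') t.
Proof.
move=> [P [cP <-] hP]; exists (fun t => c *: P t).
  split => // i j eps /(contM (@cont_cst c t) (cP i j)) [d d0 h].
  by exists d => // t' It' l; rewrite !mxE; exact: h.
by move=> t' It'; rewrite -scalerBr hP // !scalerA mulrC.
Qed.

Lemma mder_mul m n p (A : R -> 'M[C]_(m, n)) (B : R -> 'M[C]_(n, p)) A' B' t : I t ->
  mder A A' t -> mder B B' t -> mder (fun t => A t *m B t) (A' *m B t + A t *m B') t.
Proof.
move=> It dA dB; have cB := mder_cont It dB.
move: dA dB => [P [cP <-] hP] [Q [cQ <-] hQ].
exists (fun t' => P t' *m B t' + A t *m Q t').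
  split => // i j.
  have c1 := mcont_mul It cP cB i j.
  have c2 := mcont_mul It (fun i j => @cont_cst (A t i j) t) cQ i j.
  move=> eps /(contD c1 c2) [d d0 h].
  by exists d => // t' It' l; rewrite [X in normc (X - _)]mxE [X in normc (_ - X)]mxE; exact: h.
move=> t' It'; rewrite scalerDr (scalemxAl _ (P t')) (scalemxAr _ (A t)) -hP // -hQ //.
by rewrite mulmxBl mulmxBr addrA subrK.
Qed.

Lemma mder_ext m n (A B : R -> 'M[C]_(m, n)) A' t : (forall t, A t = B t) -> mder A A' t -> mder B A' t.
Proof. by move=> AB [P hP h]; exists P => // t' It'; rewrite -!AB h. Qed.

Lemma mder_row m n (A : R -> 'M[C]_(m, n)) (A' : 'M[C]_(m, n)) t :
  (forall i j, exists2 P : R -> C, cont P t /\ P t = A' i j &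
    forall t', I t' -> A t' i j - A t i j = (t' - t)%:C * P t') -> mder A A' t.
Proof.
move=> h.
have [P hP] : exists P : 'I_m -> 'I_n -> R -> C, forall i j, (cont (P i j) t /\ P i j t = A' i j) /\
    forall t', I t' -> A t' i j - A t i j = (t' - t)%:C * P i j t'.
  pose Q (ij : 'I_m * 'I_n) (P : R -> C) := (cont P t /\ P t = A' ij.1 ij.2) /\
    forall t', I t' -> A t' ij.1 ij.2 - A t ij.1 ij.2 = (t' - t)%:C * P t'.
  have [P hP] : exists P : 'I_m * 'I_n -> R -> C, forall ij, Q ij (P ij).
    have : forall ij, exists P, Q ij P by move=> [i j]; have [P h1 h2] := h i j; exists P.
    move=> {}h.
    suff : forall s : seq ('I_m * 'I_n), exists P : 'I_m * 'I_n -> R -> C, forall ij, ij \in s -> Q ij (P ij).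
      move=> /(_ (enum {: 'I_m * 'I_n})) [P hP]; exists P => ij; apply: hP.
      by rewrite mem_enum.
    elim=> [|ij s [P hP]]; first by exists (fun _ _ => 0).
    have [p hp] := h ij; exists (fun kl => if kl == ij then p else P kl) => kl.
    by rewrite inE; case: eqP => [->|_] //=; exact: hP.
  by exists (fun i j => P (i, j)) => i j; exact: (hP (i, j)).
exists (fun t => \matrix_(i, j) P i j t).
  split; last by apply/matrixP => i j; rewrite mxE; have [[_ ->]] := hP i j.
  move=> i j eps; have [[c _] _] := hP i j => /c [d d0 g].
  by exists d => // t' It' l; rewrite !mxE; exact: g.
by move=> t' It'; apply/matrixP => i j; rewrite !mxE; have [_ ->] := hP i j.
Qed.

End Calculus.

(** * Words of resolvents *)

Section Static.
Variables (R : rcfType) (K : nat) (q : int -> R[i]).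
Variables (w : nat -> R) (B C1 : R) (r : nat).
Local Notation C := R[i].
Hypothesis qherm : forall k, q (- k) = conjc (q k).
Hypothesis w_ge1 : forall n, 1 <= w n.
Hypothesis w_le : forall n, w n <= n.+1%:R.
Hypothesis w_sub : forall i j : int, w (absz (i + j)) <= w `|i|%N * w `|j|%N.
Hypothesis qB : l2bound (fun k : int => w `|k|%N * normc (q k)) B.
Hypothesis wC1 : l2bound (fun n : nat => w n / n.+1%:R) C1.
Hypothesis r_gt0 : (0 < r)%N.
Hypothesis r_large : 32 * B ^+ 2 <= r%:R.
Implicit Types (f g h x y : 'cV[C]_K) (cs : seq R) (b c X : R).

Local Notation M := (matM K q).
Local Notation J := (res M).
Let Mh : adj M = M := matM_herm K qherm.

Lemma run_add cs f g : run q cs (f + g) = run q cs f + run q cs g.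
Proof. by elim: cs f g => //= c cs IH f g; rewrite mulmxDr IH. Qed.

Lemma run_scale cs (a : C) f : run q cs (a *: f) = a *: run q cs f.
Proof. by elim: cs f => //= c cs IH f; rewrite -scalemxAr IH. Qed.

Lemma run_opp cs f : run q cs (- f) = - run q cs f.
Proof. by rewrite -scaleN1r run_scale scaleN1r. Qed.

Lemma res_res c d f : J c *m (J d *m f) = J d *m (J c *m f).
Proof.
rewrite -[RHS](resKV Mh c); congr (_ *m _).
by rewrite (resX_comm Mh) (resK Mh).
Qed.

Lemma res_run c cs f : J c *m run q cs f = run q cs (J c *m f).
Proof.
elim: cs f => [//|d cs IH f].
have E g : run q (d :: cs) g = run q cs (J d *m g) by [].
by rewrite !E IH res_res.
Qed.

Lemma run_step (cs : seq R) c (beta : C) (rf e f1 : 'cV[C]_K) :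
  run q cs (J c *m (rf + beta *: (M *m f1) + e)) =
  run q cs (J c *m rf) + beta *: (M *m (J c *m run q cs f1)) + run q cs (J c *m e).
Proof.
rewrite !mulmxDr !run_add -scalemxAr run_scale res_run (run_M qherm).
by rewrite (res_commM Mh c f1).
Qed.

(** The sum over all factors J_c of the word with J_c replaced by J_c (ic E) J_c, the perturbation
    of a resolvent caused by a perturbation E of M'. *)
Fixpoint errE (E : 'M[C]_K) cs f : 'cV[C]_K :=
  if cs is c :: cs' then
    run q cs' (J c *m ((c *i) *: (E *m (J c *m f)))) + errE E cs' (J c *m f)
  else 0.

(** An insertion splits the word: the part up to and including J_c acts on f, the adjoint of the
    part from J_c on acts on h. The factor J_c is thus available on both sides. *)
Lemma errE_le (E : 'M[C]_K) cs f h (eps G1 G2 : R) :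
  0 <= eps -> 
  (forall g h, normc (ip (E *m g) h) <= eps * (wnorm (wG w) g * wnorm (wG w) h)) ->
  (forall c, c \in cs -> `|c| <= 1) ->
  (forall cs1 c cs2, cs = cs1 ++ c :: cs2 ->
     wnorm (wG w) (run q (rcons cs1 c) f) <= G1 /\ wnorm (wG w) (runa q (c :: cs2) h) <= G2) ->
  normc (ip (errE E cs f) h) <= (size cs)%:R * (eps * (G1 * G2)).
Proof.
move=> eps0 hE; elim: cs f => [|c cs IH] f c1 hG /=.
  by rewrite ip0l normc0 mul0r.
rewrite ipDl; apply: (le_trans (le_normcD _ _)).
rewrite -natr1 mulrDl mul1r addrC; apply: lerD.
  apply: IH => [d dcs|cs1 d cs2 e]; first by apply: c1; rewrite inE dcs orbT.
  have [|h1 h2] := hG (c :: cs1) d cs2; first by rewrite e.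
  by split.
have [h1 h2] := hG [::] c cs (erefl _).
rewrite -[run q cs _]/(run q (c :: cs) _) (ip_run qherm) ipZl normcM cm_im.
apply: (@le_trans _ _ (1 * (eps * (G1 * G2)))); last by rewrite mul1r.
apply: ler_pM; rewrite ?cm_ge0 //; first by apply: c1; rewrite mem_head.
apply: (le_trans (hE _ _)); rewrite ler_wpM2l //.
by apply: ler_pM; rewrite ?wnorm_ge0.
Qed.

Definition Gam b : R := CG B C1 r * ((Cd R r / b + 1) / b).

(** After one factor J_b the gain comes from [res_gain], which is where the weighted norm of f is
    used; from two factors on it comes from [run_gain], whatever follows. *)
Lemma Gam_prefix b ds f X ds1 d ds2 : 0 < `|b| <= 1 -> wnorm w f <= X ->
  b :: b :: ds = ds1 ++ d :: ds2 -> wnorm (wG w) (run q (rcons ds1 d) f) <= Gam `|b| * X.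
Proof.
move=> hb fX; case: ds1 => [|x ds1] /=.
  by move=> [<- _]; rewrite /Gam -mulrA; exact: (res_gain qherm w_ge1 w_le w_sub qB wC1 r_gt0 r_large).
have nX : nrm f <= X by exact: le_trans (nrm_le_w w_ge1 f) fX.
have X0 : 0 <= X := le_trans (nrm_ge0 f) nX.
move: (hb) => /andP[b0 b1].
have gen cs : wnorm (wG w) (run q cs (J b *m (J b *m f))) <= Gam `|b| * X.
  apply: (le_trans (run_gain qherm w_ge1 w_le w_sub qB wC1 r_gt0 r_large cs hb nX)).
  rewrite /Gam -mulrA ler_wpM2l //.
    exact: le_trans ler01 (CG_ge1 r qB wC1).
  have -> : Cd R r * (X / `|b| ^+ 2) = Cd R r / `|b| / `|b| * X by rewrite expr2 invfM; ring.
  by rewrite ler_wpM2r // ler_wpM2r ?invr_ge0 ?(ltW b0) // lerDl.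
case: ds1 => [|y ds1] /=; first by move=> [<- <- _]; exact: (gen [::]).
by move=> [<- <- _]; exact: gen.
Qed.

Lemma Gam_run b ds f X : 0 < `|b| <= 1 -> wnorm w f <= X ->
  wnorm (wG w) (run q (b :: b :: ds) f) <= Gam `|b| * X.
Proof.
move=> hb fX; case/lastP: ds => [|s d].
  exact: (Gam_prefix (ds := [::]) (ds1 := [:: b]) (d := b) (ds2 := [::]) hb fX (erefl _)).
apply: (Gam_prefix (ds := rcons s d) (ds1 := b :: b :: s) (d := d) (ds2 := [::]) hb fX).
by rewrite /= cats1.
Qed.

Lemma Gam_ge1 b : 0 < b <= 1 -> 1 <= Gam b.
Proof.
move=> /andP[b0 b1]; rewrite -[leLHS]mulr1; apply: ler_pM => //.
  exact: CG_ge1 r qB wC1.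
have ib : 1 <= b^-1 by rewrite invf_ge1.
rewrite -[leLHS]mulr1; apply: ler_pM => //.
by rewrite lerDr divr_ge0 ?(ltW b0) // (le_trans ler01) // Cd_ge1.
Qed.

Section Letter.
Variables (m : nat) (a b : R).
Hypothesis hb : 0 < b <= 1.
Hypothesis ha : `|a| <= 1.
(* J_a^m stands for e^{imaM}, and the four factors J_b gain derivatives. *)
Definition lcs : seq R := b :: b :: (nseq m a ++ [:: b; b]).

Let b_gt0 : 0 < b. Proof. by case/andP: hb. Qed.
Let hbn : 0 < `|b| <= 1. Proof. by rewrite gtr0_norm. Qed.
Let hbn' : 0 < `|- b| <= 1. Proof. by rewrite normrN. Qed.
Let bn : `|b| = b. Proof. exact: gtr0_norm. Qed.

Lemma rev_lcs : rev lcs = lcs.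
Proof. by rewrite /lcs !rev_cons rev_cat rev_nseq -!cats1 -!catA. Qed.

Lemma lcs_le1 c : c \in lcs -> `|c| <= 1.
Proof.
rewrite !inE mem_cat !inE; have b1 : `|b| <= 1 by case/andP: hbn.
by case/or3P=> [/eqP->|/eqP->|/orP[/nseqP[-> _]|/orP[/eqP->|/eqP->]]].
Qed.

(** Wherever the word is cut, the first part starts with J_b and, the word being a palindrome, the
    adjoint of the second starts with J_{-b}. *)
Lemma lcs_split f h cs1 c cs2 : lcs = cs1 ++ c :: cs2 ->
  wnorm (wG w) (run q (rcons cs1 c) f) <= Gam b * wnorm w f /\
  wnorm (wG w) (runa q (c :: cs2) h) <= Gam b * wnorm w h.
Proof.
move=> e; split; first by rewrite -{1}bn; exact: (Gam_prefix hbn (lexx _) e).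
rewrite (runaE q) map_cons rev_cons -bn -(normrN b).
have e' : map -%R (rev lcs) = map -%R (rev cs2) ++ (- c) :: map -%R (rev cs1).
  by rewrite e rev_cat rev_cons cat_rcons map_cat.
rewrite rev_lcs /lcs /= in e'; rewrite -map_rev.
exact: (Gam_prefix hbn' (lexx _) e').
Qed.

Lemma lcs_runa h : wnorm (wG w) (runa q lcs h) <= Gam b * wnorm w h.
Proof. by have [_] := @lcs_split h h [::] b (behead lcs) (erefl _). Qed.

Lemma lcs_run f : wnorm (wG w) (run q lcs f) <= Gam b * wnorm w f.
Proof. by rewrite -{1}bn; exact: Gam_run. Qed.

(** Each of the first two J_b absorbs one M at the price 1/b; all other factors contract. *)
Lemma lcs_M2 f : nrm (M *m (M *m (J a *m run q lcs f))) <= nrm f / b ^+ 2.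
Proof.
have E : run q lcs f = run q (nseq m a ++ [:: b; b]) (J b *m (J b *m f)) by [].
rewrite E; move: (nseq m a ++ _) => cs.
rewrite (res_commM Mh a) (res_commM Mh a).
apply: (le_trans (nrm_res Mh _ _)); rewrite (run_M qherm) (run_M qherm).
apply: (le_trans (nrm_run qherm _ _)).
have hM g : b * nrm (M *m (J b *m g)) <= nrm g.
  by have := nrmM_res Mh b g; rewrite bn.
rewrite (res_commM Mh b (J b *m f)).
rewrite ler_pdivlMr ?exprn_gt0 ?b_gt0 // mulrC expr2 -mulrA.
by apply: (le_trans _ (hM f)); rewrite ler_pM2l ?b_gt0.
Qed.

End Letter.
End Static.

(** * Time derivatives of words *)

Section Inverse.
Variables (R : rcfType) (I : R -> Prop) (K : nat).
Local Notation C := R[i].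

(** Based on X(s)^{-1} - X(t)^{-1} = - X(s)^{-1} (X(s) - X(t)) X(t)^{-1}. The entrywise bound first
    yields continuity of the inverse, which the quotient then requires. *)
Lemma mder_inv (X : R -> 'M[C]_K) X' t : I t -> mder I X X' t ->
  (forall s, I s -> X s \in unitmx) ->
  (forall s i j, I s -> normc (invmx (X s) i j) <= 1) ->
  mder I (fun s => invmx (X s)) (- (invmx (X t) *m X' *m invmx (X t))) t.
Proof.
move=> It [P [cP <-] hP] uX bX.
pose Jt := invmx (X t); pose D s := P s *m Jt.
have diff s : I s -> invmx (X s) - invmx (X t) = - (s - t)%:C *: (invmx (X s) *m D s).
  move=> Is; rewrite scaleNr scalemxAr /D scalemxAl -hP // mulmxBl mulmxV ?uX //.
  by rewrite mulmxBr mulmx1 mulmxA mulVmx ?uX // mul1mx opprB.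
have cD : mcont I D t by apply: mcont_mul => // i j; exact: cont_cst.
have cJ : mcont I (fun s => invmx (X s)) t.
  move=> i j; apply: (@cont_squeeze _ _ _ 'I_K (index_enum 'I_K) (fun k s => (s%:C - t%:C) * D s k j)).
    move=> k; apply: contM (cD k j); exact: contD (@cont_id _ _ t) (@cont_cst _ _ _ t).
  move=> s Is; have /(congr1 (fun A : 'M[C]_K => A i j)) := diff s Is.
  rewrite !mxE => ->; rewrite mulr_sumr; apply: (le_trans (cm_sum _ _)).
  apply: ler_sum => k _; rewrite subrr mul0r subr0 -rmorphB mulrCA !normcM normcN.
  by rewrite -[leRHS]mul1r ler_wpM2r ?mulr_ge0 ?cm_ge0 // bX.
exists (fun s => - (invmx (X s) *m D s)); last first.
  by move=> s Is; rewrite scalerN -scaleNr; exact: diff.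
split; last by rewrite /D mulmxA.
move=> i j eps e0; have [d d0 h] := mcont_mul It cJ cD i j e0.
exists d => // s Is l; rewrite [X in normc (X - _)]mxE [X in normc (_ - X)]mxE -opprD normcN.
exact: h.
Qed.

End Inverse.

(** * The backward shift and its adjoint *)

Section Shift.
Variables (R : rcfType) (K' : nat).
Local Notation K := K'.+1.
Local Notation C := R[i].
Implicit Types (x h : 'cV[C]_K).

Definition ext x (n : nat) : C := if (n < K)%N then x (inord n) 0 else 0.

Lemma extE x (i : 'I_K) : ext x i = x i 0.
Proof. by rewrite /ext ltn_ord inord_val. Qed.

Lemma matS_mul x (i : 'I_K) : (matS R K *m x) i 0 = ext x i.+1.
Proof.
rewrite mxE /ext; case: ltnP => hi.
  rewrite (bigD1 (inord i.+1)) //= big1 ?addr0 => [|k kn].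
    by rewrite mxE inordK // eqxx mul1r.
  rewrite mxE (_ : (k : nat) == i.+1 = false) ?mul0r //.
  by apply: contraNF kn => /eqP e; apply/eqP/val_inj; rewrite /= inordK.
rewrite big1 // => k _; rewrite mxE (_ : (k : nat) == i.+1 = false) ?mul0r //.
by have := ltn_ord k; lia.
Qed.

Lemma adjS_mul x (i : 'I_K) : (adj (matS R K) *m x) i 0 = if (i : nat) is j.+1 then ext x j else 0.
Proof.
rewrite mxE; case E: (i : nat) => [|j].
  by rewrite big1 // => k _; rewrite !mxE E conjc0 mul0r.
have jK : (j < K)%N by have := ltn_ord i; lia.
rewrite (bigD1 (inord j)) //= big1 ?addr0 => [|k kn].
  by rewrite !mxE E inordK // eqxx conjc1 mul1r /ext jK.
rewrite !mxE E eqSS (_ : j == k = false) ?conjc0 ?mul0r //.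
by apply: contraNF kn => /eqP e; apply/eqP/val_inj; rewrite /= inordK.
Qed.

Lemma wnorm_shift v x : (forall n, 0 <= v n <= v n.+1) -> wnorm v (matS R K *m x) <= wnorm v x.
Proof.
move=> hv; rewrite l2_le ?wnorm_ge0 // l2_sqr.
under eq_bigr => i _ do rewrite matS_mul.
under [leRHS]eq_bigr => i _ do rewrite -extE.
rewrite big_ord_recr /= [leRHS]big_ord_recl /= addrC.
apply: lerD; first by rewrite /ext ltnn normc0 mulr0 expr0n sqr_ge0.
apply: ler_sum => i _; have /andP[v0 v1] := hv i.
rewrite lerXn2r ?nnegrE ?mulr_ge0 ?cm_ge0 //; first exact: le_trans v0 v1.
by rewrite /bump /= add1n ler_wpM2r ?cm_ge0.
Qed.

Lemma wnorm_adj_shift v c x : 0 <= c -> (forall n, 0 <= v n) -> (forall n, v n.+1 <= c * v n) ->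
  wnorm v (adj (matS R K) *m x) <= c * wnorm v x.
Proof.
move=> c0 v0 hv; rewrite l2_le ?mulr_ge0 ?wnorm_ge0 // exprMn l2_sqr mulr_sumr.
under eq_bigr => i _ do rewrite adjS_mul.
under [leRHS]eq_bigr => i _ do rewrite -extE -exprMn.
rewrite big_ord_recl; set z := (X in X + _ <= _).
rewrite (_ : z = (v 0%N * normc (0 : C)) ^+ 2) // {z}.
rewrite normc0 mulr0 expr0n add0r [leRHS]big_ord_recr /=.
rewrite -[leLHS]addr0; apply: lerD (sqr_ge0 _).
apply: ler_sum => i _; rewrite /bump /= add1n.
by rewrite lerXn2r ?nnegrE ?mulr_ge0 ?cm_ge0 // mulrA ler_wpM2r ?cm_ge0.
Qed.

End Shift.

Lemma regroup (V : zmodType) (a b c d e : V) : a + b + c + d + e = a + (b + d) + (c + e).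
Proof. by rewrite -!addrA; congr (_ + (_ + _)); rewrite addrCA. Qed.

Lemma regroup2 (V : zmodType) (a b c d e : V) : a - b + c + d + e = a + c + e + (- b + d).
Proof. by rewrite (addrAC a) -(addrA (a + c)) addrAC. Qed.

Lemma prod_regroup (R : rcfType) (a e g x y : R) :
  a * (e * (g ^+ 2 * x)) * y = a * (e * ((g * x) * (g * y))).
Proof. ring. Qed.

Lemma size_lcs (R : rcfType) m (a b : R) : size (lcs m a b) = (m + 4)%N.
Proof. by rewrite /lcs /= size_cat size_nseq /=; lia. Qed.

(** The first basis vector lies in the kernel of A, on which [initv_resid] rests. *)
Lemma kernA_col0 (R : rcfType) (q : int -> R[i]) n : kernA q n 0 = 0.
Proof.
rewrite /kernA /kernA0 !(mulr0, addr0).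
by case: n => [|n]; rewrite /= ?mul0r // expr0n !mulr0.
Qed.

Lemma kernA_row0 (R : rcfType) (q : int -> R[i]) m : kernA q 0 m = 0.
Proof.
rewrite /kernA /kernA0 expr0n /= !(mulr0, mul0r, add0r).
by case: m => [|m]; rewrite ?mulr0 // (_ : qp q _ = 0) // mul0r mulr0.
Qed.

Section Dynamic.
Variables (R : rcfType) (I : R -> Prop) (K' N : nat) (w tau : nat -> R).
Variables (B C1 Ct eta : R) (r : nat).
Variables (u qd e : R -> int -> R[i]).
Local Notation K := K'.+1.
Local Notation C := R[i].
Hypothesis w_ge1 : forall n, 1 <= w n.
Hypothesis w_le : forall n, w n <= n.+1%:R.
Hypothesis w_mono : forall n, w n <= w n.+1.
Hypothesis w_sub : forall i j : int, w (absz (i + j)) <= w `|i|%N * w `|j|%N.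
Hypothesis wC1 : l2bound (fun n : nat => w n / n.+1%:R) C1.
Hypothesis tau_ge0 : forall n, 0 <= tau n.
Hypothesis tauC : l2bound (fun k : int => tau `|k|%N) Ct.
Hypothesis r_gt0 : (0 < r)%N.
Hypothesis r_large : 32 * B ^+ 2 <= r%:R.
Hypothesis eta_ge0 : 0 <= eta.
Hypothesis eta_bound : forall j k : int, outside N j k ->
  1 <= eta * (tau `|j|%N + tau (absz (k - j)%R) + tau `|k|%N) * (w `|j|%N * w (absz (k - j)%R) * w `|k|%N).
Definition trunc (t : R) (k : int) : C := if (`|k| <= N)%N then u t k else 0.
Hypothesis uB : forall t, I t -> l2bound (fun k : int => w `|k|%N * normc (u t k)) B.
Hypothesis uherm : forall t, I t -> forall k, u t (- k) = conjc (u t k).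
Hypothesis e_tail : forall t, I t -> forall (d : R) (ks : seq int), 0 < d ->
  exists2 s : seq int, uniq s &
  forall k, k \in ks -> normc (e t k) <=
    \sum_(j <- s | outside N j k) normc (u t j) * normc (u t (k - j)) + d.
Hypothesis qdE : forall t, I t -> forall k, qd t k = BO (trunc t) N k + 'i * k%:~R * e t k.
Hypothesis qder : forall t, I t -> forall k, exists2 P : R -> C, cont I P t /\ P t = qd t k &
  forall t', I t' -> trunc t' k - trunc t k = (t' - t)%:C * P t'.
Hypothesis NK : (2 * N < K)%N.

Local Notation M t := (matM K (trunc t)).
Local Notation J t := (res (M t)).
Local Notation A t := (matA K (trunc t)).
Local Notation L t := (laxerr K (trunc t) (qd t)).
Local Notation S := (matS R K).
Local Notation eps := (lax_eps K N B C1 Ct eta).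

Lemma trunc_herm t : I t -> forall k, trunc t (- k) = conjc (trunc t k).
Proof.
by move=> It k; rewrite /trunc abszN; case: ifP => _; rewrite ?conjc0 // uherm.
Qed.

Lemma trunc_l2 t : I t -> l2bound (fun k : int => w `|k|%N * normc (trunc t k)) B.
Proof. by move=> It; apply: (@q_l2 R N w B (u t)) => //; exact: uB. Qed.

Lemma lax_small t g h : I t -> normc (ip (L t *m g) h) <= eps * (wnorm (wG w) g * wnorm (wG w) h).
Proof.
move=> It; apply: (laxerr_ip w_ge1 w_sub wC1 tau_ge0 tauC (uB It) eta_ge0 eta_bound (e_tail It)) => //.
- exact: qdE.
- lia.
Qed.

Lemma M_herm t : I t -> adj (M t) = M t.
Proof. by move=> It; apply: matM_herm; exact: trunc_herm. Qed.

Lemma M_der t : I t -> mder I (fun s => M s) (matMd K (qd t)) t.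
Proof.
move=> It; apply: mder_row => i j.
have [P [cP Pt] hP] := qder It ((i : nat)%:Z - (j : nat)%:Z).
exists (fun s => - 2 * P s); first split.
- exact: contM (@cont_cst _ _ _ t) cP.
- by rewrite Pt mxE.
- move=> s Is; rewrite !mxE; set a := trunc s _; set b := trunc t _.
  transitivity (- 2 * (a - b)); first by ring.
  by rewrite hP //; ring.
Qed.

Lemma res_entry t c i j : I t -> normc (J t c i j) <= 1.
Proof.
move=> It; pose d : 'cV[C]_K := \col_k (k == j)%:R.
have -> : J t c i j = (J t c *m d) i 0.
  rewrite mxE (bigD1 j) //= mxE eqxx mulr1 big1 ?addr0 // => k /negbTE kj.
  by rewrite mxE kj mulr0.
apply: (le_trans (cm_le_nrm _ _)); apply: (le_trans (nrm_res (M_herm It) _ _)).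
rewrite l2_le // expr1n (bigD1 j) //= mxE eqxx normc1 mulr1 expr1n big1 ?addr0 // => k /negbTE kj.
by rewrite mxE kj normc0 mulr0 expr0n.
Qed.

(** Differentiate (1 - icM) g = f with c' = beta, insert M' = [A, M] + L, and use (1 - icM) A g = A
    f + ic [A, M] g. *)
Lemma res_der t (c : R -> R) (beta : R) (f : R -> 'cV[C]_K) f' : I t ->
  (forall s, c s - c t = (s - t) * beta) -> mder I f f' t ->
  let g := J t (c t) *m f t in
  exists2 g', mder I (fun s => J s (c s) *m f s) g' t &
    g' - A t *m g = J t (c t) *m
      ((f' - A t *m f t) + (beta *i) *: (M t *m g) + ((c t) *i) *: (L t *m g)).
Proof.
move=> It hc df g.
pose X s := resX (M s) (c s).
have dX : mder I X (- ((beta *i) *: M t + ((c t) *i) *: matMd K (qd t))) t.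
  have dc : mder I (fun s => ((c s) *i)%:M : 'M[C]_K) ((beta *i)%:M) t.
    exists (fun=> (beta *i)%:M); first by split => // i j; exact: cont_cst.
    move=> s Is; rewrite -raddfB scale_scalar_mx; congr (_%:M).
    by simpc; rewrite hc.
  have d1 := mderD (mder_cst I (1%:M : 'M[C]_K) t) (mderZ (-1) (mder_mul It dc (M_der It))).
  move: d1; rewrite add0r scaleN1r !mul_scalar_mx; apply: mder_ext => s.
  by rewrite /X /resX scaleN1r mul_scalar_mx.
have dJ := mder_inv It dX (fun s Is => resX_unit (M_herm Is) (c s)) (fun s i j Is => res_entry (c s) i j Is).
exists (- (invmx (X t) *m - ((beta *i) *: M t + ((c t) *i) *: matMd K (qd t)) *m invmx (X t)) *m f t
   + invmx (X t) *m f'); first exact: mder_mul It dJ df.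
rewrite -resE mulmxN !mulNmx opprK -!mulmxA -/g.
rewrite -[A t *m g](resKV (M_herm It) (c t)) -mulmxDr -mulmxBr; congr (_ *m _).
have fE : f t = g - ((c t) *i) *: (M t *m g) by rewrite -resX_mul (resK (M_herm It)).
rewrite [in A t *m f t]fE resX_mul mulmxDl -!scalemxAl mulmxBr -scalemxAr.
rewrite /laxerr !mulmxBl -!mulmxA !scalerBr.
move: ((c t) *i) (beta *i) (M t *m g) (matMd K (qd t) *m g) (A t *m g) => c1 b1 m1 m2 a1.
move: (c1 *: (M t *m a1)) (c1 *: (A t *m m1)) => y1 y2.
apply/matrixP => i j; rewrite !mxE; ring.
Qed.

Definition vals (cs : seq ((R -> R) * R)) (s : R) : seq R := [seq p.1 s | p <- cs].

(** Residuals add up along the word. As the resolvents of one M commute, the variation of each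
    parameter contributes M J_c applied to the whole word g. *)
Lemma run_der t (cs : seq ((R -> R) * R)) (f : R -> 'cV[C]_K) f' : I t ->
  (forall p, List.In p cs -> forall s, p.1 s - p.1 t = (s - t) * p.2) -> mder I f f' t ->
  let g := run (trunc t) (vals cs t) (f t) in
  exists2 g', mder I (fun s => run (trunc s) (vals cs s) (f s)) g' t &
    g' - A t *m g = run (trunc t) (vals cs t) (f' - A t *m f t)
      + \sum_(p <- cs) (p.2 *i) *: (M t *m (J t (p.1 t) *m g))
      + errE (trunc t) (L t) (vals cs t) (f t).
Proof.
move=> It; have qh := trunc_herm It.
elim: cs f f' => [|p cs IH] f f' hcs df /=.
  by exists f' => //; rewrite big_nil !addr0.
have [f1' df1 e1] := res_der It (hcs p (or_introl (erefl p))) df.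
have [g' dg e2] := IH _ _ (fun p' hp' => hcs p' (or_intror hp')) df1.
exists g' => //; rewrite e2 e1 (run_step qh) big_cons; exact: regroup.
Qed.

(* The dual norm: residuals are estimated by duality against the weight n^{1+s}. *)
Definition resid_le (x : 'cV[C]_K) (kappa : R) : Prop :=
  forall h, normc (ip x h) <= kappa * wnorm (wG w) h.

Local Notation Gm b := (Gam B C1 r b).

Let w0 := w_ge0 w_ge1.

Lemma wG_shift n : wG w n.+1 <= 4 * wG w n.
Proof.
rewrite /wG (_ : 4 * (n.+1%:R * w n) = (2 * n.+1%:R) * (2 * w n)); last by ring.
apply: ler_pM => //; first by rewrite -natrM ler_nat; lia.
have h := w_sub n%:Z 1; have h1 : w 1 <= 2 := w_le 1.
rewrite -PoszD !absz_nat addn1 in h; apply: (le_trans h).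
by rewrite mulrC ler_wpM2r.
Qed.

(** The four terms of the bound are the residual of x, moved to the test vector through the adjoints
    of the word and of S (the latter costs 4); the shift error; the m + 4 insertions of the Lax
    error; and the mismatch between J_a^m and the exponential. Only the w norm of x enters, so that
    letters can be iterated. *)
Lemma letter_der t t0 m b (x : R -> 'cV[C]_K) x' (kappa sigma X theta : R) :
  I t -> (0 < m)%N -> 0 < b <= 1 -> `|(t - t0) / m%:R| <= theta -> theta <= 1 ->
  0 <= kappa ->
  mder I x x' t -> resid_le (x' - A t *m x t) kappa ->
  resid_le (shifterr K (trunc t) *m x t) sigma -> 0 <= sigma ->
  wnorm w (x t) <= X ->
  exists2 z', mder I (fun s => run (trunc s) (lcs m ((s - t0) / m%:R) b) (S *m x s)) z' t &
    resid_le (z' - A t *m run (trunc t) (lcs m ((t - t0) / m%:R) b) (S *m x t))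
     (4 * Gm b * kappa + sigma * Gm b + (m + 4)%:R * (eps * (Gm b ^+ 2 * X)) + theta * (X / b ^+ 2)).
Proof.
move=> It m0 hb ha theta1 kap0 dx rx rs sig0 xX.
pose a s := (s - t0) / m%:R.
pose pb : (R -> R) * R := (fun=> b, 0).
(* Each factor J_a has slope 1/m in time and there are m of them: total slope 1, as for the
   exponential. The J_b are constant. *)
pose cs := [:: pb; pb] ++ nseq m (a, m%:R^-1) ++ [:: pb; pb].
have csE s : vals cs s = lcs m (a s) b by rewrite /vals /cs /lcs map_cat map_cat map_nseq.
have mr : (m%:R : R) != 0 by rewrite pnatr_eq0 -lt0n.
have hcs p : List.In p cs -> forall s, p.1 s - p.1 t = (s - t) * p.2.
  have hpb s : pb.1 s - pb.1 t = (s - t) * pb.2 by rewrite /= subrr mulr0.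
  have hapb s : (a s - a t) = (s - t) * m%:R^-1.
    by rewrite /a -mulrBl opprB addrA subrK.
  have hin k : List.In p (nseq k (a, m%:R^-1) ++ [:: pb; pb]) -> forall s, p.1 s - p.1 t = (s - t) * p.2.
    by elim: k => [|k IH] /=; [move=> [<-|[<-|]] | move=> [<-|]].
  by move=> /= [<-|[<-|/hin]].
have dy := mder_mul It (mder_cst I S t) dx; rewrite mul0mx add0r in dy.
have [z' dz ez] := run_der It hcs dy.
exists z'.
  by apply: mder_ext dz => s; rewrite csE.
rewrite csE in ez; rewrite -/(a t) {}ez.
set cs1 := lcs m (a t) b; set y := S *m x t; set g := run _ cs1 y.
set rx0 := x' - A t *m x t in rx.
have qh := trunc_herm It; have Mh := M_herm It; have qB := trunc_l2 It.
have G1 := Gam_ge1 r qB wC1 hb.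
have a1 : `|a t| <= 1 := le_trans ha theta1.
have eps0 : 0 <= eps := lax_eps_ge0 K N wC1 tauC (uB It) eta_ge0.
have X0 : 0 <= X := le_trans (wnorm_ge0 _ _) xX.
have G0 : 0 <= Gm b := le_trans ler01 G1.
have ry : S *m x' - A t *m y = S *m rx0 - 'i *: (M t *m y) + shifterr K (trunc t) *m x t.
  rewrite /shifterr /rx0 /y mulmxDl mulmxBl mulmxBr -scalemxAl -!mulmxA.
  move: (S *m x') (A t *m (S *m x t)) (S *m (A t *m x t)) ('i *: _) => p1 p2 p3 p4.
  by apply/matrixP => i j; rewrite !mxE; ring.
have sumE : \sum_(p <- cs) (p.2 *i) *: (M t *m (J t (p.1 t) *m g))
   = 'i *: (M t *m (J t (a t) *m g)).
  have z0 v : (0 *i : C) *: (v : 'cV[C]_K) = 0 by rewrite (_ : 0 *i = 0 :> C) ?scale0r.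
  rewrite big_cat /= !big_cons big_nil /= !z0 !add0r.
  rewrite big_cat /= !big_cons big_nil /= !z0 !addr0.
  rewrite big_nseq iter_addr addr0 scalerMnl /=.
  congr (_ *: _); rewrite -mulr_natl (_ : m%:R = (m%:R : R)%:C); last by rewrite rmorph_nat.
  by apply/eqP; rewrite eq_complex /= !mul0r mulr0 subr0 addr0 mulfV ?eqxx.
(* [A, S] = iMS contributes -iM g, the m slopes contribute iM J_a g. For the exponential these would
   cancel; here J_a - 1 = ia M J_a leaves -a M^2 J_a g, which [lcs_M2] bounds. *)
have main : - ('i *: (M t *m g)) + 'i *: (M t *m (J t (a t) *m g))
   = - (a t)%:C *: (M t *m (M t *m (J t (a t) *m g))).
  rewrite {1}(res_id Mh (a t) g) mulmxDr scalerDr addrA addNr add0r -scalemxAr scalerA.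
  by congr (_ *: _); apply/eqP; rewrite eq_complex /= !mul0r !mul1r sub0r add0r oppr0 !eqxx.
rewrite ry run_add run_add run_opp run_scale sumE.
have E2 : run (trunc t) cs1 (M t *m y) = M t *m g by rewrite -(run_M qh).
rewrite E2.
set e1 := run _ _ (S *m rx0); set e2 := run _ _ (shifterr _ _ *m _); set e3 := errE _ _ _ _.
have -> : e1 - 'i *: (M t *m g) + e2 + 'i *: (M t *m (J t (a t) *m g)) + e3
  = e1 + e2 + e3 + (- ('i *: (M t *m g)) + 'i *: (M t *m (J t (a t) *m g))).
  exact: regroup2.
rewrite {}main => h; rewrite (ipDl (e1 + e2 + e3)) (ipDl (e1 + e2)) (ipDl e1).
have hwG : wnorm w h <= wnorm (wG w) h := w_le_wG w_ge1 h.
have yX : wnorm w y <= X.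
  by apply: (le_trans (wnorm_shift _ _)) => // n; rewrite w0 w_mono.
have runaG : wnorm (wG w) (runa (trunc t) cs1 h) <= Gm b * wnorm (wG w) h.
  apply: (le_trans (lcs_runa qh w_ge1 w_le w_sub qB wC1 r_gt0 r_large m (a t) hb h)).
  by rewrite ler_wpM2l.
rewrite [leRHS]mulrDl [X in _ <= X + _]mulrDl [X in _ <= X + _ + _]mulrDl.
apply: (le_trans (le_normcD _ _)); apply: lerD.
  apply: (le_trans (le_normcD _ _)); apply: lerD.
    apply: (le_trans (le_normcD _ _)); apply: lerD.
      rewrite (ip_run qh) ip_adj; apply: (le_trans (rx _)).
      have -> : 4 * Gm b * kappa * wnorm (wG w) h = kappa * (4 * (Gm b * wnorm (wG w) h)) by ring.
      rewrite ler_wpM2l //.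
      apply: (le_trans (wnorm_adj_shift _ _ _ wG_shift)) => //.
        by move=> n; exact: wG_ge0.
      by rewrite ler_wpM2l.
    by rewrite (ip_run qh); apply: (le_trans (rs _)); rewrite -mulrA ler_wpM2l.
  have hE := errE_le qh (cs := cs1) (f := y) (h := h) (G1 := Gm b * wnorm w y)
     (G2 := Gm b * wnorm w h) eps0 (fun g0 h0 => lax_small g0 h0 It) (lcs_le1 hb a1)
     (lcs_split qh w_ge1 w_le w_sub qB wC1 r_gt0 r_large (m := m) (a := a t) hb y h).
  have sz : size cs1 = (m + 4)%N by exact: size_lcs.
  rewrite sz in hE; apply: (le_trans hE); rewrite prod_regroup.
  rewrite ler_wpM2l // ler_wpM2l //.
  exact: ler_pM (mulr_ge0 G0 (wnorm_ge0 _ _)) (mulr_ge0 G0 (wnorm_ge0 _ _))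
    (ler_wpM2l G0 yX) (ler_wpM2l G0 hwG).
rewrite ipZl normcM normcN cm_real -mulrA.
apply: ler_pM; rewrite ?cm_ge0 //; apply: (le_trans (ip_le _ _)).
apply: ler_pM; rewrite ?nrm_ge0 //; last first.
  exact: le_trans (nrm_le_w w_ge1 h) hwG.
apply: (le_trans (lcs_M2 qh m (a t) hb y)); rewrite ler_wpM2r ?invr_ge0 ?sqr_ge0 //.
exact: le_trans (nrm_le_w w_ge1 y) yX.
Qed.

Definition initv (t : R) : 'cV[C]_K := \col_i trunc t (i : nat)%:Z.

Definition letter t0 m b (s : R) (x : 'cV[C]_K) :=
  run (trunc s) (lcs m ((s - t0) / m%:R) b) (S *m x).

Fixpoint word t0 m b n (s : R) : 'cV[C]_K :=
  if n is n'.+1 then letter t0 m b s (word t0 m b n' s) else initv s.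

(** The bound of [letter_der] iterated, with X taken from [word_bound]: every letter multiplies the
    w norm by at most [Gm b]. *)
Fixpoint kap b m theta n : R :=
  if n is n'.+1 then
    4 * Gm b * kap b m theta n' + (eps * (Gm b ^+ n' * B)) * Gm b
    + (m + 4)%:R * (eps * (Gm b ^+ 2 * (Gm b ^+ n' * B))) + theta * (Gm b ^+ n' * B / b ^+ 2)
  else eps.

Section Word.
Variables (t0 b theta : R) (m : nat).
Hypothesis hb : 0 < b <= 1.
Hypothesis m_gt0 : (0 < m)%N.
Hypothesis theta1 : theta <= 1.
Hypothesis htheta : forall t, I t -> `|(t - t0) / m%:R| <= theta.

Let B0 t : I t -> 0 <= B := fun It => l2bound_ge0 (uB It).
Let eps_ge0 t : I t -> 0 <= eps := fun It => lax_eps_ge0 K N wC1 tauC (uB It) eta_ge0.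
Let Gm1 t : I t -> 1 <= Gm b := fun It => Gam_ge1 r (trunc_l2 It) wC1 hb.
Let Gm0 t : I t -> 0 <= Gm b := fun It => le_trans ler01 (Gm1 It).

Lemma kap_ge0 t n : I t -> 0 <= kap b m theta n.
Proof.
move=> It; have th0 := le_trans (normr_ge0 _) (htheta It).
have e0 := eps_ge0 It; have b0 := B0 It; have g0 := Gm0 It.
have bp : 0 <= b ^+ 2 := sqr_ge0 b.
elim: n => [|n IH] //=; have gn : 0 <= Gm b ^+ n by exact: exprn_ge0.
have gB := mulr_ge0 gn b0.
apply: addr_ge0; last exact: mulr_ge0 th0 (divr_ge0 gB bp).
apply: addr_ge0; last exact: mulr_ge0 (ler0n _ _) (mulr_ge0 e0 (mulr_ge0 (exprn_ge0 2 g0) gB)).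
apply: addr_ge0; first exact: mulr_ge0 (mulr_ge0 (ler0n _ _) g0) IH.
exact: mulr_ge0 (mulr_ge0 e0 gB) g0.
Qed.

Lemma letter_G t x X : I t -> wnorm w x <= X -> wnorm (wG w) (letter t0 m b t x) <= Gm b * X.
Proof.
move=> It xX.
apply: (le_trans (lcs_run (trunc_herm It) w_ge1 w_le w_sub (trunc_l2 It) wC1 r_gt0 r_large _ _ hb _)).
rewrite ler_wpM2l ?(Gm0 It) //; apply: (le_trans (wnorm_shift _ _) xX) => k.
by rewrite w0 w_mono.
Qed.

Lemma word_bound t n : I t -> wnorm w (word t0 m b n t) <= Gm b ^+ n * B.
Proof.
move=> It; elim: n => [|n IH] /=.
  rewrite mul1r; apply: le_trans (l2bound_map (h := fun i : 'I_K => (i : nat)%:Z)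
    (s := index_enum 'I_K) (trunc_l2 It) (index_enum_uniq _) _); last first.
    by move=> i j _ _ [] /val_inj.
  by apply: l2_mono => i _; rewrite mxE ger0_norm ?mulr_ge0 ?cm_ge0 ?w0.
apply: (le_trans (w_le_wG w_ge1 _)); rewrite exprS -mulrA; exact: letter_G.
Qed.

Lemma initv_der t : I t -> mder I initv (\col_i qd t (i : nat)%:Z) t.
Proof.
move=> It; apply: mder_row => i j; have [P [cP Pt] hP] := qder It (i : nat)%:Z.
exists P; first by rewrite mxE.
by move=> s Is; rewrite !mxE hP.
Qed.

(** Apply the Lax equation to the first basis vector e0. From A e0 = 0 and M e0 = e0 - 2x one gets
    M' e0 = -2x' and [A, M] e0 = -2Ax, so the residual of x is -(1/2) L e0. *)
Lemma initv_resid t : I t -> resid_le ((\col_i qd t (i : nat)%:Z) - A t *m initv t) eps.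
Proof.
move=> It h; pose e0 : 'cV[C]_K := \col_i ((i : nat) == 0)%:R.
have colE (F : 'M[C]_K) : F *m e0 = \col_i F i ord0.
  apply/matrixP => i j; rewrite !mxE (bigD1 ord0) //= mxE eqxx mulr1 big1 ?addr0 // => k k0.
  by rewrite mxE (_ : (k : nat) == 0 = false) ?mulr0 //; apply: negbTE k0.
have Ae0 : A t *m e0 = 0.
  by rewrite colE; apply/matrixP => i j; rewrite !mxE; exact: kernA_col0.
have Me0 : M t *m e0 = e0 - 2 *: initv t.
  rewrite colE; apply/matrixP => i j; rewrite !mxE subr0.
  by case: eqP => [->|ne] //=; rewrite (_ : (i : nat) == 0 = false) //; apply/eqP => z; apply: ne; apply: val_inj.
have -> : (\col_i qd t (i : nat)%:Z) - A t *m initv t = (- 2^-1) *: (L t *m e0).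
  rewrite /laxerr !mulmxBl -!mulmxA Ae0 mulmx0 subr0 Me0 mulmxBr Ae0 sub0r opprK -scalemxAr.
  rewrite colE; apply/matrixP => i j; rewrite !mxE subr0; set z := \sum_k _.
  by field.
have e0G : wnorm (wG w) e0 <= 1.
  rewrite l2_le // expr1n (bigD1 ord0) //= mxE eqxx normc1 mulr1 big1 ?addr0.
    rewrite expr_le1 ?mulr_ge0 ?w0 // /wG mul1r; exact: w_le.
  by move=> k k0; rewrite mxE (_ : (k : nat) == 0 = false) ?normc0 ?mulr0 ?expr0n //; apply: negbTE k0.
rewrite ipZl normcM normcN normcV (cm_nat R 2) mulrC ler_pdivrMr //.
apply: (le_trans (lax_small _ _ It)); rewrite -mulrA ler_wpM2l ?(eps_ge0 It) //.
rewrite mulrC ler_wpM2l ?wnorm_ge0 //; apply: (le_trans e0G); by rewrite ler1n.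
Qed.

Lemma word_der t n : I t -> exists2 x', mder I (word t0 m b n) x' t &
  resid_le (x' - A t *m word t0 m b n t) (kap b m theta n).
Proof.
move=> It; elim: n => [|n [x' dx rx]].
  by exists (\col_i qd t (i : nat)%:Z); [exact: initv_der | exact: initv_resid].
have gB : 0 <= Gm b ^+ n * B := mulr_ge0 (exprn_ge0 n (Gm0 It)) (B0 It).
apply: (letter_der It m_gt0 hb (htheta It) theta1 (kap_ge0 n It) dx rx) => //.
- have NK' : (2 * N <= K)%N by exact: ltnW.
  (* The initial vector is bounded in w but has gained no derivative; [shifterr_supp] applies since
     it vanishes beyond N. For n > 0 the vector is a letter and lies in [wG]. *)
  case: n {dx rx x'} gB => [|n] gB h.
    have z : ip (shifterr K (trunc t) *m initv t) h = 0.
      apply: (@shifterr_supp R K N w tau B C1 Ct eta (u t) (trunc t) w_ge1 wC1 tauC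
        (uB It) eta_ge0 (fun k => erefl) (ltn0Sn K') NK' (initv t) h NK) => i hi.
      by rewrite mxE /trunc absz_nat leqNgt hi.
    by rewrite z normc0 mulr_ge0 ?wnorm_ge0 // mulr_ge0 ?(eps_ge0 It).
  have h1 := shifterr_small w_ge1 wC1 tauC (uB It) eta_ge0 (fun k => erefl) (ltn0Sn K') NK'.
  apply: (le_trans (h1 _ _)); rewrite -mulrA ler_wpM2l ?(eps_ge0 It) //.
  rewrite ler_wpM2r ?wnorm_ge0 // exprS -mulrA; apply: letter_G => //.
  exact: word_bound.
- exact: mulr_ge0 (eps_ge0 It) gB.
- exact: word_bound.
Qed.

(** Testing the residual against e0, whose [wG] norm is at most 1, removes A because its zeroth row
    is zero. *)
Lemma word_coef_der t n : I t -> exists2 P : R -> C, cont I P t /\ normc (P t) <= kap b m theta n &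
  forall s, I s -> word t0 m b n s ord0 0 - word t0 m b n t ord0 0 = (s - t)%:C * P s.
Proof.
move=> It; have [x' [P [cP Pt] hP] rx] := word_der n It.
exists (fun s => P s ord0 0); last first.
  by move=> s Is; have /(congr1 (fun F : 'cV[C]_K => F ord0 0)) := hP s Is; rewrite !mxE.
split; first exact: cP.
rewrite Pt; pose e0 : 'cV[C]_K := \col_i ((i : nat) == 0)%:R.
have ipe x : ip x e0 = x ord0 0.
  rewrite /ip (bigD1 ord0) //= mxE eqxx conjc1 mulr1 big1 ?addr0 // => k k0.
  by rewrite mxE (_ : (k : nat) == 0 = false) ?conjc0 ?mulr0 //; apply: negbTE k0.
have A0 x : (A t *m x) ord0 0 = 0.
  by rewrite mxE big1 // => k _; rewrite mxE [kernA _ _ _]kernA_row0 mul0r.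
have e0G : wnorm (wG w) e0 <= 1.
  rewrite l2_le // expr1n (bigD1 ord0) //= mxE eqxx normc1 mulr1 big1 ?addr0.
    rewrite expr_le1 ?mulr_ge0 ?w0 // /wG mul1r; exact: w_le.
  by move=> k k0; rewrite mxE (_ : (k : nat) == 0 = false) ?normc0 ?mulr0 ?expr0n //; apply: negbTE k0.
have := rx e0; rewrite ipe [X in normc X]mxE [X in _ + X]mxE A0 oppr0 addr0 => /le_trans; apply.
by rewrite ler_piMr ?(kap_ge0 n It).
Qed.

End Word.

End Dynamic.

(** * Words converge to Fourier modes *)

Lemma count_lt K rho : (\sum_(i in [pred i : 'I_K | (i < rho)%N]) 1 = minn K rho)%N.
Proof.
rewrite big_mkcond /=; elim: K => [|K IH]; first by rewrite big_ord0 min0n.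
rewrite big_ord_recr /= IH (_ : (ord_max \in _) = (K < rho)%N) //.
by case: ltnP => h; lia.
Qed.

Section Approx.
Variables (R : rcfType) (K : nat) (q : int -> R[i]) (w : nat -> R) (B : R).
Local Notation C := R[i].
Hypothesis qherm : forall k, q (- k) = conjc (q k).
Hypothesis w_ge1 : forall n, 1 <= w n.
Hypothesis w_mono : forall m n, (m <= n)%N -> w m <= w n.
Hypothesis qB : l2bound (fun k : int => w `|k|%N * normc (q k)) B.
Implicit Types (f g x y : 'cV[C]_K) (cs : seq R) (b c : R).
Local Notation M := (matM K q).
Local Notation J := (res M).
Let Mh : adj M = M := matM_herm K qherm.
Let w0 := w_ge0 w_ge1.

Lemma nrm_run_sub cs f : nrm (run q cs f - f) <= \sum_(c <- cs) nrm (J c *m f - f).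
Proof.
elim: cs f => [|c cs IH] f.
  by rewrite big_nil /= subrr /nrm -(scale0r 0) wnormZ normc0 mul0r.
rewrite big_cons.
have -> : run q (c :: cs) f - f = run q cs (J c *m f - f) + (run q cs f - f).
  by rewrite run_add run_opp addrA subrK.
by apply: (le_trans (nrmD _ _)); apply: lerD; [exact: nrm_run | exact: IH].
Qed.

Definition res_err b (rho : nat) : R :=
  b * (2 * rho%:R + 1 + 2 * (B * rho%:R)) + 2 / w rho.

(** Split f at frequency rho. On the low part J_b f1 - f1 = ib J_b M f1, and M costs at most 2 rho +
    1 + 2 B rho; on the high part J_b - 1 has norm at most 2, and the weight gives 1/w(rho). *)
Lemma res_sub b (rho : nat) f : 0 <= b -> nrm (J b *m f - f) <= res_err b rho * wnorm w f.
Proof.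
move=> b0.
have B0 : 0 <= B := l2bound_ge0 qB.
pose f1 : 'cV[C]_K := \col_i (if (i < rho)%N then f i 0 else 0).
pose f2 := f - f1.
have nf : nrm f <= wnorm w f := nrm_le_w w_ge1 f.
have wf0 : 0 <= wnorm w f := wnorm_ge0 w f.
have h1 : nrm (J b *m f1 - f1) <= b * (2 * rho%:R + 1 + 2 * (B * rho%:R)) * wnorm w f.
  have -> : J b *m f1 - f1 = (b *i) *: (J b *m (M *m f1)).
    by rewrite {1}(res_id Mh b f1) addrC addKr (res_commM Mh).
  rewrite /nrm wnormZ cm_im (ger0_norm b0) -mulrA ler_wpM2l //.
  apply: (le_trans (nrm_res Mh _ _)); rewrite matM_mul.
  apply: (le_trans (nrmB _ _)); rewrite mulrDl; apply: lerD.
    have -> : (2 * rho%:R + 1) * wnorm w f = normc ((2 * rho + 1)%:R : C) * wnorm w f.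
      by rewrite cm_nat natrD natrM.
    apply: (@le_trans _ _ (normc ((2 * rho + 1)%:R : C) * nrm f)); last by rewrite ler_wpM2l ?cm_ge0.
    rewrite -wnormZ; apply: l2_mono => i _.
    rewrite ger0_norm ?mulr_ge0 ?cm_ge0 ?one_w_ge0 // !mxE !normcM.
    rewrite ler_wpM2l ?one_w_ge0 //; case: ifP => hi; last by rewrite normc0 mulr0 mulr_ge0 ?cm_ge0.
    by rewrite ler_wpM2r ?cm_ge0 // !cm_nat ler_nat; lia.
  rewrite /nrm wnormZ (cm_nat R 2) -mulrA ler_wpM2l //.
  apply: (le_trans (nrm_matT w_ge1 qB f1)); rewrite -mulrA ler_wpM2l //.
  apply: (@le_trans _ _ (rho%:R * nrm f)); last by rewrite ler_wpM2l.
  have E : l1sum (one_w R) f1 = \sum_(i < K | (i < rho)%N) normc (f i 0).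
    rewrite [RHS]big_mkcond; apply: eq_bigr => i _; rewrite mxE /one_w mul1r.
    by case: ifP => _; rewrite ?normc0.
  rewrite E; apply: (@le_trans _ _ (\sum_(i < K | (i < rho)%N) nrm f)).
    by apply: ler_sum => i _; exact: cm_le_nrm.
  rewrite sumr_const -[leLHS]mulr_natl ler_wpM2r ?nrm_ge0 // ler_nat.
  by rewrite -sum1_card count_lt geq_minr.
have h2 : nrm (J b *m f2 - f2) <= 2 / w rho * wnorm w f.
  apply: (le_trans (nrmB _ _)).
  apply: (@le_trans _ _ (2 * nrm f2)).
    by rewrite mulr2n mulrDl mul1r lerD2r; exact: nrm_res.
  rewrite -mulrA ler_wpM2l //.
  have wr : 0 < w rho := lt_le_trans ltr01 (w_ge1 rho).
  rewrite mulrC ler_pdivlMr // mulrC -l2_scale ?w0 //.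
  apply: l2_mono => i _; rewrite ger0_norm ?mulr_ge0 ?cm_ge0 ?w0 ?one_w_ge0 // /one_w mul1r !mxE.
  case: ltnP => hi; first by rewrite subrr normc0 mulr0 mulr_ge0 ?w0 ?cm_ge0.
  by rewrite subr0 ler_wpM2r ?cm_ge0 // w_mono.
have -> : J b *m f - f = (J b *m f1 - f1) + (J b *m f2 - f2).
  have fE : f = f1 + f2 by rewrite addrC subrK.
  by rewrite {1 2}fE mulmxDr opprD addrACA.
by apply: (le_trans (nrmD _ _)); rewrite mulrDl; apply: lerD.
Qed.

Lemma nrm_lcs_sub m b rho f : 0 <= b ->
  nrm (run q (lcs m 0 b) f - f) <= 4 * res_err b rho * wnorm w f.
Proof.
move=> b0; apply: (le_trans (nrm_run_sub _ _)).
have h := res_sub rho f b0; have z : nrm (J 0 *m f - f) = 0.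
  by rewrite (res0 Mh) subrr /nrm -(scale0r 0) wnormZ normc0 mul0r.
rewrite /lcs !big_cons big_cat /= !big_cons big_nil addr0 big_nseq.
rewrite (_ : iter _ _ _ = 0); last by elim: m => //= m ->; rewrite z addr0.
rewrite add0r; move: h; set a := nrm _; rewrite -mulrA; set c := _ * _ => h.
have -> : 4 * c = c + (c + (c + c)) by ring.
by rewrite !lerD.
Qed.

End Approx.

(** * Mean value inequality *)

Section MeanValue.
Variables (R : realType) (T kappa : R) (Y : R -> R[i]).
Local Notation I := (fun t : R => 0 <= t <= T).
Hypothesis kappa0 : 0 <= kappa.
Hypothesis Yder : forall t, I t -> exists2 P : R -> R[i],
  cont I P t /\ normc (P t) <= kappa & forall s, I s -> Y s - Y t = (s - t)%:C * P s.

(** The set of x up to which the bound holds contains its supremum z, and z cannot lie before T. The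
    slack eps lets continuity of the quotient at z bound it by kappa + eps nearby. *)
Lemma mean_value_aux eps t : 0 < eps -> I t -> normc (Y t - Y 0) <= (kappa + eps) * t.
Proof.
move=> e0 /andP[t0 tT]; have T0 : 0 <= T := le_trans t0 tT.
pose k := kappa + eps; have k0 : 0 <= k by rewrite addr_ge0 // ltW.
pose S : set R := fun x => 0 <= x <= T /\ forall y, 0 <= y <= x -> normc (Y y - Y 0) <= k * y.
have S0 : S 0.
  split; first by rewrite lexx.
  move=> y /andP[y0 y1]; have -> : y = 0 by apply: le_anti; rewrite y0 y1.
  by rewrite subrr normc0 mulr0.
have supS : has_sup S.
  split; first by exists 0.
  by exists T => x [/andP[_ xT] _].
pose z := sup S.
have z0 : 0 <= z by exact: (sup_upper_bound supS).
have zT : z <= T.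
  by apply: ge_sup; [exists 0 | move=> x [/andP[_ xT] _]].
have Iz : I z by rewrite z0 zT.
have [P [cP Pz] hP] := Yder Iz.
have [d d0 hd] := cP _ e0.
have near s : I s -> `|s - z| < d -> normc (Y s - Y z) <= k * `|s - z|.
  move=> Is sz; rewrite hP // normcM cm_real mulrC ler_wpM2r //.
  rewrite -[P s](subrK (P z)) addrC; apply: (le_trans (le_normcD _ _)).
  by apply: lerD => //; exact: ltW (hd _ Is sz).
have below y : 0 <= y < z -> normc (Y y - Y 0) <= k * y.
  move=> /andP[y0 yz]; have zy : 0 < z - y by rewrite subr_gt0.
  have [x [_ hx]] := sup_adherent zy supS; rewrite opprB addrCA subrr addr0 => yx.
  by apply: hx; rewrite y0 ltW.
have hz : normc (Y z - Y 0) <= k * z.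
  have [x [Ix hx]] := sup_adherent d0 supS; rewrite -/z => xz.
  have xz1 : x <= z by apply: (sup_upper_bound supS); split.
  have /andP[x0 xT] := Ix.
  have xd : `|x - z| < d by rewrite distrC ger0_norm ?subr_ge0 //; rewrite ltrBlDr addrC -ltrBlDr.
  have -> : Y z - Y 0 = - (Y x - Y z) + (Y x - Y 0) by ring.
  apply: (le_trans (le_normcD _ _)); rewrite normcN.
  have h1 := near x Ix xd; have h2 := hx x; rewrite x0 lexx in h2.
  apply: (le_trans (lerD h1 (h2 isT))).
  by rewrite distrC ger0_norm ?subr_ge0 // -mulrDr subrK.
have Sz : S z.
  split => // y /andP[y0]; rewrite le_eqVlt => /orP[/eqP->//|yz]; apply: below.
  by rewrite y0.
have [zlT|Tz] := ltP z T; last first.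
  by have [_] := Sz; apply; rewrite t0 (le_trans tT).
pose z' := Num.min T (z + d / 2).
have zz' : z < z' by rewrite lt_min zlT ltrDl divr_gt0.
suff Sz' : S z' by have := sup_upper_bound supS Sz'; rewrite leNgt zz'.
have z'T : z' <= T by rewrite ge_min lexx.
split; first by rewrite (ltW (le_lt_trans z0 zz')).
move=> y /andP[y0 yz']; have [yz|zy] := leP y z.
  by have [_] := Sz; apply; rewrite y0.
have Iy : I y by rewrite y0 (le_trans yz').
have yd : `|y - z| < d.
  rewrite ger0_norm ?subr_ge0 ?(ltW zy) // ltrBlDl.
  apply: (le_lt_trans yz'); rewrite gt_min ltrD2l ltr_pdivrMr // mulr_natr mulr2n ltrDl d0.
  by rewrite orbT.
have -> : Y y - Y 0 = (Y y - Y z) + (Y z - Y 0) by ring.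
apply: (le_trans (le_normcD _ _)); apply: (le_trans (lerD (near y Iy yd) hz)).
by rewrite ger0_norm ?subr_ge0 ?(ltW zy) // -mulrDr subrK.
Qed.

Lemma mean_value t : I t -> normc (Y t - Y 0) <= kappa * t.
Proof.
move=> It; apply/ler_addgt0Pr => e e0; have /andP[t0 tT] := It.
have t1 : 0 < t + 1 by rewrite ltr_wpDl.
have := mean_value_aux (divr_gt0 e0 t1) It; move=> /le_trans; apply.
rewrite mulrDl lerD2l mulrAC ler_pdivrMr // ler_pM2l // lerDl ler01 //.
Qed.

End MeanValue.

(** * Dependence of the residual on the parameters *)

Section KapLimit.
Variable R : realType.

(** [kap] with the gain and the Lax error as free arguments, so that a bound can be uniform in N and
    K. *)
Fixpoint kapE (G B b : R) (m : nat) (e theta : R) n : R :=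
  if n is n'.+1 then
    4 * G * kapE G B b m e theta n' + (e * (G ^+ n' * B)) * G
    + (m + 4)%:R * (e * (G ^+ 2 * (G ^+ n' * B))) + theta * (G ^+ n' * B / b ^+ 2)
  else e.

(** The recursion is linear in e and theta. What matters is that c does not depend on m, e or theta:
    m can be chosen against c, and e against m afterwards. *)
Lemma kapE_le (G B b : R) n : 0 <= G -> 0 <= B -> exists2 c : R, 0 <= c &
  forall m e theta, 0 <= e -> 0 <= theta -> kapE G B b m e theta n <= c * ((m + 5)%:R * e + theta).
Proof.
move=> G0 B0; have bb : 0 <= b ^+ 2 := sqr_ge0 b.
elim: n => [|n [c c0 hc]].
  exists 1 => // m e th e0 th0 /=; rewrite mul1r.
  apply: (@le_trans _ _ ((m + 5)%:R * e)); last by rewrite lerDl.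
  by rewrite ler_peMl // ler1n addn_gt0 orbT.
have gB : 0 <= G ^+ n * B by rewrite mulr_ge0 ?exprn_ge0.
exists (4 * G * c + (G ^+ n * B) * G + G ^+ 2 * (G ^+ n * B) + G ^+ n * B / b ^+ 2).
  exact: addr_ge0 (addr_ge0 (addr_ge0 (mulr_ge0 (mulr_ge0 (ler0n _ 4) G0) c0)
    (mulr_ge0 gB G0)) (mulr_ge0 (exprn_ge0 2 G0) gB)) (divr_ge0 gB bb).
move=> m e th e0 th0 /=; set z := (m + 5)%:R * e + th.
have ez : e <= z.
  apply: (@le_trans _ _ ((m + 5)%:R * e)); last by rewrite lerDl.
  by rewrite ler_peMl // ler1n addn_gt0 orbT.
have mez : (m + 4)%:R * e <= z.
  apply: (@le_trans _ _ ((m + 5)%:R * e)); last by rewrite lerDl.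
  by rewrite ler_wpM2r // ler_nat leq_add2l.
have tz : th <= z by rewrite lerDr mulr_ge0.
rewrite [leRHS]mulrDl [X in _ <= X + _]mulrDl [X in _ <= X + _ + _]mulrDl; apply: lerD; last by rewrite [leRHS]mulrC ler_wpM2r // divr_ge0.
apply: lerD; last first.
  by rewrite mulrA [leRHS]mulrC ler_wpM2r // (mulr_ge0 (exprn_ge0 2 G0) gB).
apply: lerD; first by rewrite -!mulrA ler_wpM2l // ler_wpM2l // hc.
by rewrite -[leLHS]mulrA [leRHS]mulrC ler_wpM2r // (mulr_ge0 gB G0).
Qed.

Lemma inv_nat_le (x e : R) : 0 <= x -> 0 < e -> exists2 m : nat, (0 < m)%N &
  forall m' : nat, (m <= m')%N -> x / m'%:R <= e.
Proof.
move=> x0 e0; exists (Num.truncn (x / e)).+1 => // m' mm'.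
have m'0 : 0 < m'%:R :> R by rewrite ltr0n (leq_trans _ mm').
rewrite ler_pdivrMr // mulrC -ler_pdivrMr //.
apply: (@le_trans _ _ (Num.truncn (x / e)).+1%:R); last by rewrite ler_nat.
by apply: ltW; have /andP[] := truncn_itv (divr_ge0 x0 (ltW e0)).
Qed.

End KapLimit.

(** * Uniqueness for the mode equations *)

Lemma cutoff_bounds n N K1 K2 : (n <= N)%N -> let K' := maxn (maxn K1 K2) (2 * N) in
  [/\ K1 <= K'.+1, K2 <= K'.+1, 2 * N < K'.+1 & n < K'.+1]%N.
Proof. by move=> nN; split; lia. Qed.

Section Core.
Variables (R : realType) (T : R) (w tau : nat -> R) (B C1 Ct : R) (eta : nat -> R) (r : nat).
Local Notation C := R[i].
Local Notation I := (fun t : R => 0 <= t <= T).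
Hypothesis w_ge1 : forall n, 1 <= w n.
Hypothesis w_le : forall n, w n <= n.+1%:R.
Hypothesis w_mono : forall m n, (m <= n)%N -> w m <= w n.
Hypothesis w_infty : forall e : R, 0 < e -> exists rho, (w rho)^-1 <= e.
Hypothesis w_sub : forall i j : int, w (absz (i + j)) <= w `|i|%N * w `|j|%N.
Hypothesis wC1 : l2bound (fun n : nat => w n / n.+1%:R) C1.
Hypothesis tau_ge0 : forall n, 0 <= tau n.
Hypothesis tauC : l2bound (fun k : int => tau `|k|%N) Ct.
Hypothesis r_gt0 : (0 < r)%N.
Hypothesis r_large : 32 * B ^+ 2 <= r%:R.
Hypothesis eta_ge0 : forall N, 0 <= eta N.
Hypothesis eta_to0 : forall e : R, 0 < e -> exists N0, forall N, (N0 <= N)%N -> eta N <= e.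
Hypothesis eta_bound : forall N (j k : int), outside N j k ->
  1 <= eta N * (tau `|j|%N + tau (absz (k - j)%R) + tau `|k|%N) * (w `|j|%N * w (absz (k - j)%R) * w `|k|%N).

Definition conv_lim (u : R -> int -> C) (Nl : R -> int -> C) : Prop :=
  forall t k, I t -> forall d : R, 0 < d -> exists M0, forall M, (M0 <= M)%N ->
    normc (Nl t k - \sum_(j <- zrange M) u t j * u t (k - j)) <= d.

Definition mode_eq (u Nl : R -> int -> C) : Prop :=
  forall t k, I t -> exists2 P : R -> C,
    cont I P t /\ P t = 'i * k%:~R * (Nl t k - `|k|%:~R * u t k) &
    forall s, I s -> u s k - u t k = (s - t)%:C * P s.

Definition BO_data (u : R -> int -> C) : Prop :=
  [/\ forall t, I t -> l2bound (fun k : int => w `|k|%N * normc (u t k)) B,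
      forall t, I t -> forall k, u t (- k) = conjc (u t k) &
      exists2 Nl : R -> int -> C, conv_lim u Nl & mode_eq u Nl].

Section OneSolution.
Variables (u Nl : R -> int -> C).
Hypothesis uB : forall t, I t -> l2bound (fun k : int => w `|k|%N * normc (u t k)) B.
Hypothesis uherm : forall t, I t -> forall k, u t (- k) = conjc (u t k).
Hypothesis uN : conv_lim u Nl.
Hypothesis ueq : mode_eq u Nl.
Variables (N K' : nat).
Local Notation K := K'.+1.
Hypothesis NK : (2 * N < K)%N.

Definition trunc_der (t : R) (k : int) : C :=
  if (`|k| <= N)%N then 'i * k%:~R * (Nl t k - `|k|%:~R * u t k) else 0.

(** For |k| > N the truncated mode stays 0 although the convolution of truncated modes need not
    vanish; its negative is then the error. *)
Definition conv_err (t : R) (k : int) : C :=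
  (if (`|k| <= N)%N then Nl t k else 0) - conv (trunc N u t) N k.

Lemma trunc_derE t : I t -> forall k,
  trunc_der t k = BO (trunc N u t) N k + 'i * k%:~R * conv_err t k.
Proof.
move=> It k; rewrite /trunc_der /BO /conv_err /trunc; case: ifP => _; last by ring.
by ring.
Qed.

Lemma conv_extend t k M : (N <= M)%N ->
  conv (trunc N u t) N k = \sum_(j <- zrange M) trunc N u t j * trunc N u t (k - j).
Proof.
move=> NM; apply: big_supp; rewrite ?zrange_uniq // => j.
rewrite /trunc mulf_eq0 negb_or !mem_zrange => /andP[+ _].
case: ifP => [jN _|_]; last by rewrite eqxx.
by rewrite (leq_trans jN NM).
Qed.

(** Terms whose three frequencies are all at most N cancel between the modes of u^2 and the
    convolution of the truncation. One partial sum, long enough for all k in [ks], replaces the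
    series up to d. *)
Lemma conv_err_tail t : I t -> forall (d : R) (ks : seq int), 0 < d ->
  exists2 s : seq int, uniq s & forall k, k \in ks -> normc (conv_err t k) <=
    \sum_(j <- s | outside N j k) normc (u t j) * normc (u t (k - j)) + d.
Proof.
move=> It d ks d0.
have [M1 hM1] : exists M1, forall k, k \in ks -> forall M, (M1 <= M)%N ->
    normc (Nl t k - \sum_(j <- zrange M) u t j * u t (k - j)) <= d.
  elim: ks => [|k ks [M1 hM1]]; first by exists 0.
  have [M2 hM2] := uN k It d0; exists (maxn M1 M2) => k'.
  rewrite inE => /orP[/eqP->|kks] M; rewrite geq_max => /andP[m1 m2]; first exact: hM2.
  exact: hM1.
pose M := maxn N M1; have NM : (N <= M)%N by rewrite leq_max leqnn.
exists (zrange M) => [|k kks]; first exact: zrange_uniq.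
rewrite /conv_err (conv_extend t k NM).
case: ifP => kN; last first.
  rewrite sub0r normcN; apply: ler_wpDr; first exact: ltW.
  have out j : outside N j k by rewrite /outside (ltnNge N (absz k)) kN !orbT.
  rewrite [leRHS](eq_bigl xpredT) //.
  apply: (le_trans (cm_sum _ _)); apply: ler_sum => j _; rewrite normcM.
  by apply: ler_pM; rewrite ?cm_ge0 // /trunc; case: ifP; rewrite ?normc0 ?cm_ge0.
have h := hM1 k kks M (leq_maxr _ _).
set S := \sum_(j <- zrange M) u t j * u t (k - j) in h.
set Q := \sum_(j <- zrange M) _.
have -> : Nl t k - Q = (S - Q) + (Nl t k - S) by ring.
apply: (le_trans (le_normcD _ _)); apply: lerD => //.
rewrite /S /Q -sumrB; apply: (le_trans (cm_sum _ _)).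
rewrite [leRHS]big_mkcond; apply: ler_sum => j _.
rewrite /outside (ltnNge N (absz k)) kN /trunc; case: (leqP `|j| N) => jN /=; last first.
  by rewrite mul0r subr0 normcM.
case: leqP => kjN /=; first by rewrite subrr normc0.
by rewrite mulr0 subr0 normcM.
Qed.

Lemma trunc_mode t : I t -> forall k, exists2 P : R -> C, cont I P t /\ P t = trunc_der t k &
  forall s, I s -> trunc N u s k - trunc N u t k = (s - t)%:C * P s.
Proof.
move=> It k; rewrite /trunc /trunc_der; case: ifP => _; first exact: ueq.
by exists (fun=> 0) => [|s _]; [split => //; exact: cont_cst | rewrite subrr mulr0].
Qed.

Variables (t0 b theta : R) (m n rho : nat).
Hypothesis It0 : I t0.
Hypothesis hb : 0 < b <= 1.
Hypothesis m_gt0 : (0 < m)%N.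
Hypothesis Tm : T / m%:R <= theta.
Hypothesis theta1 : theta <= 1.
Hypothesis nK : (n < K)%N.

Let htheta t : I t -> `|(t - t0) / m%:R| <= theta.
Proof.
move=> /andP[a1 a2]; have /andP[c1 c2] := It0; apply: le_trans Tm.
rewrite normrM [`|m%:R^-1|]ger0_norm ?invr_ge0 // ler_wpM2r ?invr_ge0 //.
rewrite ler_norml; apply/andP; split.
  by rewrite lerNl opprB; apply: le_trans c2; rewrite lerBlDr lerDl.
by apply: le_trans a2; rewrite lerBlDr lerDl.
Qed.

Local Notation W s := (word K' N u t0 m b n s).

Lemma word_drift : normc (W t0 ord0 0 - W 0 ord0 0) <=
  kapE (Gam B C1 r b) B b m (lax_eps K N B C1 Ct (eta N)) theta n * T.
Proof.
have kE k : kap K' N B C1 Ct (eta N) r b m theta k =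
  kapE (Gam B C1 r b) B b m (lax_eps K N B C1 Ct (eta N)) theta k.
  by elim: k => //= k ->.
have wm k : w k <= w k.+1 by apply: w_mono.
have D t : I t -> exists2 P : R -> C, cont I P t /\ normc (P t) <= kap K' N B C1 Ct (eta N) r b m theta n &
  forall s, I s -> W s ord0 0 - W t ord0 0 = (s - t)%:C * P s.
  exact: (word_coef_der w_ge1 w_le wm w_sub wC1 tau_ge0 tauC r_gt0 r_large (eta_ge0 N)
    (@eta_bound N) uB uherm conv_err_tail trunc_derE trunc_mode NK hb m_gt0 theta1 htheta n).
have k0 : 0 <= kap K' N B C1 Ct (eta N) r b m theta n.
  exact: (kap_ge0 K' N r w_ge1 wC1 tauC (eta_ge0 N) uB hb htheta n It0).
have := mean_value k0 D It0; move=> /le_trans; apply.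
by rewrite -kE ler_wpM2l //; case/andP: It0.
Qed.

(** At t0 every J_a is J_0 = 1, so a letter is J_b^4 S. Replacing it by S costs 4 [res_err] times B
    for each letter, and the zeroth coordinate of S^n x is the n-th mode. *)
Lemma word_approx : normc (W t0 ord0 0 - u t0 n%:Z) <=
  n%:R * (4 * res_err w B b rho * B) + (if (n <= N)%N then 0 else normc (u t0 n%:Z)).
Proof.
have qh := trunc_herm N uherm It0.
have qB := trunc_l2 N w_ge1 uB It0.
have b0 : 0 <= b by case/andP: hb => /ltW.
have wm k : w k <= w k.+1 by apply: w_mono.
pose y j : 'cV[C]_K := iter j (mulmx (matS R K)) (initv K' N u t0).
have yB j : wnorm w (y j) <= B.
  elim: j => [|j IH] /=; last first.
    by apply: (le_trans (wnorm_shift _ _)) IH => k; rewrite (w_ge0 w_ge1) wm.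
  by have := word_bound K' N w_ge1 w_le wm w_sub wC1 r_gt0 r_large uB uherm t0 m hb 0 It0; rewrite /= mul1r.
have yE j (i : 'I_K) : (i + j < K)%N -> y j i 0 = trunc N u t0 (i + j)%N%:Z.
  elim: j i => [|j IH] i hij; first by rewrite addn0 mxE.
  rewrite /= matS_mul /ext (_ : (i.+1 < K)%N); last by lia.
  by rewrite IH inordK ?addSnnS //; lia.
have close j : nrm (word K' N u t0 m b j t0 - y j) <= j%:R * (4 * res_err w B b rho * B).
  elim: j => [|j IH] /=; first by rewrite subrr /nrm -(scale0r 0) wnormZ normc0 !mul0r.
  rewrite /letter subrr mul0r.
  set x := word _ _ _ _ _ _ j _ in IH *.
  have -> : run (trunc N u t0) (lcs m 0 b) (matS R K *m x) - matS R K *m y j =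
     run (trunc N u t0) (lcs m 0 b) (matS R K *m (x - y j)) +
     (run (trunc N u t0) (lcs m 0 b) (matS R K *m y j) - matS R K *m y j).
    by rewrite mulmxBr run_add run_opp addrA subrK.
  apply: (le_trans (nrmD _ _)); rewrite -natr1 mulrDl mul1r; apply: lerD.
    apply: (le_trans (nrm_run qh _ _)); apply: le_trans IH.
    by apply: wnorm_shift => k; rewrite one_w_ge0 lexx.
  apply: (le_trans (nrm_lcs_sub qh w_ge1 w_mono qB m rho _ b0)).
  rewrite ler_wpM2l ?(yB j.+1) // mulr_ge0 // addr_ge0 //.
    rewrite mulr_ge0 // !addr_ge0 ?mulr_ge0 //; exact: l2bound_ge0 qB.
  by rewrite divr_ge0 // (w_ge0 w_ge1).
have -> : W t0 ord0 0 - u t0 n%:Z = (W t0 - y n) ord0 0 + (trunc N u t0 n%:Z - u t0 n%:Z).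
  by rewrite [(W t0 - y n) ord0 0]mxE [X in _ + X + _]mxE yE // add0n addrA subrK.
apply: (le_trans (le_normcD _ _)); apply: lerD.
  exact: le_trans (cm_le_nrm _ _) (close n).
rewrite /trunc absz_nat; case: ifP => _; first by rewrite subrr normc0.
by rewrite sub0r normcN.
Qed.

End OneSolution.

Lemma word_eq (u v : R -> int -> C) N K' t0 m b n s : u s = v s ->
  word K' N u t0 m b n s = word K' N v t0 m b n s.
Proof.
move=> uv; have tE : trunc N u s = trunc N v s by rewrite /trunc uv.
elim: n => [|n IH] /=; first by apply/matrixP => i j; rewrite !mxE tE.
by rewrite /letter tE IH.
Qed.

(** Choices are made against the order of the limits: rho, b against rho, m against the constant of
    [kapE_le] (which depends on b), N against m, and K against N. A third of the allowed Lax error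
    goes to each term of [lax_eps]. *)
Lemma params_exist (q : int -> C) (n : nat) (e : R) :
  l2bound (fun k : int => w `|k|%N * normc (q k)) B -> 0 <= T -> 0 < e ->
  exists b m N K' rho, [/\ 0 < b <= 1, (0 < m)%N, T / m%:R <= 1 &
    [/\ (2 * N < K'.+1)%N, (n < K'.+1)%N, (n <= N)%N,
    n%:R * (4 * res_err w B b rho * B) <= e &
    kapE (Gam B C1 r b) B b m (lax_eps K'.+1 N B C1 Ct (eta N)) (T / m%:R) n * T <= e]].
Proof.
move=> qB T0 e0.
have B0 := l2bound_ge0 qB.
have C10 := l2bound_ge0 wC1.
have Ct0 := l2bound_ge0 tauC.
pose x := n%:R * 4 * B; have x0 : 0 <= x by rewrite mulr_ge0 // mulr_ge0.
have small (y e' : R) : 0 <= y -> 0 < e' -> exists2 d : R, 0 < d & y * d <= e'.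
  move=> y0 e'0; exists (e' / (y + 1)); first by rewrite divr_gt0 // ltr_wpDl.
  by rewrite mulrCA ger_pMr // ler_pdivrMr ?ltr_wpDl // mul1r lerDl.
have e20 : 0 < e / 2 by rewrite divr_gt0.
have [d1 d10 hd1] := small (x * 2) (e / 2) (mulr_ge0 x0 (ler0n _ 2)) e20.
have [rho hrho] := w_infty d10.
pose y := 2 * rho%:R + 1 + 2 * (B * rho%:R).
have y0 : 0 <= y by rewrite /y !addr_ge0 ?mulr_ge0.
have [b1 b10 hb1] := small (x * y) (e / 2) (mulr_ge0 x0 y0) e20.
pose b := Num.min 1 b1.
have hb : 0 < b <= 1 by rewrite lt_min ltr01 b10 ge_min lexx.
have hb2 : b <= b1 by rewrite ge_min lexx orbT.
have xerr : n%:R * (4 * res_err w B b rho * B) <= e.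
  have -> : n%:R * (4 * res_err w B b rho * B) = x * y * b + x * 2 * (w rho)^-1.
    by rewrite /x /y /res_err; ring.
  rewrite (splitr e); apply: lerD.
    by apply: le_trans hb1; rewrite ler_wpM2l // mulr_ge0.
  by apply: le_trans hd1; rewrite ler_wpM2l // mulr_ge0.
have G0 : 0 <= Gam B C1 r b.
  exact: le_trans ler01 (Gam_ge1 r qB wC1 hb).
have [c c0 hc] := kapE_le b n G0 B0.
have cT0 : 0 <= c * T by rewrite mulr_ge0.
have [d2 d20 hd2] := small (c * T) (e / 2) cT0 e20.
have [m1 m10 hm1] := inv_nat_le T0 d20.
have [m2 m20 hm2] := inv_nat_le T0 ltr01.
pose m := maxn m1 m2.
have mp : (0 < m)%N by rewrite leq_max m10.
have [d3 d30 hd3] := small (c * T * (m + 5)%:R) (e / 2) (mulr_ge0 cT0 (ler0n _ _)) e20.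
have d33 : 0 < d3 / 3 by rewrite divr_gt0.
have f0 : 0 <= 12 * Ct * C1 * B ^+ 2 by rewrite !mulr_ge0.
have [d4 d40 hd4] := small _ _ f0 d33.
have [N1 hN1] := eta_to0 d40.
pose N := maxn n N1.
have g0 : 0 <= 16 * N%:R ^+ 2 * N.+1%:R * B ^+ 2 by rewrite !mulr_ge0 ?exprn_ge0.
have h0 : 0 <= 4 * B * N%:R by rewrite !mulr_ge0.
have [K1 _ hK1] := inv_nat_le g0 d33.
have [K2 _ hK2] := inv_nat_le h0 d33.
pose K' := maxn (maxn K1 K2) (2 * N).
have nN : (n <= N)%N by rewrite leq_max leqnn.
have [K1K K2K NK nK] := cutoff_bounds K1 K2 nN.
exists b, m, N, K', rho; split => //.
  by apply: hm2; rewrite leq_max leqnn orbT.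
split => //.
have et : eta N <= d4 by apply: hN1; rewrite leq_max leqnn orbT.
set le := lax_eps _ _ _ _ _ _.
have led : le <= d3.
  have -> : d3 = d3 / 3 + d3 / 3 + d3 / 3 by field.
  rewrite /le /lax_eps; apply: lerD; last exact: hK2.
  apply: lerD; last exact: hK1.
  apply: le_trans hd4; rewrite [leLHS](_ : _ = 12 * Ct * C1 * B ^+ 2 * eta N); last by ring.
  by rewrite ler_wpM2l.
have le0 : 0 <= le by exact: (lax_eps_ge0 K'.+1 N wC1 tauC qB (eta_ge0 N)).
have Tm0 : 0 <= T / m%:R by rewrite divr_ge0.
apply: (@le_trans _ _ (c * ((m + 5)%:R * le + T / m%:R) * T)).
  by rewrite ler_wpM2r // hc.
have -> : c * ((m + 5)%:R * le + T / m%:R) * T = c * T * (m + 5)%:R * le + c * T * (T / m%:R) by ring.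
rewrite (splitr e); apply: lerD.
  by apply: le_trans hd3; rewrite ler_wpM2l // mulr_ge0.
by apply: le_trans hd2; rewrite ler_wpM2l // hm1 // leq_max leqnn.
Qed.

Theorem mode_unique (u v : R -> int -> C) : BO_data u -> BO_data v -> u 0 = v 0 ->
  forall t, I t -> forall n : nat, u t n%:Z = v t n%:Z.
Proof.
move=> [uB uh [Nu cu mu]] [vB vh [Nv cv mv]] uv0 t It n.
have T0 : 0 <= T by case/andP: It => /le_trans; apply.
have I0 : I 0 by apply/andP.
apply/subr0_eq/eq0_normc/le_anti; rewrite cm_ge0 andbT.
apply/ler_addgt0Pr => e e0; rewrite add0r.
have e40 : 0 < e / 4 by rewrite divr_gt0.
have [b [m [N [K' [rho [hb mp Tm [NK nK nN h1 h2]]]]]]] := params_exist n (uB _ I0) T0 e40.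
have au := word_approx uB uh NK rho It hb mp (lexx _) Tm nK.
have av := word_approx vB vh NK rho It hb mp (lexx _) Tm nK.
have du := word_drift uB uh cu mu NK n It hb mp (lexx _) Tm.
have dv := word_drift vB vh cv mv NK n It hb mp (lexx _) Tm.
rewrite nN addr0 in au av.
(* At time 0 both words are computed from the same data, which links the two solutions. *)
rewrite -(word_eq N K' t m b n uv0) in dv.
have -> : u t n%:Z - v t n%:Z =
  - (word K' N u t m b n t ord0 0 - u t n%:Z) + (word K' N u t m b n t ord0 0 - word K' N u t m b n 0 ord0 0)
  + - (word K' N v t m b n t ord0 0 - word K' N u t m b n 0 ord0 0) + (word K' N v t m b n t ord0 0 - v t n%:Z).
  by ring.
have -> : e = e / 4 + e / 4 + e / 4 + e / 4 by field.
apply: (le_trans (le_normcD _ _)); apply: lerD; last exact: le_trans av h1.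
apply: (le_trans (le_normcD _ _)); apply: lerD; last by rewrite normcN; exact: le_trans dv h2.
apply: (le_trans (le_normcD _ _)); apply: lerD; last exact: le_trans du h2.
by rewrite normcN; exact: le_trans au h1.
Qed.

End Core.

(** * Power weights over the real numbers *)

Arguments pw a%_ring_scope n%_nat_scope.

Lemma absz_add_le (i j : int) : (absz (i + j)%R <= `|i| + `|j|)%coq_nat.
Proof. lia. Qed.

(** With d half of 3s - 1/2, 2(3s - d) = 1 + (3s - 1/2) exceeds 1. The upper bound on s keeps 1 - 2s
    positive, so that n^{s-1} is square summable. *)
Lemma exponent_bounds (F : realFieldType) (s : F) : 1 / 6 < s -> s <= 1 / 4 ->
  [/\ 0 < s, 0 < (3 * s - 1 / 2) / 2, (3 * s - 1 / 2) / 2 <= s &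
    [/\ 0 < 1 - 2 * s, 0 < 3 * s - 1 / 2 & s <= 1]].
Proof. by move=> h1 h2; repeat split; lra. Qed.

Lemma sqr_bounds (F : realFieldType) (x : F) : 0 < x ->
  [/\ 0 <= 1 + x, 0 <= 2 * (1 + x), 1 + x <= (1 + x) ^+ 2 & (1 + x) + (1 + x) <= (2 * (1 + x)) ^+ 2].
Proof. by move=> x0; split; nra. Qed.

Section Weights.

Lemma sum_iota (f : nat -> R) n : sum_f_R0 f n = \sum_(i <- iota 0 n.+1) f i.
Proof. by rewrite sum_f_R0E /index_iota subn0. Qed.

Lemma zsum_zrange (f : Z -> R) M :
  sum_f_R0 (fun m => f (Z.of_nat m - Z.of_nat M)%Z) (2 * M) = \sum_(k <- zrange M) f (Z_of_int k).
Proof.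
rewrite sum_iota /zrange big_map; apply: eq_bigr => j _.
by congr f; lia.
Qed.

Lemma Zsum_cvP (f : Z -> R) l : Zsum_cv f l -> forall e : R, 0 < e ->
  exists M0, forall M, (M0 <= M)%N -> `|l - \sum_(k <- zrange M) f (Z_of_int k)| < e.
Proof.
move=> fl e /RltP e0; have [M0 hM] := fl e e0; exists M0 => M /ssrnat.leP hle.
have := hM M hle; rewrite -zsum_zrange distrC => /RltP; rewrite RdistE; exact.
Qed.

Lemma Zsum_le (f : Z -> R) l : (forall k, 0 <= f k) -> Zsum_cv f l ->
  forall s : seq int, uniq s -> \sum_(k <- s) f (Z_of_int k) <= l.
Proof.
move=> f0 fl s us; apply/ler_addgt0Pr => e e0.
have [M0 hM] := Zsum_cvP fl e0.
pose M := maxn M0 (\max_(k <- s) `|k|%N).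
have h := hM M (leq_maxl _ _).
apply: (@le_trans _ _ (\sum_(k <- zrange M) f (Z_of_int k))).
  apply: big_subset => // k ks; rewrite mem_zrange.
  by apply: leq_trans (leq_maxr _ _); exact: (@leq_bigmax_seq _ s xpredT (fun k : int => `|k|%N)).
by move: (ltW h); rewrite ler_distlC => /andP[].
Qed.

Lemma pwD a b n : pw (a + b) n = pw a n * pw b n.
Proof. exact: pw_plus. Qed.

Lemma pwN a n : pw (- a) n = (pw a n)^-1.
Proof. exact: pw_opp. Qed.

Lemma pw1 n : pw 1 n = n.+1%:R.
Proof. by rewrite -INRE; exact: pw_1. Qed.

Lemma pw_gt0 a n : 0 < pw a n.
Proof. exact/RltP/pw_pos. Qed.

Lemma pw_sqr a n : pw a n ^+ 2 = pw (2 * a) n.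
Proof. by rewrite expr2 -pwD mulrDl mul1r. Qed.

Lemma pw_sum_uniq e (s : seq nat) : 0 < e -> uniq s -> \sum_(n <- s) pw (- (1 + e)) n <= 1 + e^-1.
Proof.
move=> e0 us; pose M := (\max_(n <- s) n)%N.
apply: (@le_trans _ _ (\sum_(n <- iota 0 M.+1) pw (- (1 + e)) n)).
  apply: big_subset => // [n ns|n]; last exact/ltW/pw_gt0.
  by rewrite mem_iota /= add0n ltnS; exact: (@leq_bigmax_seq _ s xpredT id).
by rewrite -sum_iota; apply/RleP; apply: pw_sum; apply/RltP.
Qed.

Variables (s0 d : R).
Hypothesis s0_gt : 1 / 6 < s0.
Hypothesis s0_le : s0 <= 1 / 4.
Hypothesis dE : d = (3 * s0 - 1 / 2) / 2.
Local Notation w := (pw s0).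
Local Notation tau := (pw (- (3 * s0 - d))).
Local Notation eta := (pw (- d)).

Let s0_gt0 : 0 < s0. Proof. by case: (exponent_bounds s0_gt s0_le). Qed.
Let d_gt0 : 0 < d. Proof. by rewrite dE; case: (exponent_bounds s0_gt s0_le). Qed.
Let d_le : d <= s0. Proof. by rewrite dE; case: (exponent_bounds s0_gt s0_le). Qed.

Lemma pw_l2bound e a (c : R) : 0 < e -> 2 * a = - (1 + e) -> 0 <= c -> 1 + e^-1 <= c ^+ 2 ->
  l2bound (fun n : nat => pw a n) c.
Proof.
move=> e0 ae c0 ce s us; rewrite l2_le // (le_trans _ ce) //.
apply: le_trans (pw_sum_uniq e0 us); rewrite le_eqVlt; apply/orP; left; apply/eqP.
by apply: eq_bigr => n _; rewrite pw_sqr ae.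
Qed.

Lemma weight_l2 : exists C1, l2bound (fun n : nat => w n / n.+1%:R) C1.
Proof.
have [_ _ _ [e0 _ s1]] := exponent_bounds s0_gt s0_le.
have i0 : 0 < (1 - 2 * s0)^-1 by rewrite invr_gt0.
exists (1 + (1 - 2 * s0)^-1 : R) => s us.
rewrite (@l2_eq _ _ _ _ (pw (s0 - 1))); last first.
  by move=> n _; rewrite pwD pwN pw1.
have [c0 _ cc _] := sqr_bounds i0; apply: (pw_l2bound e0) us => //; by ring.
Qed.

Lemma tau_l2 : exists Ct, l2bound (fun k : int => tau `|k|%N) Ct.
Proof.
have [_ _ _ [_ e0 _]] := exponent_bounds s0_gt s0_le.
set e := 3 * s0 - 1 / 2 in e0.
have i0 : 0 < e^-1 by rewrite invr_gt0.
have [_ c0 _ cc] := sqr_bounds i0.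
exists (2 * (1 + e^-1)) => s us; rewrite l2_le //.
(* The absolute value is injective on integers of one sign, so splitting by sign costs a factor
   2. *)
have S (r : seq int) : uniq r -> {in r &, injective (fun k : int => `|k|%N)} ->
    \sum_(k <- r) tau `|k|%N ^+ 2 <= 1 + e^-1.
  move=> ur inj; rewrite -(big_map (fun k : int => `|k|%N) xpredT (fun n => tau n ^+ 2)).
  rewrite (eq_bigr (pw (- (1 + e)))); last first.
    by move=> n _; rewrite pw_sqr; congr (pw _ n); rewrite /e dE; field.
  by apply: pw_sum_uniq; rewrite // map_inj_in_uniq.
rewrite (bigID (fun k : int => 0 <= k)) /= -big_filter -[X in _ + X]big_filter.
have h1 := S [seq k <- s | 0 <= k]; have h2 := S [seq k <- s | ~~ (0 <= k)].
rewrite !filter_uniq // in h1 h2.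
apply: le_trans cc.
apply: lerD; [apply: h1 | apply: h2] => // i j; rewrite !mem_filter => /andP[hi _] /andP[hj _]; lia.
Qed.

Lemma weight_ge1 n : 1 <= w n.
Proof. by apply/RleP; apply: pw_ge1; apply/RleP/ltW. Qed.

Lemma weight_le n : w n <= n.+1%:R.
Proof. by rewrite -pw1; apply/RleP/pw_le_exp/RleP; case: (exponent_bounds s0_gt s0_le) => _ _ _ []. Qed.

Lemma weight_mono m n : (m <= n)%N -> w m <= w n.
Proof. by move=> mn; apply/RleP/pw_mono; [apply/RleP/ltW | apply/ssrnat.leP]. Qed.

Lemma pw_to0 a : 0 < a -> forall e, 0 < e -> exists N, forall n, (N <= n)%N -> pw (- a) n <= e.
Proof.
move=> /RltP a0 e /RltP e0; have [N hN] := pw_infty _ _ a0 e0.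
by exists N => n /ssrnat.leP Nn; apply/RleP; exact: hN.
Qed.

Lemma weight_infty (e : R) : 0 < e -> exists rho, (w rho)^-1 <= e.
Proof.
move=> e0; have [N hN] := pw_to0 s0_gt0 e0; exists N; rewrite -pwN; exact: hN.
Qed.

Lemma weight_sub (i j : int) : w (absz (i + j)) <= w `|i|%N * w `|j|%N.
Proof.
apply/RleP/pw_submult; [exact/RleP/ltW | exact: absz_add_le].
Qed.

(* This is where s > 1/6 is used: tau must be square summable, that is 2(3s - d) > 1 for some d > 0. *)
Lemma eta_outside N (j k : int) : outside N j k ->
  1 <= eta N * (tau `|j|%N + tau (absz (k - j)%R) + tau `|k|%N) * (w `|j|%N * w (absz (k - j)%R) * w `|k|%N).
Proof.
move=> h; apply/RleP; apply: pw_resonance; first by split; apply/RleP; rewrite // ltW.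
by case/or3P: h => /ssrnat.leP ?; [left | right; left | right; right].
Qed.

End Weights.

Lemma weight_Hs s0 s (k : int) : 0 <= s0 -> s0 <= s -> s0 <= 1 ->
  pw s0 `|k|%N ^+ 2 <= 2 * Hs_weight s (Z_of_int k).
Proof.
move=> /RleP h0 /RleP h1 /RleP h2; apply/RleP; rewrite -RpowE.
have -> : `|k|%N = Z.abs_nat (Z_of_int k) by lia.
exact: sobolev_weight.
Qed.

(** * From distributional solutions to mode equations *)

(** Compactness of [0,T] by a supremum argument; it turns continuity in time into a bound B uniform
    in time. *)
Lemma local_to_global (F : realType) (T : F) (P : F -> F -> Prop) :
  (forall t B B', B <= B' -> P t B -> P t B') ->
  (forall t0, 0 <= t0 <= T -> exists2 d : F, 0 < d & exists B, forall t, 0 <= t <= T ->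
    `|t - t0| < d -> P t B) ->
  exists B, forall t, 0 <= t <= T -> P t B.
Proof.
move=> mono loc; have [T0|Tneg] := leP 0 T; last first.
  by exists 0 => t /andP[t0 tT]; move: (le_lt_trans (le_trans t0 tT) Tneg); rewrite ltxx.
pose S : set F := fun x => 0 <= x <= T /\ exists B, forall y, 0 <= y <= x -> P y B.
have S0 : S 0.
  have [|d d0 [B hB]] := loc 0; first by rewrite lexx.
  split; first by rewrite lexx.
  exists B => y /andP[y0 y1]; have y00 : y = 0 by apply: le_anti; rewrite y0 y1.
  by apply: hB; rewrite y00 ?subrr ?normr0 // lexx.
have supS : has_sup S by split; [exists 0 | exists T => x [/andP[_ xT] _]].
pose z := sup S.
have z0 : 0 <= z by exact: (sup_upper_bound supS).
have zT : z <= T by apply: ge_sup; [exists 0 | move=> x [/andP[_ xT] _]].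
have Iz : 0 <= z <= T by rewrite z0 zT.
have [d d0 [B1 hB1]] := loc _ Iz.
have [x [/andP[x0 xT] [B2 hB2]]] := sup_adherent d0 supS; rewrite -/z => xz.
pose z' := Num.min T (z + d / 2).
have h y : 0 <= y <= z' -> P y (Num.max B1 B2).
  move=> /andP[y0 yz']; have [yx|xy] := leP y x.
    by apply: (mono _ B2); [rewrite le_max lexx orbT | apply: hB2; rewrite y0].
  apply: (mono _ B1); first by rewrite le_max lexx.
  apply: hB1; first by rewrite y0 (le_trans yz') // ge_min lexx.
  rewrite ltr_distl (lt_trans xz xy) /=; apply: (le_lt_trans yz').
  by rewrite gt_min ltrD2l ltr_pdivrMr // mulr_natr mulr2n ltrDl d0 orbT.
have z'T : z' <= T by rewrite ge_min lexx.
have Sz' : S z'.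
  split; last by exists (Num.max B1 B2).
  by rewrite z'T le_min T0 /= addr_ge0 // divr_ge0 // ltW.
have zz' : z' <= z by exact: (sup_upper_bound supS).
have Tz' : z' = T.
  have [//|lt1] := eqVneq z' T; move: zz'; rewrite leNgt lt_min ltrDl divr_gt0 // andbT.
  rewrite -leNgt => Tz; apply: le_anti; rewrite z'T le_min lexx /=.
  by apply: (le_trans Tz); rewrite lerDl divr_ge0 // ltW.
by exists (Num.max B1 B2) => t It; apply: h; rewrite Tz'.
Qed.

Definition toC (z : Cx) : R[i] := fst z +i* snd z.

Lemma toC_norm z : normc (toC z) ^+ 2 = Cnorm2 z.
Proof. by rewrite /= sqr_sqrtr ?addr_ge0 ?sqr_ge0 // !expr2. Qed.

Lemma toC_mul z w : toC (Cmul z w) = toC z * toC w.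
Proof. by []. Qed.

Lemma Hs_l2bound s0 s (c : Z -> Cx) l : 0 <= s0 -> s0 <= s -> s0 <= 1 ->
  Zsum_cv (fun k => Rmult (Hs_weight s k) (Cnorm2 (c k))) l ->
  l2bound (fun k : int => pw s0 `|k|%N * normc (toC (c (Z_of_int k)))) (Num.sqrt (2 * l)).
Proof.
move=> h0 h1 h2 hl.
have pos k : 0 <= Rmult (Hs_weight s k) (Cnorm2 (c k)).
  rewrite RmultE mulr_ge0 // -?toC_norm ?sqr_ge0 //.
  by apply/RleP; left; exact: exp_pos.
have le := Zsum_le pos hl.
have l0 : 0 <= l by have := le [::] isT; rewrite big_nil.
move=> r ur; rewrite l2_le ?sqrtr_ge0 // sqr_sqrtr ?mulr_ge0 //.
apply: (@le_trans _ _ (2 * \sum_(k <- r) Rmult (Hs_weight s (Z_of_int k)) (Cnorm2 (c (Z_of_int k))))).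
  rewrite mulr_sumr; apply: ler_sum => k _.
  by rewrite exprMn toC_norm RmultE mulrA ler_wpM2r ?weight_Hs // -toC_norm sqr_ge0.
by rewrite ler_wpM2l // le.
Qed.

Lemma Z_of_int_opp (k : int) : Z_of_int (- k) = Z.opp (Z_of_int k).
Proof. by lia. Qed.

Section Solution.
Variables (s0 s T : R) (u : R -> Z -> Cx).
Hypothesis s0_ge0 : 0 <= s0.
Hypothesis s0_le : s0 <= s.
Hypothesis s0_le1 : s0 <= 1.
Hypothesis uHs : CHs_real s T u.
Local Notation I := (fun t : R => 0 <= t <= T).
Local Notation w := (pw s0).
Definition modes t (k : int) : R[i] := toC (u t (Z_of_int k)).

Let range t : I t -> (Rle 0 t /\ Rle t T).
Proof. by move=> /andP[/RleP a /RleP b]. Qed.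

Lemma modes_herm t k : I t -> modes t (- k) = conjc (modes t k).
Proof.
move=> /range It; have [_ h] := (proj1 uHs) t It.
by rewrite /modes Z_of_int_opp h.
Qed.

Lemma modes_cont t0 e : I t0 -> 0 < e -> exists2 d : R, 0 < d & forall t, I t -> `|t - t0| < d ->
  l2bound (fun k : int => w `|k|%N * normc (modes t k - modes t0 k)) e.
Proof.
move=> /range It0 e0; have e20 : 0 < e ^+ 2 / 2 by rewrite divr_gt0 // exprn_gt0.
have /RltP e21 := e20; have [d [/RltP d0 hd]] := (proj2 uHs) t0 It0 _ e21.
exists d => // t /range It /RltP; rewrite -RabsE => tt0.
have [l [hl /RltP le]] := hd t It tt0.
move=> r ur; have := Hs_l2bound s0_ge0 s0_le s0_le1 hl ur.
move=> /le_trans; apply; rewrite -[leRHS](ger0_norm (ltW e0)) -sqrtr_sqr ler_wsqrtr //.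
by rewrite mulrC -ler_pdivlMr // ltW.
Qed.

Lemma modes_bound : exists B, forall t, I t -> l2bound (fun k : int => w `|k|%N * normc (modes t k)) B.
Proof.
apply: (local_to_global (P := fun t B => l2bound (fun k : int => w `|k|%N * normc (modes t k)) B)).
  by move=> t B B' BB h r /h /le_trans; apply.
move=> t0 It0; have [d d0 hd] := modes_cont It0 ltr01; exists d => //.
have [[l hl] _] := (proj1 uHs) t0 (range It0).
exists (1 + Num.sqrt (2 * l)) => t It tt0 r ur.
have h1 := hd t It tt0 r ur; have h2 := Hs_l2bound s0_ge0 s0_le s0_le1 hl ur.
apply: le_trans (lerD h1 h2); apply: le_trans (l2_triangle _ _ _).
apply: l2_mono => k _; rewrite ger0_norm ?mulr_ge0 ?cm_ge0 ?(ltW (pw_gt0 _ _)) //.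
rewrite -mulrDr ler_wpM2l ?(ltW (pw_gt0 _ _)) // -[X in normc X](subrK (modes t0 k)).
exact: le_normcD.
Qed.

End Solution.

Lemma toC_sum (J : Type) (r : seq J) (f : J -> Cx) :
  \sum_(j <- r) toC (f j) = (\sum_(j <- r) fst (f j)) +i* (\sum_(j <- r) snd (f j)).
Proof. by elim: r => [|j r IH]; rewrite ?big_nil // !big_cons IH. Qed.

Lemma toC_add z w : toC (Cadd z w) = toC z + toC w.
Proof. by []. Qed.

Lemma toC_scal r z : toC (Cscal r z) = r%:C * toC z.
Proof.
by rewrite /toC /=; congr (_ +i* _); rewrite !(RmultE, RplusE) mul0r ?subr0 ?addr0.
Qed.

Lemma IZR_int (k : int) : IZR (Z_of_int k) = k%:~R :> R.
Proof.
case: k => n /=; first by rewrite -INR_IZR_INZ INRE.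
by rewrite opp_IZR -INR_IZR_INZ INRE addn1 NegzE mulrNz.
Qed.

Section Equation.
Variables (s0 s T : R) (u : R -> Z -> Cx) (N : Z -> R -> Cx) (B : R).
Hypothesis s0_ge0 : 0 <= s0.
Hypothesis s0_le : s0 <= s.
Hypothesis s0_le1 : s0 <= 1.
Hypothesis T_gt0 : 0 < T.
Hypothesis uHs : CHs_real s T u.
Local Notation I := (fun t : R => 0 <= t <= T).
Local Notation w := (pw s0).
Local Notation modes := (modes u).
Hypothesis uB : forall t, I t -> l2bound (fun k : int => w `|k|%N * normc (modes t k)) B.
Hypothesis NE : forall (n : Z) t, Rle 0 t /\ Rle t T ->
  Zsum_cv (fun k => fst (Cmul (u t k) (u t (Z.sub n k)))) (fst (N n t)) /\
  Zsum_cv (fun k => snd (Cmul (u t k) (u t (Z.sub n k)))) (snd (N n t)).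
Definition square_modes t (k : int) : R[i] := toC (N (Z_of_int k) t).

Let range t : I t -> (Rle 0 t /\ Rle t T).
Proof. by move=> /andP[/RleP a /RleP b]. Qed.

Lemma square_lim : conv_lim T modes square_modes.
Proof.
move=> t k It d d0; have d20 : 0 < d / 2 by rewrite divr_gt0.
have [h1 h2] := NE (Z_of_int k) (range It).
have [M1 hM1] := Zsum_cvP h1 d20; have [M2 hM2] := Zsum_cvP h2 d20.
exists (maxn M1 M2) => M; rewrite geq_max => /andP[m1 m2].
have := hM1 M m1; have := hM2 M m2.
set f := (fun j : int => Cmul (u t (Z_of_int j)) (u t (Z.sub (Z_of_int k) (Z_of_int j)))) => k2 k1.
rewrite (eq_bigr (fun j => toC (f j))); last first.
  by move=> j _; rewrite /f toC_mul /modes; congr (_ * toC (u t _)); lia.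
rewrite toC_sum; apply: (le_trans (cm_reim _)); rewrite (splitr d).
by apply: lerD; apply: ltW; [exact: k1 | exact: k2].
Qed.

Let flat_l2 (f : int -> R[i]) b : l2bound (fun k : int => w `|k|%N * normc (f k)) b ->
  l2bound (fun k : int => normc (f k)) b.
Proof.
move=> h r /h; apply: le_trans; apply: l2_mono => k _; rewrite ger0_norm ?cm_ge0 //.
by rewrite ler_peMl ?cm_ge0 //; apply/RleP/pw_ge1/RleP.
Qed.

Lemma modes_mode_cont t0 k : I t0 -> cont I (fun t => modes t k) t0.
Proof.
move=> It0 e e0; have e20 : 0 < e / 2 by rewrite divr_gt0.
have [d d0 hd] := modes_cont s0_ge0 s0_le s0_le1 uHs It0 e20.
exists d => // t It tt0; have := flat_l2 (hd t It tt0) (s := [:: k]) isT.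
rewrite /l2 big_seq1 sqrtr_sqr ger0_norm ?cm_ge0 // => /le_lt_trans; apply.
by rewrite ltr_pdivrMr // mulr_natr mulr2n ltrDl.
Qed.

(** Write uu - u0u0 = (u - u0)u + u0(u - u0) and apply Cauchy-Schwarz to the partial sums, uniformly
    in their length. This continuity is what [weak_deriv_strong] asks of the right-hand side. *)
Lemma square_cont t0 k : I t0 -> cont I (fun t => square_modes t k) t0.
Proof.
move=> It0 e e0.
have B0 : 0 <= B := l2bound_ge0 (uB It0).
have B1 : 0 < 4 * (B + 1) by rewrite mulr_gt0 // ltr_wpDl.
pose e1 := e / (4 * (B + 1)); have e10 : 0 < e1 by rewrite divr_gt0.
have eB : e1 * B + B * e1 <= e / 2.
  rewrite [B * e1]mulrC -mulrDr /e1 mulrAC ler_pdivrMr // -mulrA ler_wpM2l ?(ltW e0) //.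
  have -> : 2^-1 * (4 * (B + 1)) = B + B + 2 by field.
  by rewrite lerDl.
have [d d0 hd] := modes_cont s0_ge0 s0_le s0_le1 uHs It0 e10.
exists d => // t It tt0.
have h := flat_l2 (hd t It tt0); have bt := flat_l2 (uB It); have b0 := flat_l2 (uB It0).
have e80 : 0 < e / 8 by rewrite divr_gt0.
have [M1 hM1] := square_lim k It e80; have [M2 hM2] := square_lim k It0 e80.
pose M := maxn M1 M2; have := hM1 M (leq_maxl _ _); have := hM2 M (leq_maxr _ _).
set S0 := \sum_(j <- _) _; set S := \sum_(j <- _) _ => k2 k1.
have SS : normc (S - S0) <= e / 2.
  apply: le_trans eB; rewrite /S /S0 -sumrB; apply: (le_trans (cm_sum _ _)).
  apply: (@le_trans _ _ (\sum_(j <- zrange M) (normc (modes t j - modes t0 j) * normc (modes t (k - j)) +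
     normc (modes t0 j) * normc (modes t (k - j) - modes t0 (k - j))))).
    apply: ler_sum => j _; rewrite -!normcM; apply: le_trans (le_normcD _ _).
    by rewrite le_eqVlt; apply/orP; left; apply/eqP; congr normc; ring.
  have inj : {in zrange M &, injective (fun j : int => k - j)} by move=> i j _ _ /addrI/oppr_inj.
  rewrite big_split; apply: lerD; apply: (le_trans (cauchy_schwarz _ _ _)).
    apply: ler_pM; rewrite ?l2_ge0 ?h ?zrange_uniq //.
    exact: (l2bound_map (U := fun j => normc (modes t j)) bt (zrange_uniq _) inj).
  apply: ler_pM; rewrite ?l2_ge0 ?b0 ?zrange_uniq //.
  exact: (l2bound_map (U := fun j => normc (modes t j - modes t0 j)) h (zrange_uniq _) inj).
have -> : square_modes t k - square_modes t0 k =
  (square_modes t k - S) + (S - S0) - (square_modes t0 k - S0) by ring.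
apply: (le_lt_trans (cmB _ _)).
apply: (le_lt_trans (lerD (le_trans (le_normcD _ _) (lerD k1 SS)) k2)).
have -> : e / 8 + e / 2 + e / 8 = e * (3 / 4) by field.
by rewrite gtr_pMr // ltr_pdivrMr // mul1r ltr_nat.
Qed.

Lemma cont_onP (F : R -> R[i]) : (forall t, I t -> cont I F t) ->
  cont_on T (fun t => complex.Re (F t)) /\ cont_on T (fun t => complex.Im (F t)).
Proof.
move=> cF; split=> t [/RleP t0 /RleP tT] e /RltP e0.
  have [|d d0 hd] := cF t _ e e0; first by rewrite t0.
  exists d; split; first exact/RltP.
  move=> x [/RleP x0 /RleP xT]; rewrite !RabsE => /RltP xt; apply/RltP.
  have Ix : I x by apply/andP.
  apply: le_lt_trans (hd x Ix xt).
  have -> : Rminus (complex.Re (F x)) (complex.Re (F t)) = complex.Re (F x - F t) by case: (F x) (F t) => a b [].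
  exact: cm_Re.
have [|d d0 hd] := cF t _ e e0; first by rewrite t0.
exists d; split; first exact/RltP.
move=> x [/RleP x0 /RleP xT]; rewrite !RabsE => /RltP xt; apply/RltP.
have Ix : I x by apply/andP.
apply: le_lt_trans (hd x Ix xt).
have -> : Rminus (complex.Im (F x)) (complex.Im (F t)) = complex.Im (F x - F t) by case: (F x) (F t) => a b [].
by case: (F x - F t) => a b /=; rewrite -sqrtr_sqr ler_wsqrtr // lerDr sqr_ge0.
Qed.

Hypothesis uN : forall n : Z,
  let G := fun t => Cadd (Cscal (IZR n) (N n t)) (Cscal (Ropp (Rmult (IZR n) (IZR (Z.abs n)))) (u t n)) in
  weak_deriv T (fun t => fst (u t n)) (fun t => Ropp (snd (G t))) /\
  weak_deriv T (fun t => snd (u t n)) (fun t => fst (G t)).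

(** The two weak equations say that u_n has derivative iG; both sides are continuous, so the lemma
    of du Bois-Reymond makes this classical, separately for real and imaginary parts. *)
Lemma modes_eq : mode_eq T modes square_modes.
Proof.
move=> t k It; have := uN (Z_of_int k).
set G := (fun t => Cadd _ _) => -[/= w1 w2].
have GE x : toC (G x) = k%:~R * (square_modes x k - `|k|%:~R * modes x k).
  rewrite /G toC_add !toC_scal IZR_int.
  have -> : Z.abs (Z_of_int k) = Z_of_int `|k| by lia.
  rewrite IZR_int RoppE RmultE rmorphN rmorphM !rmorph_int /square_modes /modes; ring.
have cG x : I x -> cont I (fun x => toC (G x)) x.
  move=> Ix; apply: (cont_ext Ix (G := fun x => k%:~R * (square_modes x k + (- `|k|%:~R) * modes x k))).
    by move=> y _; rewrite GE mulNr.
  apply: contM; first exact: cont_cst.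
  apply: contD; first exact: square_cont.
  by apply: contM; [exact: cont_cst | exact: modes_mode_cont].
have ciG x : I x -> cont I (fun x => 'i * toC (G x)) x.
  by move=> Ix; apply: contM; [exact: cont_cst | exact: cG].
have [ug1 ug2] := cont_onP (fun x Ix => @modes_mode_cont x k Ix).
have [g1 g2] := cont_onP ciG.
have e1 : (fun x => complex.Re ('i * toC (G x))) = (fun x => Ropp (snd (G x))).
  by apply/funext => x; rewrite /toC /= mul0r mul1r sub0r.
have e2 : (fun x => complex.Im ('i * toC (G x))) = (fun x => fst (G x)).
  by apply/funext => x; rewrite /toC /= mul0r mul1r add0r.
rewrite e1 in g1; rewrite e2 in g2.
have T0 : Rlt 0 T by apply/RltP.
have d1 := weak_deriv_strong _ _ _ T0 ug1 g1 w1 t (range It).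
have d2 := weak_deriv_strong _ _ _ T0 ug2 g2 w2 t (range It).
(* The difference quotient, filled in at t by its limit. *)
pose P x := if x == t then 'i * toC (G t) else
  ((complex.Re (modes x k) - complex.Re (modes t k)) / (x - t)) +i*
  ((complex.Im (modes x k) - complex.Im (modes t k)) / (x - t)).
exists P => [|x Ix]; last first.
  rewrite /P; case: eqP => [->|/eqP xt]; first by rewrite !subrr mul0r.
  have xt0 : x - t != 0 by rewrite subr_eq0.
  rewrite /modes /toC /=; simpc.
  by congr (_ +i* _); rewrite mulrC divfK.
split; last by rewrite /P eqxx GE mulrA.
move=> e e0; have e20 : 0 < e / 2 by rewrite divr_gt0.
have /RltP e21 := e20.
have [x1 [/RltP x10 h1]] := d1 _ e21; have [x2 [/RltP x20 h2]] := d2 _ e21.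
exists (Num.min x1 x2) => [|x Ix]; first by rewrite lt_min x10.
rewrite lt_min => /andP[/RltP l1 /RltP l2]; rewrite -RabsE in l1 l2.
rewrite /P eqxx; case: eqP => [_|xt]; first by rewrite subrr normc0.
apply: (le_lt_trans (cm_reim _)); rewrite (splitr e).
apply: ltrD; apply/RltP; rewrite -RabsE.
  have := h1 x (range Ix) xt l1; rewrite /toC /=.
  by rewrite RdivE RminusE !RminusE RoppE mul0r mul1r sub0r.
have := h2 x (range Ix) xt l2; rewrite /toC /=.
by rewrite RdivE RminusE !RminusE mul0r mul1r add0r.
Qed.

End Equation.

Lemma toC_inj : injective toC.
Proof. by move=> [a b] [c d] [-> ->]. Qed.

Lemma real_valued_ext (c d : Z -> Cx) : real_valued c -> real_valued d ->
  (forall n : nat, c (Z_of_int n) = d (Z_of_int n)) -> forall k, c k = d k.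
Proof.
move=> hc hd cd k; rewrite -(int_of_ZK k); case: (int_of_Z k) => n; first exact: cd.
have -> : Z_of_int (Negz n) = Z.opp (Z_of_int n.+1) by lia.
by rewrite hc hd cd.
Qed.

Lemma BO_data_of (s0 s T B : R) (u : R -> Z -> Cx) : 0 < T -> 0 <= s0 -> s0 <= s -> s0 <= 1 ->
  CHs_real s T u -> BO_sol T u ->
  (forall t, 0 <= t <= T -> l2bound (fun k : int => pw s0 `|k|%N * normc (modes u t k)) B) ->
  BO_data T (pw s0) B (modes u).
Proof.
move=> T0 h0 h1 h2 uHs [N [NE uN]] uB; split => //.
  by move=> t It k; exact: (modes_herm uHs k It).
exists (square_modes N); first exact: square_lim NE.
exact: (modes_eq h0 h1 h2 T0 uHs uB NE uN).
Qed.

Open Scope R_scope.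

Theorem theorem1p1 (s T : R) (u v : R -> Z -> Cx) :
  s > 1 / 6 -> T > 0 ->
  CHs_real s T u -> CHs_real s T v ->
  BO_sol T u -> BO_sol T v ->
  (forall k : Z, u 0 k = v 0 k) ->
  forall t : R, 0 <= t <= T -> forall k : Z, u t k = v t k.
Proof.
move=> /RltP hs /RltP T0 uHs vHs uBO vBO uv0 t rt; have [/RleP t0 /RleP tT] := rt.
Local Open Scope ring_scope.
(* Lowering s is harmless because H^s embeds in H^{s0}; a value at most 1/4 makes n^{s0-1} square
   summable. *)
have [s0 [s0_gt s0_le s0s]] : exists s0 : R, [/\ 1 / 6 < s0, s0 <= 1 / 4 & s0 <= s].
  exists (Num.min s (1 / 4)); rewrite lt_min !ge_min !lexx orbT; split => //.
  by move: hs; rewrite RdivE (IZRposE 6) INRE => ->; rewrite !div1r ltf_pV2 ?posrE // ltr_nat.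
have [s00 d0 ds [_ _ s01]] := exponent_bounds s0_gt s0_le.
have h0 := ltW s00; have It : 0 <= t <= T by rewrite t0.
pose d : R := (3 * s0 - 1 / 2) / 2; have dE : d = (3 * s0 - 1 / 2) / 2 := erefl.
rewrite -dE in d0.
have [Bu uB] := modes_bound h0 s0s s01 uHs.
have [Bv vB] := modes_bound h0 s0s s01 vHs.
pose B := Num.max Bu Bv.
have uB' x : 0 <= x <= T -> l2bound (fun k : int => pw s0 `|k|%N * normc (modes u x k)) B.
  by move=> Ix r /(uB x Ix) /le_trans; apply; rewrite le_max lexx.
have vB' x : 0 <= x <= T -> l2bound (fun k : int => pw s0 `|k|%N * normc (modes v x k)) B.
  by move=> Ix r /(vB x Ix) /le_trans; apply; rewrite le_max lexx orbT.
have B2 : 0 <= 32 * B ^+ 2 by rewrite mulr_ge0 // sqr_ge0.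
(* The size of r depends only on the uniform bound B, hence on neither N nor K. *)
have [r r0 hr] := inv_nat_le B2 ltr01.
have rB : 32 * B ^+ 2 <= r%:R by have := hr r (leqnn r); rewrite ler_pdivrMr ?ltr0n // mul1r.
have [C1 wC1] := weight_l2 s0_gt s0_le.
have [Ct tC] := tau_l2 s0_gt s0_le dE.
have [_ ru] := (proj1 uHs) t rt.
have [_ rv] := (proj1 vHs) t rt.
(* The words reach nonnegative modes only; the others follow by conjugation. *)
apply: real_valued_ext => // n; apply: toC_inj.
have eB N := @eta_outside s0 d s0_gt s0_le dE N.
have m0 : modes u 0 = modes v 0 by apply/funext => k; rewrite /modes uv0.
exact: (mode_unique (weight_ge1 s0_gt s0_le) (weight_le s0_gt s0_le) (weight_mono s0_gt s0_le)
  (weight_infty s0_gt s0_le) (weight_sub s0_gt s0_le) wC1 (fun n => ltW (pw_gt0 _ n)) tC r0 rB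
  (fun n => ltW (pw_gt0 _ n)) (pw_to0 d0) eB (BO_data_of T0 h0 s0s s01 uHs uBO uB')
  (BO_data_of T0 h0 s0s s01 vHs vBO vB') m0 It n).
Qed.
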